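(* Let $p_1,\ldots,p_{10}\in\mathbb{P}^2$ be the ten nodes of an irreducible plane sextic, let $X=\mathrm{Bl}_{p_1,\ldots,p_{10}}\mathbb{P}^2$ be the corresponding Coble surface, with exceptional curves $E_1,\ldots,E_{10}$ and $L$ the pull-back of the class of a line, and let $H=6L-2E_1-\cdots-2E_7-E_8-E_9-E_{10}$. Let $\phi:X\to\mathbb{P}^3$ be the map defined by $|H|$, birational onto a quintic surface $\overline X$, with coordinates chosen on $\mathbb{P}^3$ so that $\overline X$ has an equation $$\alpha X_0X_2^2X_3^2+\beta X_0X_1^2X_3^2+\gamma X_0X_1^2X_2^2+X_1X_2X_3\,q(X_0,X_1,X_2,X_3)=0,$$ with $\alpha,\beta,\gamma\in\mathbb{C}$ and $q$ a quadratic form. Composing $\phi$ with the cubo-cubic involution $[X_0,X_1,X_2,X_3]\mapsto[X_1X_2X_3,\,X_0X_2X_3,\,X_0X_1X_3,\,X_0X_1X_2]$ of $\mathbb{P}^3$ realizes a birational map from $X$ onto an Enriques sextic with a quartic (quadruple) point at a vertex of the coordinate tetrahedron. The linear system on $X$ realizing this birational map $X\to\mathbb{P}^3$ is $$|H'|=|9L-3E_1-\cdots-3E_7-2E_8-2E_9-2E_{10}|.$$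
   Context: All varieties are over $\mathbb{C}$. A Coble surface is a smooth rational projective surface $X$ with $h^0(\mathcal{O}_X(-K_X))=0$ and $h^0(\mathcal{O}_X(-2K_X))=1$. Write $L_{i,j}=\{X_i=X_j=0\}\subset\mathbb{P}^3$; the union $T$ of the six lines $L_{i,j}$ is the coordinate tetrahedron. An Enriques sextic is a sextic surface with double points along the six edges of $T$, i.e. with an equation $\lambda_0(X_1X_2X_3)^2+\lambda_1(X_0X_2X_3)^2+\lambda_2(X_0X_1X_3)^2+\lambda_3(X_0X_1X_2)^2+X_0X_1X_2X_3\,\hat q(X_0,X_1,X_2,X_3)=0$ with $\hat q$ a quadratic form; here it has a quartic point in the sense that $\hat q(1,0,0,0)=0$. In the coordinates chosen on $\mathbb{P}^3$: the exceptional curves $E_8,E_9,E_{10}$ are mapped isomorphically by $\phi$ onto the three edges $L_{0,1},L_{0,2},L_{0,3}$ in the plane $X_0=0$, and the strict transforms of the three plane cubics through $p_1,\ldots,p_7$ and two of $p_8,p_9,p_{10}$ (the members of $|-K_X+E_k|$, $k=8,9,10$) are mapped with degree $2$ onto the three double lines $L_{1,2},L_{1,3},L_{2,3}$ of $\overline X$. *)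

(* Defs.v *)
From mathcomp Require Export all_boot all_algebra perm reals.
From mathcomp Require Export complex mpoly.

Set Implicit Arguments.
Unset Strict Implicit.
Unset Printing Implicit Defensive.

Import GRing.Theory.
Local Open Scope ring_scope.

Section Defs.
Variable K : fieldType.

(* Points of P^(n-1) are nonzero row vectors, compared up to a nonzero scalar. *)
Definition proj_eq n (x y : 'rV[K]_n) := exists2 a : K, a != 0 & y = a *: x.

Definition irreducible_mpoly n (f : {mpoly K[n]}) :=
  (1 < msize f)%N /\
  forall g h : {mpoly K[n]}, f = g * h -> (msize g <= 1)%N \/ (msize h <= 1)%N.

(* F(a + t v) as a polynomial in t. *)
Definition taylor n (F : {mpoly K[n]}) (a v : 'rV[K]_n) : {poly K} :=
  mmap (@polyC K) (fun j => (a 0 j)%:P + v 0 j *: 'X) F.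

Definition mult_ge n (m : nat) (F : {mpoly K[n]}) (a : 'rV[K]_n) :=
  forall (v : 'rV[K]_n) (k : nat), (k < m)%N -> (taylor F a v)`_k = 0.

(* Ordinary double point: the tangent cone consists of two distinct lines. *)
Definition node (f : {mpoly K[3]}) (x : 'rV[K]_3) :=
  mult_ge 2 f x /\
  exists a b : 'rV[K]_3, \rank (col_mx a b) = 2%N /\
    forall v, (taylor f x v)`_2 = (a *m v^T) 0 0 * (b *m v^T) 0 0.

Definition ten_nodes (f : {mpoly K[3]}) (p : 'I_10 -> 'rV[K]_3) :=
  [/\ forall i, p i != 0,
      forall i j, proj_eq (p i) (p j) -> i = j
    & forall x, x != 0 -> (node f x <-> exists i, proj_eq x (p i))].

(* X is the blow-up of P^2 at the p i.  The divisor class d L - \sum_i m_i E_i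
   on X is encoded by (d, m), and H^0(X, O_X(d L - \sum_i m_i E_i)) is identified
   as usual with the forms of degree d having multiplicity >= m_i at p_i. *)
Definition sections (p : 'I_10 -> 'rV[K]_3) (d : nat) (m : 'I_10 -> nat)
    (g : {mpoly K[3]}) :=
  g \is d.-homog /\ forall i, mult_ge (m i) g (p i).

Definition basis_of_sections p d m (F : 4.-tuple {mpoly K[3]}) :=
  [/\ forall j, sections p d m (tnth F j),
      forall a : 'I_4 -> K,
        \sum_j a j *: tnth F j = 0 -> forall j, a j = 0
    & forall g, sections p d m g ->
        exists a : 'I_4 -> K, g = \sum_j a j *: tnth F j].

(* The irreducible curves on X are the strict transforms of irreducible plane
   curves and the E_i; E_i is fixed when all sections vanish to order m_i + 1
   at p_i. *)
Definition no_fixed_component p d m :=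
  (forall g : {mpoly K[3]}, (1 < msize g)%N ->
     exists2 s, sections p d m s & ~ exists u, s = u * g) /\
  (forall i, exists2 s, sections p d m s & ~ mult_ge (m i).+1 s (p i)).

(* A tuple G of forms of the same degree is a rational map P^2 -> P^3, hence a
   rational map X -> P^3; proportional tuples define the same map.  The linear
   system realizing it on X is the complete, fixed-component-free |(d, m)| with
   a basis proportional to G. *)
Definition realized_by p d m (G : 4.-tuple {mpoly K[3]}) :=
  no_fixed_component p d m /\
  exists2 Y, basis_of_sections p d m Y &
    exists2 h, h != 0 & forall j, tnth G j = h * tnth Y j.

(* The closure of the image of the rational map G has equation Q, that is, its
   homogeneous ideal is generated by Q. *)
Definition image_equation (G : 4.-tuple {mpoly K[3]}) (Q : {mpoly K[4]}) :=
  forall g : {mpoly K[4]}, g \mPo G = 0 <-> exists u, g = Q * u.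

(* Existence of a rational inverse (S_0 : S_1 : S_2) on the image. *)
Definition birational_onto_image (G : 4.-tuple {mpoly K[3]}) :=
  exists (e : nat) (S : 3.-tuple {mpoly K[4]}) (h : {mpoly K[3]}),
    [/\ h != 0, forall k, tnth S k \is e.-homog
      & forall k, tnth S k \mPo G = h * 'X_k].

Definition birational_onto G Q := image_equation G Q /\ birational_onto_image G.

Definition quintic (alpha beta gamma : K) (q : {mpoly K[4]}) : {mpoly K[4]} :=
  alpha *: ('X_0 * 'X_2 ^+ 2 * 'X_3 ^+ 2)
  + beta *: ('X_0 * 'X_1 ^+ 2 * 'X_3 ^+ 2)
  + gamma *: ('X_0 * 'X_1 ^+ 2 * 'X_2 ^+ 2)
  + 'X_1 * 'X_2 * 'X_3 * q.

Definition cubo_cubic : 4.-tuple {mpoly K[4]} :=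
  [tuple 'X_1 * 'X_2 * 'X_3; 'X_0 * 'X_2 * 'X_3;
         'X_0 * 'X_1 * 'X_3; 'X_0 * 'X_1 * 'X_2].

Definition enriques_sextic (l : 'I_4 -> K) (q : {mpoly K[4]}) : {mpoly K[4]} :=
  l 0 *: ('X_1 * 'X_2 * 'X_3) ^+ 2 + l 1 *: ('X_0 * 'X_2 * 'X_3) ^+ 2
  + l 2 *: ('X_0 * 'X_1 * 'X_3) ^+ 2 + l 3 *: ('X_0 * 'X_1 * 'X_2) ^+ 2
  + 'X_0 * 'X_1 * 'X_2 * 'X_3 * q.

(* (L_{i,j} : X_i = X_j = 0) *)
Definition edge (i j : 'I_4) (y : 'rV[K]_4) := y 0 i = 0 /\ y 0 j = 0.

(* For sections F_k of a class of degree 1 on E (the exceptional curve over x),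
   the map E -> P^3 sends the tangent direction v to the first-order terms of
   the F_k; it is induced by a linear map on K^3 / <x>, and is an isomorphism
   onto the line L_{i,j} iff that linear map is an isomorphism onto the
   corresponding plane of K^4. *)
Definition exceptional_iso_onto_edge (F : 4.-tuple {mpoly K[3]})
    (x : 'rV[K]_3) (i j : 'I_4) :=
  let D v : 'rV[K]_4 := \row_k (taylor (tnth F k) x v)`_1 in
  [/\ forall v, edge i j (D v),
      forall v, D v = 0 -> exists a, v = a *: x
    & forall y, edge i j y -> exists v, D v = y].

(* The strict transform of the plane curve c is mapped by F onto L_{i,j} with
   degree 2: the coordinates X_i, X_j pull back to 0 on the curve, and all but
   finitely many points y of L_{i,j} have exactly two preimages on it.  The
   finitely many points of the curve lying over the p i can be left out. *)
Definition degree2_onto_edge (p : 'I_10 -> 'rV[K]_3)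
    (F : 4.-tuple {mpoly K[3]}) (c : {mpoly K[3]}) (i j : 'I_4) :=
  let fiber (y : 'rV[K]_4) (x : 'rV[K]_3) :=
    [/\ x != 0, forall k, ~ proj_eq (p k) x, c.@[x 0] = 0
      & proj_eq (\row_k (tnth F k).@[x 0]) y] in
  [/\ exists u, tnth F i = c * u, exists u, tnth F j = c * u
    & exists s : seq 'rV[K]_4, forall y, y != 0 -> edge i j y ->
        (forall z, z \in s -> ~ proj_eq z y) ->
        exists x1 x2, [/\ fiber y x1, fiber y x2, ~ proj_eq x1 x2
          & forall x, fiber y x -> proj_eq x x1 \/ proj_eq x x2]].

(* Indices are shifted by one: p 0, ..., p 9, and last_index k for k : 'I_3 is the
   index of the (8 + k)-th point. *)
Definition last_index (k : 'I_3) : 'I_10 := rshift 7 k.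

Definition H_mult (i : 'I_10) : nat := if (i < 7)%N then 2%N else 1%N.
Definition H'_mult (i : 'I_10) : nat := if (i < 7)%N then 3%N else 2%N.

(* -K_X + E_k = 3 L - \sum_(i != k) E_i *)
Definition anticanonical_plus_E p (k : 'I_10) (c : {mpoly K[3]}) :=
  c != 0 /\ sections p 3 (fun i => (i != k) : nat) c.

(* Position of the coordinate tetrahedron; the matching of the curves with the
   edges is left unspecified. *)
Definition adapted_coordinates p (F : 4.-tuple {mpoly K[3]}) :=
  (exists s : 'S_3,
     [/\ exceptional_iso_onto_edge F (p (last_index (s 0))) 0 1,
         exceptional_iso_onto_edge F (p (last_index (s 1))) 0 2
       & exceptional_iso_onto_edge F (p (last_index (s 2))) 0 3]) /\
  (exists (t : 'S_3) (c : 'I_3 -> {mpoly K[3]}),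
     [/\ forall k, anticanonical_plus_E p (last_index k) (c k),
         degree2_onto_edge p F (c (t 0)) 1 2,
         degree2_onto_edge p F (c (t 1)) 1 3
       & degree2_onto_edge p F (c (t 2)) 2 3]).

End Defs.

Arguments cubo_cubic {K}.

(* Main.v *)
From HB Require Import structures.
Require Import Defs.
From mathcomp Require Import order.
From mathcomp Require boolp.
From mathcomp Require Import ring zify.

(** Let [f] be the sextic, [C_0], [C_1], [C_2] the cubics through nine of its ten nodes
    that omit one of the last three, and [F] the given basis of [|H|].

    The position of the tetrahedron forces, up to nonzero factors of the coordinates,
    [F = (f, C_0 C_1, C_0 C_2, C_1 C_2)] ([quintic_coordinates]). Hence the composition [G]
    of [F] with the cubo-cubic involution is [C_0 C_1 C_2] times
    [(C_0 C_1 C_2, f C_2, f C_1, f C_0)]. These four forms are a basis of the sections of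
    [H']: the class [H'] has degree [0] on the strict transform of the sextic, so a
    section is determined modulo multiples of [f] by its value at one more point of the
    sextic, and the cofactors of [f] lie in the net [|3L - E_1 - .. - E_7|], which is
    spanned by the [C_j]. There is no fixed component because the [C_j] have no common
    factor ([enriques_realized]).

    For the equation of the image of [G], write [q] as a combination of monomials, [l_i]
    being the coefficient of the square of [X_i]. Substituting the involution in the
    equation [Q] of the quintic gives [X_0^3 X_1^2 X_2^2 X_3^2 E], where [E] is the equation
    of an Enriques sextic with square terms [l_i] and a quadratic form without
    [X_0 ^+ 2]. So [E] vanishes on the image, and it generates the ideal of the image
    provided that no coordinate divides it, that is, provided that no [l_i] vanishes
    ([enriques_image_equation]). A rational inverse is obtained by composing that of [F]
    with the involution.

    It remains to see that the [l_i] do not vanish, unless [Q = 0], in which case [E = 0]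
    as well. If [l_3 = 0], then restricting the relation [Q (F) = 0] to the cubic [C_0]
    shows that [X_1 X_2] divides [Q]. The cofactor vanishes on the image as well, so it is
    a multiple of [Q], which is only possible for [Q = 0]. Similarly for [l_1] and
    [l_2]. If [l_0 = 0], then the quintic has a point of multiplicity four, and [F_0] is a
    rational function of the other coordinates, that is, of the [C_j]. The map to the
    plane given by the net [|3L - E_1 - .. - E_7|] would then be birational, whereas its
    degree is two ([triangle_not_birational]).

    That the net is not birational is proved without intersection theory on the blow-up.
    The tools are Bezout's inequality with multiplicities for an irreducible curve
    ([bezout_inequality]), which follows from counting the conditions imposed by multiple
    points, and unique factorisation of polynomials ([irreducible_prime]). A rational
    inverse of the net is shown to be divisible by a linear form, again and again
    ([net_not_birational]). *)

Set Implicit Arguments.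
Unset Strict Implicit.
Unset Printing Implicit Defensive.

Import Order.TTheory GRing.Theory Num.Theory.
Local Open Scope ring_scope.

(** * Unique factorisation of multivariate polynomials *)

Definition divides (R : pzSemiRingType) (p g : R) := exists v, g = p * v.

Definition prime_elt (R : pzSemiRingType) (p : R) :=
  forall g h, divides p (g * h) -> divides p g \/ divides p h.

Definition irreducible_elt (R : idomainType) (p : R) :=
  [/\ p != 0, p \isn't a GRing.unit
    & forall g h, p = g * h -> g \is a GRing.unit \/ h \is a GRing.unit].

Section Dvd.
Variable R : comNzRingType.
Implicit Types p g h : R.

Lemma dvdrr p : divides p p. Proof. by exists 1; rewrite mulr1. Qed.
Lemma dvdr0 p : divides p 0. Proof. by exists 0; rewrite mulr0. Qed.
Lemma dvdr_mulr p g h : divides p g -> divides p (g * h).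
Proof. by case=> v ->; exists (v * h); rewrite mulrA. Qed.
Lemma dvdr_mull p g h : divides p h -> divides p (g * h).
Proof. by rewrite mulrC; apply: dvdr_mulr. Qed.
Lemma dvdrD p g h : divides p g -> divides p h -> divides p (g + h).
Proof. by case=> v -> [w ->]; exists (v + w); rewrite mulrDr. Qed.
Lemma dvdrN p g : divides p g -> divides p (- g).
Proof. by case=> v ->; exists (- v); rewrite mulrN. Qed.
Lemma dvdrB p g h : divides p g -> divides p h -> divides p (g - h).
Proof. by move=> pg ph; apply/dvdrD/dvdrN. Qed.
Lemma dvdr_trans p g h : divides p g -> divides g h -> divides p h.
Proof. by case=> v -> [w ->]; exists (v * w); rewrite mulrA. Qed.
Lemma dvdr_sum p I (r : seq I) (P : pred I) (F : I -> R) :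
  (forall i, P i -> divides p (F i)) -> divides p (\sum_(i <- r | P i) F i).
Proof. by move=> H; elim/big_ind: _ => //; [exact: dvdr0|exact: dvdrD]. Qed.

End Dvd.

Section Gauss.
(** [mu] decreases under proper division: it replaces the ascending chain condition. *)
Variables (A : idomainType) (mu : A -> nat).
Hypothesis mu_lt :
  forall a b : A, a * b != 0 -> a \isn't a GRing.unit -> (mu b < mu (a * b))%N.
Hypothesis primeA : forall p : A, irreducible_elt p -> prime_elt p.

Lemma irreducible_factor (a : A) : a != 0 -> a \isn't a GRing.unit ->
  exists2 p, irreducible_elt p & divides p a.
Proof.
have [n] := ubnP (mu a); elim: n a => // n IH a le_n a0 aU.
have [irr|/boolp.not_and3P nirr] := boolp.pselect (irreducible_elt a).
  by exists a => //; apply: dvdrr.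
have [g [h [agh gU hU]]] :
    exists g h, [/\ a = g * h, g \isn't a GRing.unit & h \isn't a GRing.unit].
  apply: boolp.contrapT => nex; case: nirr => // -[] g h agh.
  have [gU|gU] := boolP (g \is a GRing.unit); first by left.
  have [hU|hU] := boolP (h \is a GRing.unit); first by right.
  by case: nex; exists g, h.
have h0 : h != 0 by apply: contraNneq a0 => h0; rewrite agh h0 mulr0.
have lt_h : (mu h < n)%N.
  by apply: leq_trans (_ : mu a <= n)%N => //; rewrite agh mu_lt -?agh.
have [p pirr ph] := IH h lt_h h0 hU.
by exists p => //; rewrite agh; apply: dvdr_mull.
Qed.

(** The leading coefficient of a multiple of [p] is a multiple of [p], so that leading
    terms can be peeled off one at a time from the factor where [p] divides them. *)
Lemma prime_elt_polyC (p : A) : prime_elt p -> prime_elt p%:P.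
Proof.
move=> pP g h; have [n] := ubnP (size g + size h).
elim: n g h => // n IH g h le_n pgh.
have [->|g0] := eqVneq g 0; first by left; apply: dvdr0.
have [->|h0] := eqVneq h 0; first by right; apply: dvdr0.
pose tl (q : {poly A}) := \poly_(i < (size q).-1) q`_i.
have qE (q : {poly A}) : q != 0 -> q = tl q + (lead_coef q)%:P * 'X^((size q).-1).
  move=> q0; apply/polyP => i; rewrite coefD coef_poly coefCM coefXn.
  case: ltngtP => [_|lt_i|->].
  - by rewrite mulr0 addr0.
  - by rewrite mulr0 addr0 nth_default // -(prednK (_ : 0 < size q)%N) ?size_poly_gt0.
  - by rewrite add0r mulr1.
have size_tl (q : {poly A}) : q != 0 -> (size (tl q) < size q)%N.
  move=> q0; apply: leq_ltn_trans (size_poly _ _) _.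
  by rewrite prednK ?size_poly_gt0.
have [v Ev] : divides p (lead_coef g * lead_coef h).
  case: pgh => u /(congr1 lead_coef); rewrite !lead_coefM lead_coefC => ->.
  by exists (lead_coef u).
have dvd_mono (q : {poly A}) c k : divides p c -> divides p%:P (c%:P * 'X^k).
  by case=> w ->; exists (w%:P * 'X^k); rewrite polyCM mulrA.
have [pg|ph] := pP (lead_coef g) (lead_coef h) (ex_intro _ v Ev).
- have pg' : divides p%:P ((lead_coef g)%:P * 'X^((size g).-1)) by apply: dvd_mono.
  have [||dg|dh] := IH (tl g) h.
  + by apply: leq_trans (_ : size g + size h <= n)%N; rewrite // ltn_add2r size_tl.
  + have -> : tl g * h = g * h - ((lead_coef g)%:P * 'X^((size g).-1)) * h.
      by rewrite -mulrBl {2}(qE g g0) addrK.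
    by apply: dvdrB => //; apply: dvdr_mulr.
  + by left; rewrite (qE g g0); apply: dvdrD.
  + by right.
- have ph' : divides p%:P ((lead_coef h)%:P * 'X^((size h).-1)) by apply: dvd_mono.
  have [||dg|dh] := IH g (tl h).
  + by apply: leq_trans (_ : size g + size h <= n)%N; rewrite // ltn_add2l size_tl.
  + have -> : g * tl h = g * h - g * ((lead_coef h)%:P * 'X^((size h).-1)).
      by rewrite -mulrBr {2}(qE h h0) addrK.
    by apply: dvdrB => //; apply: dvdr_mull.
  + by left.
  + by right; rewrite (qE h h0); apply: dvdrD.
Qed.

(** Gauss' lemma: the prime factors of [d] can be removed one at a time from [m] or
    from [q], by [prime_elt_polyC]; [d1] collects those removed from [m]. *)
Lemma split_constant (d : A) (f m q : {poly A}) : d != 0 -> d%:P * f = m * q ->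
  exists d1 m' q', [/\ d1 != 0, m = d1%:P * m' & f = m' * q'].
Proof.
have [n] := ubnP (mu d); elim: n d m q => // n IH d m q le_n d0 E.
have [dU|dU] := boolP (d \is a GRing.unit).
  exists 1, m, (d^-1%:P * q); split; rewrite ?oner_neq0 ?mul1r //.
  by rewrite mulrCA -E mulrA -polyCM mulVr // mul1r.
have [p pirr [b db]] := irreducible_factor d0 dU.
have [p0 pU _] := pirr.
have b0 : b != 0 by apply: contraNneq d0 => b0; rewrite db b0 mulr0.
have lt_b : (mu b < n)%N.
  by apply: leq_trans (_ : mu d <= n)%N => //; rewrite db mu_lt -?db.
have pC0 : p%:P != 0 by rewrite polyC_eq0.
have pmq : divides p%:P (m * q).
  by exists (b%:P * f); rewrite -E db polyCM mulrA.
have [[m1 Em]|[q1 Eq]] := prime_elt_polyC (primeA pirr) pmq.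
- have E1 : b%:P * f = m1 * q.
    by apply: (mulfI pC0); rewrite !mulrA -polyCM -db E Em.
  have [d1 [m' [q' [d10 Em1 Ef]]]] := IH b m1 q lt_b b0 E1.
  exists (p * d1), m', q'; split=> //; first by rewrite mulf_neq0.
  by rewrite Em Em1 polyCM mulrA.
- have E1 : b%:P * f = m * q1.
    by apply: (mulfI pC0); rewrite mulrA -polyCM -db E Eq mulrCA.
  exact: IH b m q1 lt_b b0 E1.
Qed.

Lemma dvd_cancel_constant (f h q : {poly A}) (d : A) :
  irreducible_elt f -> (1 < size f)%N -> d != 0 -> d%:P * h = f * q -> divides f h.
Proof.
move=> [f0 fU firr] sf d0 E.
have [d1 [m [q' [d10 Ef ->]]]] := split_constant d0 E.
have [d1U|mU] := firr _ _ Ef.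
  exists (d1%:P^-1 * q'); rewrite Ef.
  by rewrite [RHS](_ : _ = d1%:P / d1%:P * (m * q')); [rewrite divrr ?mul1r|ring].
move: sf; rewrite Ef mul_polyC size_scale //.
by move: mU; rewrite poly_unitE => /andP[/eqP->].
Qed.

(** Division by a greatest common divisor [D] of [f] and [g] is only possible up to
    constants, which [split_constant] removes: an irreducible [f] is then associated
    to [D], hence divides [g], or [D] is constant, and a Bezout relation between [f]
    and [g] shows that [f] divides [h]. *)
Theorem poly_irreducible_prime (f : {poly A}) : irreducible_elt f -> prime_elt f.
Proof.
move=> firr; have [f0 fU fP] := firr.
have [sf|sf] := leqP (size f) 1.
  have [c fE] : exists c, f = c%:P by exists f`_0; apply: size1_polyC.
  rewrite fE in f0 fU fP *; apply/prime_elt_polyC/primeA.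
  have polyCU (a : A) : (a%:P \is a GRing.unit) = (a \is a GRing.unit).
    rewrite poly_unitE size_polyC coefC /=.
    by have [->|_] := eqVneq a 0; rewrite ?unitr0 ?eqxx.
  split; rewrite -?polyCU -?(polyC_eq0 c) // => g h E.
  by rewrite -!polyCU; apply: fP; rewrite E polyCM.
move=> g h [u E].
set D := gcdp f g.
have /Pdiv.Idomain.dvdpP[[c1 q1] c10 E1] : D %| f by apply: dvdp_gcdl.
have /Pdiv.Idomain.dvdpP[[c2 q2] c20 E2] : D %| g by apply: dvdp_gcdr.
rewrite /= in c10 c20 E1 E2.
have D0 : D != 0 by rewrite gcdp_eq0 (negPf f0).
have E1' : c1%:P * f = D * q1 by rewrite mul_polyC E1 mulrC.
have [d1 [m [q [d10 ED Ef]]]] := split_constant c10 E1'.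
have [mU|qU] := fP _ _ Ef.
- right.
  have [w Dw] : exists w, D = w%:P.
    exists D`_0; apply: size1_polyC; rewrite ED mul_polyC size_scale //.
    by move: mU; rewrite poly_unitE => /andP[/eqP->].
  have w0 : w != 0 by rewrite -polyC_eq0 -Dw.
  have [[u1 v1] /= /eqpP[[e1 e2] /= /andP[e10 e20] EB]] := Bezoutp f g.
  apply: (@dvd_cancel_constant f h (e1%:P * (u1 * h + v1 * u)) (e2 * w)) => //.
    by rewrite mulf_neq0.
  rewrite polyCM -Dw mul_polyC -EB -mul_polyC.
  by transitivity (e1%:P * (u1 * f * h + v1 * (g * h))); [ring|rewrite E; ring].
- left; apply: (@dvd_cancel_constant f g (d1%:P * q2 * q^-1) c2) => //.
  rewrite mul_polyC E2 ED Ef.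
  by rewrite [RHS](_ : _ = q2 * (d1%:P * m) * (q / q)); [rewrite divrr ?mulr1|ring].
Qed.

End Gauss.

Lemma widen_ord_lift n (i : 'I_n) : widen_ord (leqnSn n) i = lift ord_max i.
Proof. by apply: val_inj; rewrite /= /bump leqNgt ltn_ord. Qed.

Section MpolyPrime.
Variable K : fieldType.

(** The inverse of [muni], which reads a polynomial in [n + 1] variables as a
    polynomial in the last one. *)
Definition mpoly_of_muni n (q : {poly {mpoly K[n]}}) : {mpoly K[n.+1]} :=
  (map_poly (@mwiden n K) q).['X_ord_max].

Lemma mpoly_of_muni_is_additive n : additive (@mpoly_of_muni n).
Proof. by move=> p q; rewrite /mpoly_of_muni raddfB /= hornerD hornerN. Qed.

Lemma mpoly_of_muni_is_multiplicative n : multiplicative (@mpoly_of_muni n).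
Proof.
by split=> [p q|]; rewrite /mpoly_of_muni ?rmorphM ?hornerM // rmorph1 hornerC.
Qed.

HB.instance Definition _ n :=
  GRing.isAdditive.Build {poly {mpoly K[n]}} {mpoly K[n.+1]} (@mpoly_of_muni n)
    (@mpoly_of_muni_is_additive n).
HB.instance Definition _ n :=
  GRing.isMultiplicative.Build {poly {mpoly K[n]}} {mpoly K[n.+1]}
    (@mpoly_of_muni n) (@mpoly_of_muni_is_multiplicative n).

Lemma mpoly_of_muniK n : cancel (@mpoly_of_muni n) (@muni n K).
Proof.
have muniX (m : 'X_{1..n.+1}) : muni ('X_[m] : {mpoly K[n.+1]}) =
    'X_[[multinom m (widen_ord (leqnSn n) i) | i < n]] *: 'X^(m ord_max).
  rewrite muniE msuppX big_seq1 mcoeffX eqxx scale1r.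
  by congr ('X_[_] *: _); apply/mnmP => i; rewrite !mnmE.
have muniW (p : {mpoly K[n]}) : muni (mwiden p) = p%:P.
  rewrite (mpolyE p) [in RHS]raddf_sum (raddf_sum (@mwiden n K)) (raddf_sum (@muni n K)).
  apply: eq_bigr => m _ /=.
  rewrite mwidenZ muniZ mwidenX muniX mnmwiden_ordmax expr0 alg_polyC.
  rewrite -mul_polyC -polyCM mul_mpolyC; congr (_ *: _)%:P.
  by congr 'X_[_]; apply/mnmP => i; rewrite mnmE mnmwiden_widen.
move=> q; elim/poly_ind: q => [|q c IH]; first by rewrite !raddf0.
have -> : mpoly_of_muni (q * 'X + c%:P) = mpoly_of_muni q * 'X_ord_max + mwiden c.
  by rewrite /mpoly_of_muni rmorphD rmorphM /= map_polyX map_polyC hornerD hornerM hornerX hornerC.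
rewrite muniD muniM IH muniW muniX mnm1E eqxx expr1 -mul_polyC; congr (_ * _ + _).
set m0 := [multinom _ | i < n].
have -> : m0 = 0%MM.
  apply/mnmP => i; rewrite mnmE mnm1E mnmE; case: eqP => // /(congr1 val) /= E.
  by move: (ltn_ord i); rewrite -E ltnn.
by rewrite mpolyX0 mul1r.
Qed.

Lemma muniK n : cancel (@muni n K) (@mpoly_of_muni n).
Proof.
move=> p; rewrite muniE raddf_sum /= [RHS](mpolyE p); apply: eq_bigr => m _.
have -> q k : mpoly_of_muni (q *: 'X^k) = mwiden q * 'X_ord_max ^+ k.
  by rewrite /mpoly_of_muni map_polyZ map_polyXn hornerZ hornerXn.
rewrite mwidenZ mwidenX -scalerAl; congr (_ *: _).
rewrite mpolyXn -mpolyXD; congr 'X_[_]; apply/mnmP => i.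
rewrite mnmDE mulmnE mnm1E; case: (unliftP ord_max i) => [j ->|->].
  rewrite -widen_ord_lift mnmwiden_widen mnmE -val_eqE /= [n == j](gtn_eqF (ltn_ord j)).
  by rewrite mul0n addn0.
by rewrite mnmwiden_ordmax eqxx mul1n.
Qed.

Lemma mpoly_unitE n (p : {mpoly K[n]}) : (p \is a GRing.unit) = (msize p == 1%N).
Proof.
apply/idP/idP => [/andP[/eqP pE pU]|/msize_poly1P[c c0 ->]].
  by rewrite pE msizeC -unitfE pU.
by rewrite rmorph_unit // unitfE.
Qed.

Lemma msize_lt_mul n (a b : {mpoly K[n]}) :
  a * b != 0 -> a \isn't a GRing.unit -> (msize b < msize (a * b))%N.
Proof.
move=> ab0; have [a0 b0] : a != 0 /\ b != 0 by apply/andP; rewrite -negb_or -mulf_eq0.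
rewrite mpoly_unitE msizeM //.
by move: a0 b0; rewrite -!msize_poly_eq0; move: (msize a) (msize b) => x y; lia.
Qed.

Lemma irreducible_eltP n (f : {mpoly K[n]}) :
  irreducible_mpoly f <-> irreducible_elt f.
Proof.
split=> [[sf fP]|[f0 fU fP]].
  have f0 : f != 0 by rewrite -msize_poly_eq0; lia.
  split; rewrite ?mpoly_unitE //; first by lia.
  move=> g h E; rewrite !mpoly_unitE; have [g0 h0] : g != 0 /\ h != 0.
    by apply/andP; rewrite -negb_or -mulf_eq0 -E.
  by case: (fP g h E) => H; [left|right]; rewrite eqn_leq H lt0n msize_poly_eq0.
split; first by move: f0 fU; rewrite -msize_poly_eq0 mpoly_unitE; case: (msize f) => [|[]].
by move=> g h /fP; rewrite !mpoly_unitE => -[]/eqP->; [left|right].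
Qed.

(** [K[X_1..X_n+1]] is [K[X_1..X_n][X]], so Gauss' lemma carries primality of
    irreducible polynomials from [n] to [n + 1] variables. *)
Theorem irreducible_prime n (f : {mpoly K[n]}) : irreducible_mpoly f -> prime_elt f.
Proof.
move/irreducible_eltP; elim: n f => [|n IH] f irr.
  have [f0 fU _] := irr; case/negP: fU; rewrite mpoly_unitE.
  rewrite eqn_leq lt0n msize_poly_eq0 f0 andbT msizeE.
  apply/bigmax_leqP_seq => m _ _; rewrite ltnS leqn0; apply/eqP.
  by rewrite mdegE big_ord0.
have muniU (p : {mpoly K[n.+1]}) : (muni p \is a GRing.unit) = (p \is a GRing.unit).
  apply/unitrP/unitrP => -[y [yp py]]; [exists (mpoly_of_muni y)|exists (muni y)].
    by split; apply: (can_inj (@muniK n)); rewrite muniM mpoly_of_muniK ?yp ?py muni1.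
  by split; rewrite -muniM ?yp ?py muni1.
have primef : prime_elt (muni f).
  apply: (poly_irreducible_prime (@msize_lt_mul n) IH).
  have [f0 fU fP] := irr.
  split; rewrite ?muniU //.
    by apply: contraNneq f0 => E; apply/eqP/(can_inj (@muniK n)); rewrite E muni0.
  move=> g h E; have := fP (mpoly_of_muni g) (mpoly_of_muni h).
  rewrite -(muniU (mpoly_of_muni g)) -(muniU (mpoly_of_muni h)) !mpoly_of_muniK.
  by apply; apply: (can_inj (@muniK n)); rewrite muniM !mpoly_of_muniK.
move=> g h [u E]; have E' : muni g * muni h = muni f * muni u.
  have /(congr1 (@muni n K)) := E.
  by rewrite (muniM g h) (muniM f u).
have back p : divides (muni f) (muni p) -> divides f p.
  case=> v E1; exists (mpoly_of_muni v).
  by apply: (can_inj (@muniK n)); rewrite muniM mpoly_of_muniK.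
by case: (primef _ _ (ex_intro _ _ E')) => /back; [left|right].
Qed.

End MpolyPrime.

Section Factorial.
Variable K : fieldType.
Implicit Types (n : nat).

Lemma msize2_irreducible n (f : {mpoly K[n]}) : msize f = 2%N -> irreducible_mpoly f.
Proof.
move=> sf; split; first by rewrite sf.
move=> g h E; have f0 : f != 0 by rewrite -msize_poly_eq0 sf.
have [g0 h0] : g != 0 /\ h != 0 by apply/andP; rewrite -negb_or -mulf_eq0 -E.
have [sg|sg] := leqP (msize g) 1; first by left.
right; move: sf sg; rewrite E msizeM //; move: (msize g) (msize h) => x y; lia.
Qed.

Lemma prime_X n (i : 'I_n) : prime_elt ('X_i : {mpoly K[n]}).
Proof. by apply/irreducible_prime/msize2_irreducible; rewrite msizeX mdeg1. Qed.

Lemma mpoly_irreducible_factor n (a : {mpoly K[n]}) : (1 < msize a)%N ->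
  exists2 p, irreducible_mpoly p & divides p a.
Proof.
move=> sa; have [||p /irreducible_eltP pirr pa] := @irreducible_factor _ _ (@msize_lt_mul K n) a.
- by rewrite -msize_poly_eq0; case: (msize a) sa.
- by rewrite mpoly_unitE; case: (msize a) sa => [|[]].
by exists p.
Qed.

Lemma dvd_msize n (p a : {mpoly K[n]}) : a != 0 -> divides p a -> (msize p <= msize a)%N.
Proof.
move=> a0 [v E]; have [p0 v0] : p != 0 /\ v != 0 by apply/andP; rewrite -negb_or -mulf_eq0 -E.
rewrite E msizeM //; move: v0; rewrite -msize_poly_eq0.
by case: (msize v) => // k _; rewrite addnS leq_addr.
Qed.

(** Refinement in a factorial ring: each irreducible factor of [a] goes to the side
    that it divides. *)
Lemma dvd_mul_split n (a x y : {mpoly K[n]}) : a != 0 -> divides a (x * y) ->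
  exists a1 a2, [/\ a = a1 * a2, divides a1 x & divides a2 y].
Proof.
have [k] := ubnP (msize a); elim: k a x y => // k IH a x y le_k a0 axy.
have [sa|sa] := leqP (msize a) 1.
  have aU : a \is a GRing.unit.
    by rewrite mpoly_unitE eqn_leq sa lt0n msize_poly_eq0.
  exists a, 1; rewrite mulr1; split=> //; last by exists y; rewrite mul1r.
  by exists (a^-1 * x); rewrite mulrA divrr // mul1r.
have [p pirr [b E]] := mpoly_irreducible_factor sa.
have [p0 b0] : p != 0 /\ b != 0 by apply/andP; rewrite -negb_or -mulf_eq0 -E.
have lt_b : (msize b < k)%N.
  apply: leq_trans (_ : msize a <= k)%N; last by [].
  rewrite E; apply: msize_lt_mul; first by rewrite -E.
  by rewrite mpoly_unitE; have [+ _] := pirr; case: (msize p) => [|[]].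
have pxy : divides p (x * y) by apply: dvdr_trans axy; exists b.
case: axy => u Eu.
have [[x' Ex]|[y' Ey]] := irreducible_prime pirr pxy.
- have bxy : divides b (x' * y).
    by exists u; apply: (mulfI p0); rewrite !mulrA -Ex -E.
  have [a1 [a2 [Eb d1 d2]]] := IH b x' y lt_b b0 bxy.
  exists (p * a1), a2; split=> //; first by rewrite E Eb mulrA.
  by case: d1 => w E1; exists w; rewrite Ex E1 mulrA.
- have bxy : divides b (x * y').
    by exists u; apply: (mulfI p0); rewrite mulrCA -Ey Eu E mulrA.
  have [a1 [a2 [Eb d1 d2]]] := IH b x y' lt_b b0 bxy.
  exists a1, (p * a2); split=> //; first by rewrite E Eb mulrCA.
  by case: d2 => w E2; exists w; rewrite Ey E2 mulrA.
Qed.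

End Factorial.

(** * Taylor expansions and multiplicities *)

Lemma rmorph_mmap n (R S T : comNzRingType) (f : {rmorphism R -> S})
    (h : 'I_n -> S) (g : {rmorphism S -> T}) (p : {mpoly R[n]}) :
  g (mmap f h p) = mmap (g \o f) (g \o h) p.
Proof.
rewrite /mmap rmorph_sum; apply: eq_bigr => m _; rewrite rmorphM; congr (_ * _).
by rewrite /mmap1 rmorph_prod; apply: eq_bigr => i _; rewrite rmorphXn.
Qed.

Lemma eq_mmap n (R S : comNzRingType) (f1 f2 : R -> S) (h1 h2 : 'I_n -> S) (p : {mpoly R[n]}) :
  f1 =1 f2 -> h1 =1 h2 -> mmap f1 h1 p = mmap f2 h2 p.
Proof.
by move=> Ef Eh; apply: eq_bigr => m _; rewrite Ef (mmap1_eq _ Eh).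
Qed.

Lemma divides_X (R : nzRingType) (p : {poly R}) : p`_0 = 0 -> divides 'X p.
Proof.
move=> p0; exists (drop_poly 1 p); rewrite -{1}(poly_take_drop 1 p) expr1 commr_polyX.
suff -> : take_poly 1 p = 0 by rewrite add0r.
by apply/polyP => -[|k]; rewrite coef_take_poly coef0.
Qed.

Lemma divides_Xn_cancel (R : idomainType) m k (p q : {poly R}) :
  divides 'X^(m + k) (p * q) -> ~ divides 'X^(m.+1) p -> divides 'X^k q.
Proof.
have base j (f g : {poly R}) : f`_0 != 0 -> divides 'X^j (f * g) -> divides 'X^j g.
  move=> f0; elim: j g => [|j IH] g [r E]; first by exists g; rewrite expr0 mul1r.
  have /divides_X[g' Eg] : g`_0 = 0.
    apply: (mulfI f0); rewrite mulr0 -coef0M E exprS -mulrA coef0M coefX mul0r //.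
  rewrite Eg in E *; have [|h ->] := IH g'; last by exists h; rewrite exprS mulrA.
  by exists r; apply: (mulfI (negbT (polyX_eq0 _))); rewrite mulrCA E exprS mulrA.
elim: m p => [|m IH] p H np.
  apply: base H; apply/eqP => /divides_X[r Er]; apply: np.
  by exists r; rewrite expr1.
have [/divides_X[p' Ep]|p0] := eqVneq p`_0 0; last first.
  apply: base p0 _; case: H => r ->; exists ('X^(m.+1) * r).
  by rewrite addnC exprD mulrA.
rewrite Ep in H np; apply: (IH p').
  case: H => r E; exists r; apply: (mulfI (negbT (polyX_eq0 _))).
  by rewrite !mulrA E addSn exprS.
case=> r E; apply: np; exists r; by rewrite E mulrA -exprS.
Qed.

Section Taylor.
Variables (K : numFieldType) (n : nat).
Implicit Types (F G : {mpoly K[n]}) (a v : 'rV[K]_n).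

Lemma poly_nat_eq0 d (p : {poly K}) : (size p <= d)%N ->
  (forall j, (j < d)%N -> p.[j%:R] = 0) -> p = 0.
Proof.
move=> sp H; apply: (@roots_geq_poly_eq0 _ p [seq j%:R | j <- iota 0 d]).
- by apply/allP => _ /mapP[j + ->]; rewrite mem_iota => /andP[_ jd]; apply/eqP/H.
- by rewrite map_inj_uniq ?iota_uniq // => i j /eqP; rewrite eqr_nat => /eqP.
- by rewrite size_map size_iota.
Qed.

Lemma meval_neq0 k (g : {mpoly K[k]}) : g != 0 -> exists v : 'I_k -> K, g.@[v] != 0.
Proof.
elim: k g => [|k IH] g g0.
  exists (fun=> 0); rewrite mevalE.
  have /msize1_polyC E : (msize g <= 1)%N.
    by rewrite msizeE; apply/bigmax_leqP_seq => m _ _; rewrite mdegE big_ord0.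
  rewrite E in g0 *; rewrite -mevalE mevalC.
  by apply: contraNneq g0 => ->; rewrite rmorph0.
have meval_widen w (c : {mpoly K[k]}) :
    (mwiden c).@[w] = c.@[fun i => w (widen_ord (leqnSn k) i)].
  rewrite (mpolyE c) (raddf_sum (@mwiden k K)) !raddf_sum; apply: eq_bigr => m _ /=.
  rewrite mwidenZ mwidenX !mevalZ !mevalX; congr (_ * _).
  rewrite big_ord_recr /= mnmwiden_ordmax expr0 mulr1; apply: eq_bigr => i _.
  by rewrite mnmwiden_widen.
have meval_muni w : g.@[w] =
    (map_poly (meval (fun i => w (widen_ord (leqnSn k) i))) (muni g)).[w ord_max].
  rewrite -{1}(muniK g) /mpoly_of_muni -(mevalXU w ord_max) -horner_map /=.
  rewrite -map_poly_comp; congr (_.[_]); first by apply: eq_map_poly => c /=.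
have q0 : muni g != 0.
  by apply: contraNneq g0 => E; apply/eqP/(can_inj (@muniK K k)); rewrite E muni0.
have [w w0] : exists w : 'I_k -> K, (lead_coef (muni g)).@[w] != 0.
  by apply: IH; rewrite lead_coef_eq0.
pose r := map_poly (meval w) (muni g).
have r0 : r != 0.
  by apply: contraNneq w0 => /(congr1 (coefp (size (muni g)).-1)); rewrite /= coef_map coef0 => ->.
have [t t0] : exists t : K, r.[t] != 0.
  apply: boolp.contrapT => nt; case/eqP: r0; apply: (@poly_nat_eq0 (size r)) => // j _.
  by apply/eqP; apply: contraT => rj; case: nt; exists j%:R.
pose u i := if unlift ord_max i is Some j then w j else t.
exists u; rewrite meval_muni {2}/u unlift_none -[X in map_poly X](_ : meval w = _) //.
rewrite /meval; congr mmap; apply: boolp.funext => i; rewrite /u.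
by rewrite widen_ord_lift liftK.
Qed.

Lemma mpoly_eval_eq0 k (g : {mpoly K[k]}) : (forall v : 'I_k -> K, g.@[v] = 0) -> g = 0.
Proof.
move=> H; apply/eqP; apply: contraT => /meval_neq0[v].
by rewrite H eqxx.
Qed.

Lemma taylorD a v : {morph (fun F => taylor F a v) : F G / F + G}.
Proof. by move=> F G; rewrite /taylor mmapD. Qed.
Lemma taylorB a v : {morph (fun F => taylor F a v) : F G / F - G}.
Proof. by move=> F G; rewrite /taylor mmapB. Qed.
Lemma taylorM a v : {morph (fun F => taylor F a v) : F G / F * G}.
Proof. by move=> F G; rewrite /taylor rmorphM. Qed.
Lemma taylorZ a v c F : taylor (c *: F) a v = c *: taylor F a v.
Proof. by rewrite /taylor mmapZ mul_polyC. Qed.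
Lemma taylorX a v i : taylor 'X_i a v = (a 0 i)%:P + v 0 i *: 'X.
Proof. by rewrite /taylor mmapX mmap1U. Qed.
Lemma taylorC a v c : taylor (c%:MP) a v = c%:P.
Proof. by rewrite /taylor mmapC. Qed.

Lemma taylor_eval F a v t : (taylor F a v).[t] = F.@[(a + t *: v) 0].
Proof.
have := rmorph_mmap (@polyC K) (fun j => (a 0 j)%:P + v 0 j *: 'X) (horner_eval t) F.
rewrite /= /horner_eval -/(taylor F a v) => ->; apply: eq_mmap => [c|i] /=; first by rewrite hornerC.
by rewrite hornerD hornerC hornerZ hornerX !mxE mulrC.
Qed.

Lemma taylor0 F a v : (taylor F a v)`_0 = F.@[a 0].
Proof. by rewrite -horner_coef0 taylor_eval scale0r addr0. Qed.

(** Taylor expansion in a direction with indeterminate coordinates: the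
    coefficients are polynomials in the direction, and the ring of expansions
    is a domain, so that multiplicities are additive. *)
Definition generic_taylor F a : {poly {mpoly K[n]}} :=
  mmap (polyC \o @mpolyC n K) (fun j => ((a 0 j)%:MP)%:P + ('X_j)%:P * 'X) F.

Lemma generic_taylorM a : {morph (generic_taylor^~ a) : F G / F * G}.
Proof. by move=> F G; rewrite /generic_taylor rmorphM. Qed.

Lemma generic_taylorE F a v k :
  (taylor F a v)`_k = ((generic_taylor F a)`_k).@[v 0].
Proof.
have := rmorph_mmap (polyC \o @mpolyC n K)
  (fun j => ((a 0 j)%:MP)%:P + ('X_j)%:P * 'X) (map_poly (meval (v 0))) F.
rewrite -/(generic_taylor F a) -coef_map => ->; apply: (congr1 (fun p : {poly K} => p`_k)).
rewrite /taylor; apply: eq_mmap => [c|i] /=; first by rewrite map_polyC /= mevalC.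
by rewrite rmorphD rmorphM /= !map_polyC map_polyX /= mevalC mevalXU mul_polyC.
Qed.

Lemma generic_taylor_homog F a k : (generic_taylor F a)`_k \is k.-homog.
Proof.
pose P (q : {poly {mpoly K[n]}}) := forall k, q`_k \is k.-homog.
have PM p q : P p -> P q -> P (p * q).
  move=> Pp Pq j; rewrite coefM rpred_sum // => i _.
  by have := dhomogM (Pp i) (Pq (j - i)%N); rewrite subnKC // -ltnS.
have PC c : P (c%:MP)%:P.
  move=> [|j]; rewrite coefC /= ?dhomog0 // -[_%:MP]mulr1 mul_mpolyC.
  by apply/dhomogZ/dhomog1.
have PD p q : P p -> P q -> P (p + q).
  by move=> Pp Pq j; rewrite coefD rpredD.
have PX i : P (('X_i)%:P * 'X).
  move=> [|[|j]]; rewrite coefMX /= ?coefC /= ?dhomog0 //.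
  by rewrite dhomogX /= mdeg1.
move: k; rewrite -/(P _) /generic_taylor /mmap.
elim/big_rec: _ => [j|m q _ Pq]; first by rewrite coef0 dhomog0.
apply: (PD) => //; apply: (PM); first exact: (PC).
rewrite /mmap1; elim/big_rec: _ => [|i {}q _ {}Pq]; first exact: (PC 1).
apply: (PM) => //; elim: (m i) => [|e IH]; first exact: (PC 1).
by rewrite exprS; apply/PM/IH/PD/PX/PC.
Qed.

Lemma size_taylor F a v d : F \is d.-homog -> (size (taylor F a v) <= d.+1)%N.
Proof.
move=> hF; rewrite /taylor /mmap.
apply: leq_trans (size_sum _ _ _) _; apply/bigmax_leqP_seq => m mF _.
rewrite mul_polyC; apply: leq_trans (size_scale_leq _ _) _.
rewrite -(dhomog_mf hF mF) /= mdegE /mmap1.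
elim/big_rec2: _ => [|i p e _ IH]; first by rewrite size_poly1.
apply: leq_trans (size_mul_leq _ _) _; rewrite -addnS.
have sl : (size ((a 0 i)%:P + v 0 i *: 'X)%R <= 2)%N.
  apply: leq_trans (size_polyD _ _) _; rewrite geq_max size_polyC.
  by rewrite (leq_trans (size_scale_leq _ _)) ?size_polyX // andbT; case: (_ != 0).
have : (size (((a 0 i)%:P + v 0 i *: 'X) ^+ m i)%R <= (m i).+1)%N.
  apply: leq_trans (size_poly_exp_leq _ _) _; rewrite ltnS.
  by rewrite -[leqRHS]mul1n leq_mul2r; case: (size _) sl => [|[|[]]]; rewrite ?orbT.
move: (size _) (size _) IH => x y; lia.
Qed.

Lemma homog_eval_scale F d (s : K) (x : 'I_n -> K) :
  F \is d.-homog -> F.@[fun i => s * x i] = s ^+ d * F.@[x].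
Proof.
move=> hF; rewrite !mevalE mulr_sumr; apply: eq_big_seq => m mF.
rewrite mulrCA; congr (_ * _); rewrite -(dhomog_mf hF mF) /= mdegE -prodrXr -big_split.
by apply: eq_bigr => i _; rewrite exprMn.
Qed.

Lemma homog_evalZ F d (s : K) (x : 'rV[K]_n) :
  F \is d.-homog -> F.@[(s *: x) 0] = s ^+ d * F.@[x 0].
Proof.
move=> hF; rewrite -(homog_eval_scale _ _ hF); apply: meval_eq => i.
by rewrite mxE.
Qed.

Lemma homog_eval_line F d a v (s r : K) : F \is d.-homog -> s != 0 ->
  F.@[(s *: a + r *: v) 0] =
  \sum_(j < d.+1) (taylor F a v)`_j * s ^+ (d - j) * r ^+ j.
Proof.
move=> hF s0; have -> : s *: a + r *: v = s *: (a + (r / s) *: v).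
  by rewrite scalerDr scalerA mulrCA divff ?mulr1.
rewrite (homog_evalZ _ _ hF) -taylor_eval (horner_coef_wide _ (size_taylor a v hF)).
rewrite mulr_sumr; apply: eq_bigr => j _.
rewrite -mulrA mulrCA; congr (_ * _).
by rewrite expr_div_n mulrCA [RHS]mulrC expfB_cond ?(negPf s0) // add0n -ltnS.
Qed.

(** The expansion of [F (s a + r v)] in [r / s] exchanges the roles of [a] and [v], so
    that the top coefficient at [a] is the constant coefficient at [v]; comparing the
    two polynomials at positive integers avoids division by zero. *)
Lemma homog_taylor_top F d a v : F \is d.-homog -> (taylor F a v)`_d = F.@[v 0].
Proof.
move=> hF; have hT := size_taylor v a hF.
pose q := \poly_(i < d.+1) (taylor F a v)`_(d - i).
have sq : (size (q - taylor F v a)%R <= d.+1)%N.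
  by apply: leq_trans (size_polyD _ _) _; rewrite size_polyN geq_max size_poly.
suff E : q - taylor F v a = 0.
  move/(congr1 (fun p : {poly K} => p`_0)): E; rewrite coefB coef_poly subn0 coef0 taylor0.
  by move/eqP; rewrite subr_eq0 => /eqP.
suff H j : (q - taylor F v a).[j.+1%:R] = 0.
  have : (q - taylor F v a) \Po ('X + 1%:P) = 0.
    apply: (@poly_nat_eq0 d.+1) => [|j _].
      by rewrite size_comp_poly2 // size_XaddC.
    rewrite horner_comp (_ : _.[j%:R] = j.+1%:R) ?H //.
    by rewrite hornerD hornerX hornerC natr1.
  by move/eqP; rewrite comp_poly2_eq0 ?size_XaddC // => /eqP.
apply/eqP; rewrite hornerD hornerN subr_eq0; apply/eqP.
rewrite taylor_eval addrC -[v]scale1r.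
rewrite (homog_eval_line _ _ _ hF) ?pnatr_eq0 //.
rewrite /q horner_poly [RHS](reindex_inj rev_ord_inj) /=; apply: eq_bigr => i _.
by rewrite expr1n mulr1 subSS subKn // -ltnS.
Qed.

Lemma mult_geP m F a : mult_ge m F a <-> divides 'X^m (generic_taylor F a).
Proof.
split=> [H|[q E] v k km]; last first.
  by rewrite generic_taylorE E coefXnM km meval0.
exists (drop_poly m (generic_taylor F a)).
rewrite -{1}(poly_take_drop m (generic_taylor F a)) mulrC.
suff -> : take_poly m (generic_taylor F a) = 0 by rewrite add0r.
apply/polyP => k; rewrite coef_take_poly coef0; case: ifP => // km.
apply: mpoly_eval_eq0 => v.
have := H (\row_i v i) k km; rewrite generic_taylorE => <-.
by apply: meval_eq => i; rewrite mxE.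
Qed.

Lemma mult_ge0 F a : mult_ge 0 F a. Proof. by []. Qed.

Lemma mult_ge1 F a : mult_ge 1 F a <-> F.@[a 0] = 0.
Proof.
split=> [/(_ 0 0%N isT)|E v [|//] _]; first by rewrite taylor0.
by rewrite taylor0.
Qed.

Lemma mult_ge_leq m k F a : (k <= m)%N -> mult_ge m F a -> mult_ge k F a.
Proof. by move=> km H v j jk; apply/H/(leq_trans jk). Qed.

Lemma mult_geD m F G a : mult_ge m F a -> mult_ge m G a -> mult_ge m (F + G) a.
Proof. by move=> HF HG v k km; rewrite taylorD coefD HF ?HG ?addr0. Qed.

Lemma mult_geZ m c F a : mult_ge m F a -> mult_ge m (c *: F) a.
Proof. by move=> HF v k km; rewrite taylorZ coefZ HF ?mulr0. Qed.

Lemma mult_geB m F G a : mult_ge m F a -> mult_ge m G a -> mult_ge m (F - G) a.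
Proof. by move=> HF HG; rewrite -scaleN1r; apply/mult_geD/mult_geZ. Qed.

Lemma mult_geM m k F G a : mult_ge m F a -> mult_ge k G a -> mult_ge (m + k) (F * G) a.
Proof.
move=> /mult_geP[p Ep] /mult_geP[q Eq]; apply/mult_geP; exists (p * q).
by rewrite generic_taylorM Ep Eq exprD mulrACA.
Qed.

Lemma mult_geMl m F G a : mult_ge m F a -> mult_ge m (F * G) a.
Proof. by move=> HF; rewrite -[m]addn0; apply: mult_geM. Qed.

Lemma mult_geMr m F G a : mult_ge m G a -> mult_ge m (F * G) a.
Proof. by rewrite mulrC; apply: mult_geMl. Qed.

Lemma mult_ge_cancel m k F G a :
  mult_ge (m + k) (F * G) a -> ~ mult_ge m.+1 F a -> mult_ge k G a.
Proof.
move=> HFG HF; apply/mult_geP.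
have {HF} HF : ~ divides 'X^(m.+1) (generic_taylor F a) by move/mult_geP.
move/mult_geP: HFG; rewrite generic_taylorM.
by move=> H; apply: (divides_Xn_cancel H HF).
Qed.

End Taylor.

(** * Homogeneous factors *)

Section HomogeneousFactor.
Variables (K : numFieldType) (n : nat).
Implicit Types F G : {mpoly K[n]}.

Lemma poly_X_order (R : nzRingType) (p : {poly R}) : p != 0 ->
  exists i q, p = 'X^i * q /\ q`_0 != 0.
Proof.
have [k] := ubnP (size p); elim: k p => // k IH p sp p0.
have [/divides_X[q E]|p00] := eqVneq p`_0 0; last by exists 0%N, p; rewrite expr0 mul1r.
have q0 : q != 0 by apply: contraNneq p0 => q0; rewrite E q0 mulr0.
have [|i [r [Eq r0]]] := IH q _ q0.
  by move: sp; rewrite E -commr_polyX size_mulX.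
by exists i.+1, r; rewrite E Eq mulrA -exprS.
Qed.

Lemma monomial_factor (R : idomainType) (p q : {poly R}) c d :
  p * q = c%:P * 'X^d -> c != 0 -> exists a i, p = a%:P * 'X^i.
Proof.
move=> E c0.
have cX0 : c%:P * 'X^d != 0 by rewrite mulf_neq0 ?polyC_eq0 ?expf_neq0 ?polyX_eq0.
have [p0 q0] : p != 0 /\ q != 0 by apply/andP; rewrite -negb_or -mulf_eq0 E.
have [i [p' [Ep p'0]]] := poly_X_order p0.
have [j [q' [Eq q'0]]] := poly_X_order q0.
have X0 k : 'X^k != 0 :> {poly R} by rewrite expf_neq0 ?polyX_eq0.
have E' : 'X^(i + j) * (p' * q') = 'X^d * c%:P.
  by rewrite exprD mulrACA -Ep -Eq E mulrC.
have pq0 : (p' * q')`_0 != 0 by rewrite coef0M mulf_neq0.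
have ijd : (i + j)%N = d.
  case: (ltngtP (i + j) d) => // lt.
  - have /(mulfI (X0 _)) Epq : 'X^(i + j) * (p' * q') = 'X^(i + j) * ('X^(d - (i + j)) * c%:P).
      by rewrite E' mulrA -exprD subnKC // ltnW.
    by move: pq0; rewrite Epq coefXnM subn_gt0 lt eqxx.
  - have /(mulfI (X0 _)) Ec : 'X^d * ('X^(i + j - d) * (p' * q')) = 'X^d * c%:P.
      by rewrite -E' mulrA -exprD subnKC // ltnW.
    have := coefC c 0; rewrite -Ec coefXnM subn_gt0 lt /= => c00.
    by move: c0; rewrite -c00 eqxx.
move: E'; rewrite ijd => /(mulfI (X0 _)) Epq.
exists p'`_0, i; rewrite {1}Ep mulrC; congr (_ * _); apply: size1_polyC.
have := size_mul_eq1 p' q'; rewrite Epq size_polyC c0 eqxx => /esym/andP[/eqP->] //.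
Qed.

Lemma generic_taylor_origin1 F : (generic_taylor F 0).[1] = F.
Proof.
have := rmorph_mmap (polyC \o @mpolyC n K)
  (fun j => ((0 : 'rV[K]_n) 0 j)%:MP%:P + ('X_j)%:P * 'X) (horner_eval 1) F.
rewrite /= /horner_eval -/(generic_taylor F 0) => ->.
rewrite -[RHS](comp_mpoly_id F); apply: eq_mmap => [c|i] /=; first by rewrite hornerC.
by rewrite mxE mpolyC0 polyC0 add0r hornerM hornerX hornerC mulr1 tnth_mktuple.
Qed.

Lemma generic_taylor_origin F d : F \is d.-homog -> generic_taylor F 0 = F%:P * 'X^d.
Proof.
move=> hF; rewrite /generic_taylor /mmap [in RHS](mpolyE F) rmorph_sum mulr_suml.
apply: eq_big_seq => m mF /=; rewrite -mul_mpolyC rmorphM /= -mulrA; congr (_ * _).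
rewrite -(dhomog_mf hF mF) /= mdegE /mmap1 mpolyXE_id rmorph_prod /= -prodrXr -big_split.
by apply: eq_bigr => i _; rewrite mxE mpolyC0 polyC0 add0r exprMn rmorphXn.
Qed.

(** The expansion of [F] at the origin records its homogeneous components as
    coefficients; that of a form is a monomial, so those of its factors are too. *)
Lemma homog_factor F G d : F * G \is d.-homog -> F * G != 0 ->
  exists d1 d2, [/\ F \is d1.-homog, G \is d2.-homog & (d1 + d2)%N = d].
Proof.
move=> hFG FG0.
have hom F1 G1 : F1 * G1 \is d.-homog -> F1 * G1 != 0 -> exists d1, F1 \is d1.-homog.
  move=> /generic_taylor_origin; rewrite generic_taylorM => E c0.
  have [a [i Ei]] := monomial_factor E c0.
  exists i; rewrite -(generic_taylor_origin1 F1).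
  have := generic_taylor_homog F1 0 i.
  by rewrite {2}Ei Ei hornerCM hornerXn expr1n mulr1 coefCM coefXn eqxx mulr1.
have [d1 h1] := hom _ _ hFG FG0.
have [d2 h2] : exists d2, G \is d2.-homog by apply: (hom G F); rewrite mulrC.
exists d1, d2; split=> //.
exact: dhomog_uniq FG0 (dhomogM h1 h2) hFG.
Qed.

Lemma homog_cofactor F G d e : F != 0 -> F \is d.-homog -> F * G \is (d + e).-homog ->
  G \is e.-homog.
Proof.
move=> F0 hF hFG; have [->|G0] := eqVneq G 0; first exact: dhomog0.
have [|d1 [d2 [h1 h2 E]]] := homog_factor hFG; first by rewrite mulf_neq0.
by move: h2 E; rewrite (dhomog_uniq F0 h1 hF) => h2 /addnI <-.
Qed.

Lemma homog_msize F d : F != 0 -> F \is d.-homog -> msize F = d.+1.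
Proof.
move=> F0 /dhomogP hF; rewrite -(mlead_deg F0); congr _.+1.
exact/hF/mlead_supp.
Qed.

End HomogeneousFactor.

(** * Linear forms and frames *)

Section Plane.
Variable K : numFieldType.
Implicit Types (a u v w x : 'rV[K]_3) (F G : {mpoly K[3]}).

Definition lin w : {mpoly K[3]} := \sum_j w 0 j *: 'X_j.
Definition dot w x : K := \sum_j w 0 j * x 0 j.

Lemma lin_homog w : lin w \is 1.-homog.
Proof. by rewrite rpred_sum // => j _; rewrite dhomogZ // dhomogX /= mdeg1. Qed.

Lemma lin_eval w x : (lin w).@[x 0] = dot w x.
Proof. by rewrite raddf_sum /=; apply: eq_bigr => j _; rewrite mevalZ mevalXU. Qed.

Lemma dotDr w x y : dot w (x + y) = dot w x + dot w y.
Proof. by rewrite -big_split; apply: eq_bigr => j _; rewrite mxE mulrDr. Qed.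
Lemma dotZr w c x : dot w (c *: x) = c * dot w x.
Proof. by rewrite mulr_sumr; apply: eq_bigr => j _; rewrite mxE mulrCA. Qed.

Lemma taylor_lin w a v : taylor (lin w) a v = (dot w a)%:P + dot w v *: 'X.
Proof.
rewrite /lin (big_morph (fun F => taylor F a v) (taylorD a v) (_ : _ = 0)); last first.
  by rewrite /taylor mmap0.
rewrite raddf_sum scaler_suml -big_split; apply: eq_bigr => j _.
by rewrite /= taylorZ taylorX scalerDr scalerA -mul_polyC -polyCM.
Qed.

Lemma lin_eq0 w : lin w = 0 -> w = 0.
Proof.
move=> E; apply/rowP => j; have := lin_eval w (delta_mx 0 j).
rewrite E meval0 /dot (bigD1 j) //= big1 => [|i ij].
  by rewrite !mxE !eqxx mulr1 addr0.
by rewrite !mxE eqxx /= (negPf ij) mulr0.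
Qed.

(** Affine coordinates at the point [a]: [lu] and [lw] are local parameters there, dual
    to the directions [u] and [w]. *)
Lemma frame a : a != 0 -> exists u w lu lw,
  [/\ forall v, exists c, v = c *: a + dot lu v *: u + dot lw v *: w,
      dot lu a = 0 /\ dot lw a = 0,
      dot lu u = 1 /\ dot lu w = 0 & dot lw u = 0 /\ dot lw w = 1].
Proof.
move=> a0; have [i ai] : exists i, a 0 i != 0.
  apply: boolp.contrapT => na; case/eqP: a0; apply/rowP => i; rewrite mxE; apply/eqP.
  by apply: contraT => ai; case: na; exists i.
pose e k : 'rV[K]_3 := delta_mx 0 k.
pose l k : 'rV[K]_3 := e k - (a 0 k / a 0 i) *: e i.
have dote k x : dot (e k) x = x 0 k.
  rewrite /dot (bigD1 k) //= big1 => [|j jk]; rewrite !mxE ?eqxx ?mul1r ?addr0 //.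
  by rewrite (negPf jk) mul0r.
have dotl k x : dot (l k) x = x 0 k - a 0 k / a 0 i * x 0 i.
  rewrite -(dote k x) -(dote i x) /l /dot mulr_sumr -sumrB; apply: eq_bigr => j _.
  by rewrite !mxE; ring.
exists (e (lift i ord0)), (e (lift i 1)), (l (lift i ord0)), (l (lift i 1)).
have il k : (i == lift i k) = false by rewrite (negPf (neq_lift i k)).
have el k k' : e k 0 k' = (k' == k)%:R by rewrite mxE eqxx.
split; last 1 first.
- by rewrite !dotl !el !il mulr0 subr0 (inj_eq lift_inj) eqxx subr0.
- move=> v; exists (v 0 i / a 0 i); apply/rowP => k.
  rewrite !mxE !dotl.
  case: (unliftP i k) => [j ->|->]; last by rewrite !il !mulr0 !addr0 divfK.
  rewrite !(inj_eq lift_inj).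
  case: j => [[|[|//]] Hj] /=.
    by rewrite (_ : Ordinal Hj = ord0); [field|apply: val_inj].
  by rewrite (_ : Ordinal Hj = 1); [field|apply: val_inj].
- by rewrite !dotl !divfK // !subrr.
- by rewrite !dotl !el !il mulr0 !subr0 !(inj_eq lift_inj) eqxx.
Qed.

Lemma linear_form_separating a b : a != 0 -> b != 0 -> ~ proj_eq a b ->
  exists2 w, dot w a = 0 & dot w b != 0.
Proof.
move=> a0 b0 nab; have [u [w [lu [lw [H [lua lwa] _ _]]]]] := frame a0.
have [E1|] := eqVneq (dot lu b) 0; last by exists lu.
have [E2|] := eqVneq (dot lw b) 0; last by exists lw.
case: nab; have [c E] := H b; exists c; last by rewrite {1}E E1 E2 !scale0r !addr0.
by apply: contraNneq b0 => c0; rewrite E E1 E2 c0 !scale0r !addr0.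
Qed.

Lemma linear_form_nonzero_at a : a != 0 -> exists w, dot w a != 0.
Proof.
move=> a0; apply: boolp.contrapT => na; case/eqP: a0; apply/rowP => i.
rewrite [RHS]mxE; apply/eqP; apply: contraT => ai; case: na; exists (delta_mx 0 i).
rewrite /dot (bigD1 i) //= big1 ?addr0 => [|j ji]; rewrite !mxE ?eqxx ?mul1r //.
by rewrite (negPf ji) mul0r.
Qed.

End Plane.

(** * Counting the conditions imposed by multiple points *)

Lemma vspace_of_closed (K : fieldType) (vT : vectType K) (P : vT -> Prop) :
  P 0 -> (forall c x y, P x -> P y -> P (c *: x + y)) ->
  exists U : {vspace vT}, forall x, x \in U <-> P x.
Proof.
move=> P0 PD.
have [U0 HU0] : exists U : {vspace vT}, forall x, x \in U -> P x.
  by exists 0%VS => x; rewrite memv0 => /eqP->.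
have [k] := ubnP (\dim (fullv : {vspace vT}) - \dim U0)%N.
elim: k U0 HU0 => // k IH U HU le_k.
have [UP|] := boolp.pselect (forall x, P x -> x \in U).
  by exists U => x; split=> [/HU|/UP].
move=> /boolp.existsNP[x /boolp.not_implyP[Px xU]].
apply: (IH (U + <[x]>)%VS).
  move=> y /memv_addP[u uU [z /vlineP[c ->] ->]].
  by rewrite addrC; apply: PD => //; apply: HU.
have sU : (U <= U + <[x]>)%VS by apply: addvSl.
have ltU : (\dim U < \dim (U + <[x]>))%N.
  rewrite ltn_neqAle dimvS // andbT; apply: contra_notN xU => /eqP dE.
  by rewrite (_ : U = U + <[x]>)%VS ?(subvP (addvSr _ _)) ?memv_line //; apply/eqP; rewrite -dimv_leqif_eq ?dE.
have := dimvS (subvf (U + <[x]>)); move: ltU le_k.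
by move: (\dim _) (\dim _) (\dim _) => b c d; lia.
Qed.

Section Forms.
Variable K : numFieldType.

Lemma dim_form n : \dim (fullv : {vspace dhomog 3 K n}) = 'C(n + 2, n).
Proof. by rewrite dimvf. Qed.

Section Jet.
Variables (n k : nat) (a u w : 'rV[K]_3).

(** The leading form at [a] of a form vanishing to order [k] there is a binary
    form of degree [k], determined by its values at [k + 1] directions. *)
Definition jet (F : dhomog 3 K n) : 'rV[K]_k.+1 :=
  \row_(j < k.+1) (taylor (val F) a (u + j%:R *: w))`_k.

Lemma jet_is_linear : linear jet.
Proof.
move=> c F G; apply/rowP => j.
by rewrite !mxE raddfD /= taylorD taylorZ coefD coefZ.
Qed.
HB.instance Definition _ := GRing.isLinear.Build K (dhomog 3 K n) 'rV[K]_k.+1 _ jet jet_is_linear.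

End Jet.

Lemma homog_plane_eq0 (G : {mpoly K[3]}) k (u w : 'rV[K]_3) (b c : K) :
  G \is k.-homog -> (forall j : 'I_k.+1, G.@[(u + j%:R *: w) 0] = 0) ->
  G.@[(b *: u + c *: w) 0] = 0.
Proof.
move=> hG H; have T0 : taylor G u w = 0.
  apply: (poly_nat_eq0 (size_taylor u w hG)) => j jk.
  by rewrite taylor_eval (H (Ordinal jk)).
have [->|b0] := eqVneq b 0.
  rewrite scale0r add0r (homog_evalZ _ _ hG) -(homog_taylor_top u w hG).
  by rewrite T0 coef0 mulr0.
rewrite (homog_eval_line u w _ hG) // big1 // => j _.
by rewrite T0 coef0 !mul0r.
Qed.

(** The leading form at [a] is invariant under translation by [a]. *)
Lemma taylor_shift (F : {mpoly K[3]}) n k (a v : 'rV[K]_3) c :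
  F \is n.-homog -> mult_ge k F a ->
  (taylor F a (v + c *: a))`_k = (taylor F a v)`_k.
Proof.
move=> hF mF; have [->|c0] := eqVneq c 0; first by rewrite scale0r addr0.
pose s : {poly K} := 1 + c *: 'X.
pose q := \sum_(j < n.+1) (taylor F a v)`_j *: (s ^+ (n - j) * 'X^j).
have E : (taylor F a (v + c *: a) - q) * s = 0.
  apply: (poly_nat_eq0 (leqnn _)) => i _; rewrite hornerM.
  have sE : s.[i%:R] = 1 + c * i%:R by rewrite !hornerE.
  have [->|s0] := eqVneq s.[i%:R] 0; first by rewrite mulr0.
  apply/eqP; rewrite mulf_eq0 (negPf s0) orbF hornerD hornerN subr_eq0; apply/eqP.
  have -> : (taylor F a (v + c *: a)).[i%:R] = F.@[(s.[i%:R] *: a + i%:R *: v) 0].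
    rewrite taylor_eval sE; apply: meval_eq => j; rewrite !mxE; ring.
  rewrite (homog_eval_line _ _ _ hF) // horner_sum; apply: eq_bigr => j _.
  by rewrite hornerZ hornerM hornerXn horner_exp mulrA.
have s0 : s != 0.
  by apply/eqP => /(congr1 (fun p : {poly K} => p`_0)); rewrite coefD coefC coefZ coefX mulr0 addr0 coef0; apply/eqP/oner_neq0.
move/eqP: E; rewrite mulf_eq0 (negPf s0) orbF subr_eq0 => /eqP->.
rewrite /q coef_sum.
have [kn|nk] := leqP k n; last first.
  rewrite big1 => [|j _]; last by rewrite (mF v j) ?scale0r ?coef0 // (leq_trans (ltn_ord j)).
  by rewrite nth_default // (leq_trans (size_taylor _ _ hF)).
rewrite (bigD1 (Ordinal (kn : k < n.+1)%N)) //= big1 => [|j jk].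
  rewrite addr0 coefZ coefMXn ltnn subnn -horner_coef0 horner_exp.
  have -> : s.[0] = 1 by rewrite /s !hornerE ?mulr0 ?addr0.
  by rewrite expr1n mulr1.
rewrite coefZ coefMXn; case: ltnP => [_|jk']; first by rewrite mulr0.
by rewrite (mF v j) ?mul0r // ltn_neqAle jk' andbT; move: jk; rewrite -val_eqE.
Qed.

(** The leading form at [a] is determined by its values at directions in a complement
    of [a], hence by [jet]. *)
Lemma mult_ge_jet (F : {mpoly K[3]}) n k (a u w lu lw : 'rV[K]_3) :
  F \is n.-homog -> (forall v, exists c, v = c *: a + dot lu v *: u + dot lw v *: w) ->
  mult_ge k F a -> (forall j : 'I_k.+1, (taylor F a (u + j%:R *: w))`_k = 0) ->
  mult_ge k.+1 F a.
Proof.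
move=> hF H mF jF v i; rewrite ltnS leq_eqVlt => /orP[/eqP->|]; last exact: mF.
have [c ->] := H v; rewrite -addrA addrC (taylor_shift _ _ hF mF) generic_taylorE.
apply: homog_plane_eq0 (generic_taylor_homog _ _ _) _ => j.
by rewrite -generic_taylorE.
Qed.

Section Mult.
Variables (N : nat) (p : 'I_N -> 'rV[K]_3).
Hypothesis p0 : forall i, p i != 0.

Lemma mult_space_exists n (kap : 'I_N -> nat) : exists U : {vspace dhomog 3 K n},
  forall F, F \in U <-> forall i, mult_ge (kap i) (val F) (p i).
Proof.
apply: vspace_of_closed => [i v k km|c F G HF HG i].
  by rewrite /= /taylor mmap0 coef0.
by rewrite raddfD /= ; apply: mult_geD => //; apply: mult_geZ.
Qed.

Definition mult_space n kap := sval (boolp.cid (mult_space_exists n kap)).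

Lemma mult_spaceP n kap F :
  F \in mult_space n kap <-> forall i, mult_ge (kap i) (val F) (p i).
Proof. exact: svalP (boolp.cid (mult_space_exists n kap)) F. Qed.

Definition raise_at kap (i : 'I_N) : 'I_N -> nat := fun j => (kap j + (j == i))%N.

(** The leading form of degree [kap i] at [p i], which has [kap i + 1] coefficients, is
    the obstruction to a higher multiplicity. *)
Lemma dim_mult_raise_le n kap i :
  (\dim (mult_space n kap) <= \dim (mult_space n (raise_at kap i)) + (kap i).+1)%N.
Proof.
have [u [w [lu [lw [H _ _ _]]]]] := frame (p0 i).
pose f := linfun (@jet n (kap i) (p i) u w).
rewrite -(limg_ker_dim f); apply: leq_add.
  apply/dimvS/subvP => F; rewrite memv_cap => /andP[/mult_spaceP FZ].
  rewrite memv_ker lfunE => /eqP jF; apply/mult_spaceP => j; rewrite /raise_at.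
  have [->|_] := eqVneq j i; last by rewrite addn0.
  rewrite addn1; apply: mult_ge_jet H _ _ => [||k]; first exact: valP.
    exact: FZ.
  by have /rowP/(_ k) := jF; rewrite !mxE.
by rewrite (leq_trans (dimvS (subvf _))) // dimvf dim_matrix mul1r.
Qed.

(** The converse bound needs [kap i + 1] dimensions of forms of multiplicity exactly
    [kap i] at [p i]: the binary forms in two local parameters at [p i], times a form
    [D] that has the required multiplicities at the other points and is not [0] at
    [p i]. In degree at least [\sum_j kap j], powers of linear forms separating the
    points multiply to such a [D]. *)
Lemma dim_mult_raise_ge n kap i : (forall i j, proj_eq (p i) (p j) -> i = j) ->
  (\sum_j kap j <= n)%N ->
  (\dim (mult_space n (raise_at kap i)) + (kap i).+1 <= \dim (mult_space n kap))%N.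
Proof.
move=> pinj le_n; set k := kap i.
have [u [w [lu [lw [H [lua lwa] [luu luw] [lwu lww]]]]]] := frame (p0 i).
have [D [hD Di Dj]] : exists D, [/\ D \is (n - k).-homog, D.@[p i 0] != 0
    & forall j, j != i -> mult_ge (kap j) D (p j)].
  have /boolp.choice[l Hl] : forall j, exists l, j != i -> dot l (p j) = 0 /\ dot l (p i) != 0.
    move=> j; have [->|ji] := eqVneq j i; first by exists 0.
    have [|l l1 l2] := linear_form_separating (p0 j) (p0 i); last by exists l.
    by move=> /pinj E; case/eqP: ji.
  have [l0 Hl0] := linear_form_nonzero_at (p0 i).
  have sE : (\sum_(j | j != i) kap j + (n - \sum_j kap j))%N = (n - k)%N.
    move: le_n; rewrite (bigD1 i) //= -/k.
    by move: (\sum_(j | _) _)%N => s; lia.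
  exists (\prod_(j | j != i) lin (l j) ^+ kap j * lin l0 ^+ (n - \sum_j kap j)).
  split.
  - rewrite -sE; apply: dhomogM; last by rewrite -[X in X.-homog]mul1n dhomogMn ?lin_homog.
    elim/big_rec2: _ => [|j e G _ hG]; first exact: dhomog1.
    by apply: dhomogM => //; rewrite -[X in X.-homog]mul1n dhomogMn ?lin_homog.
  - rewrite mevalM rmorphXn /= lin_eval mulf_neq0 ?expf_neq0 //.
    rewrite rmorph_prod; apply/prodf_neq0 => j ji /=; rewrite rmorphXn /= lin_eval expf_neq0 //.
    by case: (Hl j ji).
  - move=> j ji; apply: mult_geMl; rewrite (bigD1 j) //=; apply: mult_geMl.
    have l1 : mult_ge 1 (lin (l j)) (p j) by apply/mult_ge1; rewrite lin_eval; case: (Hl j ji).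
    elim: (kap j) => [|e IH]; first exact: mult_ge0.
    by rewrite exprS; apply: (mult_geM l1 IH).
pose B (c : 'rV[K]_k.+1) := \sum_j c 0 j *: (lin lu ^+ j * lin lw ^+ (k - j)).
have hB c : D * B c \is n.-homog.
  have kn : (k <= n)%N by apply: leq_trans le_n; rewrite (bigD1 i) //= leq_addr.
  rewrite -(subnK kn); apply: dhomogM => //; rewrite rpred_sum // => j _.
  apply: dhomogZ; rewrite -[X in X.-homog](subnKC (leq_ord j)).
  by apply: dhomogM; rewrite -[X in X.-homog]mul1n dhomogMn ?lin_homog.
pose psi c : dhomog 3 K n := DHomog (hB c).
have psi_lin : linear psi.
  move=> b c d; apply: val_inj; rewrite /= scalerAr -mulrDr; congr (_ * _).
  rewrite /B scaler_sumr -big_split; apply: eq_bigr => j _.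
  by rewrite !mxE scalerDl scalerA.
have taylorB c v : taylor (B c) (p i) v =
    (\sum_j c 0 j * (dot lu v ^+ j * dot lw v ^+ (k - j))) *: 'X^k.
  rewrite /B (big_morph (fun F => taylor F (p i) v) (taylorD _ _) (_ : _ = 0)); last by rewrite /taylor mmap0.
  rewrite scaler_suml; apply: eq_bigr => j _; rewrite taylorZ taylorM -scalerA; congr (_ *: _).
  have tX l e : taylor (lin l ^+ e) (p i) v = taylor (lin l) (p i) v ^+ e.
    by elim: e => [|e IH]; rewrite ?expr0 -?mpolyC1 ?taylorC // !exprS taylorM IH.
  rewrite !tX !taylor_lin lua lwa !add0r !exprZn -scalerAl -scalerAr scalerA -exprD.
  by rewrite subnKC // leq_ord.
have psi0 c : psi c \in mult_space n (raise_at kap i) -> c = 0.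
  move=> /mult_spaceP /(_ i); rewrite /raise_at eqxx addn1 -/k => mDB.
  have mB : mult_ge k.+1 (B c) (p i).
    apply: (@mult_ge_cancel _ _ 0 _ D) => // /mult_ge1 E; by rewrite E eqxx in Di.
  have P0 : \poly_(j < k.+1) (c 0 (inord j)) = 0.
    apply: (poly_nat_eq0 (size_poly _ _)) => j _; rewrite horner_poly.
    have := mB (j%:R *: u + w) k (leqnn _).
    rewrite taylorB coefZ coefXn eqxx mulr1 !dotDr !dotZr luu luw lwu lww mulr0 mulr1 add0r addr0.
    by move=> E; rewrite -[RHS]E; apply: eq_bigr => e _; rewrite expr1n mulr1 inord_val.
  apply/rowP => j; move/(congr1 (fun q : {poly K} => q`_j)): P0.
  by rewrite coef_poly ltn_ord inord_val coef0 mxE.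
pose psiL : {linear 'rV[K]_k.+1 -> dhomog 3 K n} :=
  HB.pack psi (GRing.isLinear.Build _ _ _ _ psi psi_lin).
have fE c : linfun psiL c = psi c by rewrite lfunE.
have ker0 : lker (linfun psiL) = 0%VS.
  apply/eqP; rewrite -subv0; apply/subvP => c; rewrite memv_ker fE memv0 => /eqP E.
  by apply/eqP/psi0; rewrite E mem0v.
have dimg : \dim (limg (linfun psiL)) = k.+1.
  by rewrite limg_dim_eq ?ker0 ?capv0 // dimvf dim_matrix mul1r.
have cap0 : (mult_space n (raise_at kap i) :&: limg (linfun psiL) = 0)%VS.
  apply/eqP; rewrite -subv0; apply/subvP => F; rewrite memv_cap => /andP[FZ /memv_imgP[c _ E]].
  by rewrite E fE memv0 in FZ *; rewrite (psi0 c) // -(fE 0) raddf0.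
rewrite -dimg -dimv_disjoint_sum //; apply/dimvS; rewrite subv_add; apply/andP; split.
  apply/subvP => F /mult_spaceP FZ; apply/mult_spaceP => j.
  by apply: mult_ge_leq (FZ j); rewrite leq_addr.
apply/subvP => F /memv_imgP[c _ ->]; rewrite fE; apply/mult_spaceP => j /=.
have [->|ji] := eqVneq j i; last by apply/mult_geMl/Dj.
apply: mult_geMr => v e ek; rewrite taylorB coefZ coefXn.
by rewrite (ltn_eqF ek) mulr0.
Qed.

Lemma multiplicity_ind (P : ('I_N -> nat) -> Prop) : P (fun=> 0%N) ->
  (forall kap i, P kap -> P (raise_at kap i)) -> forall kap, P kap.
Proof.
move=> P0 Pb kap; have [m] := ubnP (\sum_i kap i)%N; elim: m kap => // m IH kap le_m.
have [i ki|k0] := pickP (fun i => kap i != 0%N); last first.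
  rewrite (_ : kap = fun=> 0%N) //; apply: boolp.funext => i.
  by apply/eqP/negbFE/k0.
pose kap' j := (kap j - (j == i))%N.
have E : kap = raise_at kap' i.
  apply: boolp.funext => j; rewrite /raise_at /kap'.
  by have [->|] := eqVneq j i; rewrite ?subn0 ?addn0 // subnK // lt0n.
rewrite E; apply/Pb/IH; apply: leq_trans (_ : \sum_j kap j <= m)%N => //.
rewrite [ltnRHS](bigD1 i) //= [ltnLHS](bigD1 i) //= /kap' eqxx.
rewrite (eq_bigr kap) => [|j /negPf->]; last by rewrite subn0.
by rewrite -addSn leq_add2r subn1 prednK // lt0n.
Qed.

Lemma sum_bin_raise kap i : (\sum_j 'C((raise_at kap i j).+1, 2) =
  \sum_j 'C((kap j).+1, 2) + (kap i).+1)%N.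
Proof.
rewrite (bigD1 i) //= [X in _ = (X + _)%N](bigD1 i) //= /raise_at eqxx addn1 binS bin1.
rewrite addnAC; congr (_ + _ + _)%N; apply: eq_bigr => j /negPf->.
by rewrite addn0.
Qed.

Lemma dim_mult_ge n kap :
  ('C(n + 2, n) <= \dim (mult_space n kap) + \sum_i 'C((kap i).+1, 2))%N.
Proof.
elim/multiplicity_ind: kap => [|kap i IH].
  rewrite big1 // addn0 -dim_form; apply/dimvS/subvP => F _.
  by apply/mult_spaceP => i; apply: mult_ge0.
have := dim_mult_raise_le n kap i; rewrite sum_bin_raise.
by move: IH; move: (\dim _) (\dim _) (\sum__ _)%N => x y z; lia.
Qed.

(** Multiple points impose independent conditions in large degree. *)
Lemma dim_mult_le n kap : (forall i j, proj_eq (p i) (p j) -> i = j) ->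
  (\sum_i kap i <= n)%N ->
  (\dim (mult_space n kap) + \sum_i 'C((kap i).+1, 2) <= 'C(n + 2, n))%N.
Proof.
move=> pinj; elim/multiplicity_ind: kap => [|kap i IH] le_n.
  by rewrite [X in (_ + X)%N]big1 // addn0 -dim_form; apply/dimvS/subvf.
have le_n' : (\sum_j kap j <= n)%N.
  by apply: leq_trans le_n; apply: leq_sum => j _; rewrite leq_addr.
have := dim_mult_raise_ge i pinj le_n'; rewrite sum_bin_raise.
by move: (IH le_n'); move: (\dim _) (\dim _) (\sum__ _)%N => x y z; lia.
Qed.

End Mult.

(** * Bezout's inequality *)

Section Multiplication.
Variables (d e n : nat) (f : {mpoly K[3]}).
Hypotheses (hf : f \is d.-homog) (den : (d + e)%N = n).

Lemma mulform_subproof (g : dhomog 3 K e) : f * val g \is n.-homog.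
Proof. by rewrite -den; apply: dhomogM => //; apply: valP. Qed.

Definition mulform (g : dhomog 3 K e) : dhomog 3 K n := DHomog (mulform_subproof g).

Lemma mulform_is_linear : linear mulform.
Proof. by move=> c g h; apply: val_inj; rewrite /= mulrDr scalerAr. Qed.
HB.instance Definition _ :=
  GRing.isLinear.Build K (dhomog 3 K e) (dhomog 3 K n) _ mulform mulform_is_linear.

Lemma dim_mulform (U : {vspace dhomog 3 K e}) : f != 0 ->
  \dim (linfun mulform @: U) = \dim U.
Proof.
move=> f0; apply: limg_dim_eq; apply/eqP; rewrite -subv0; apply/subvP => g.
rewrite memv_cap memv_ker lfunE memv0 => /andP[_ /eqP /(congr1 val) /= /eqP].
by rewrite mulf_eq0 (negPf f0) /= => /eqP E; apply/eqP/val_inj.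
Qed.

End Multiplication.

Lemma bin2_double x : ('C(x.+1, 2).*2 = x.+1 * x)%N.
Proof. by rewrite -mul2n -mul_bin_diag bin1. Qed.

Lemma bin2_add x y : ('C((x + y).+1, 2) = 'C(x.+1, 2) + 'C(y.+1, 2) + x * y)%N.
Proof.
have := bin2_double (x + y); have := bin2_double x; have := bin2_double y.
by move: ('C(_, _)) ('C(_, _)) ('C(_, _)) => a b c; nia.
Qed.

(** Let [V (n, m)] be the space of forms of degree [n] with multiplicities at least [m].
    In degree [n = d + e + M], with [M] large, it contains the sum of
    [f V (e + M, k)] and [g V (d + M, m)] for the multiplicities [m + k]. If [f] does not
    divide [g], then the intersection of these two spaces consists of multiples of
    [f g], and counting dimensions bounds [\sum_i m i * k i] by [d * e]. *)
Theorem bezout_inequality N (p : 'I_N -> 'rV[K]_3) (f g : {mpoly K[3]}) d e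
    (m k : 'I_N -> nat) :
  (forall i, p i != 0) -> (forall i j, proj_eq (p i) (p j) -> i = j) ->
  irreducible_mpoly f -> f \is d.-homog -> g \is e.-homog ->
  (forall i, mult_ge (m i) f (p i)) -> (forall i, mult_ge (k i) g (p i)) ->
  (d * e < \sum_i m i * k i)%N -> divides f g.
Proof.
move=> p0 pinj firr hf hg mf mg lt_de.
apply: boolp.contrapT => nfg.
have f0 : f != 0 by have [+ _] := firr; apply: contraTneq => ->; rewrite msize0.
have g0 : g != 0 by apply: contra_notN nfg => /eqP->; apply: dvdr0.
pose M := (\sum_i (m i + k i))%N.
pose n := (d + e + M)%N.
have En1 : (d + (e + M))%N = n by rewrite addnA.
have En2 : (e + (d + M))%N = n by rewrite addnCA addnA.
pose W1 := (linfun (mulform hf En1) @: mult_space p (e + M) k)%VS.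
pose W2 := (linfun (mulform hg En2) @: mult_space p (d + M) m)%VS.
have sW : (W1 + W2 <= mult_space p n (fun i => (m i + k i)%N))%VS.
  rewrite subv_add; apply/andP; split; apply/subvP => F /memv_imgP[G /mult_spaceP GZ ->].
    by rewrite lfunE; apply/mult_spaceP => i; apply: mult_geM.
  by rewrite lfunE; apply/mult_spaceP => i; rewrite /= mulrC; apply: mult_geM.
have hfg : f * g \is (d + e).-homog by apply: dhomogM.
have sC : (W1 :&: W2 <= limg (linfun (mulform hfg (erefl n : (d + e + M)%N = n))))%VS.
  apply/subvP => F; rewrite memv_cap => /andP[/memv_imgP[A _ EA] /memv_imgP[B _ EB]].
  have /(congr1 val) E := etrans (esym EA) EB; rewrite !lfunE /= in E.
  have [//|[C EC]] := irreducible_prime firr (ex_intro _ (val A) (esym E)).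
  have hC : C \is M.-homog.
    by apply: (homog_cofactor f0 hf); rewrite -EC; apply: valP.
  apply/memv_imgP; exists (DHomog hC); first exact: memvf.
  by rewrite EB !lfunE; apply: val_inj; rewrite /= EC; ring.
have := dimv_sum_cap W1 W2; have := dimvS sW; have := dimvS sC.
rewrite dim_mulform ?mulf_neq0 // dim_form !dim_mulform //.
have := dim_mult_ge p0 (e + M) k; have := dim_mult_ge p0 (d + M) m.
have := @dim_mult_le N p p0 n (fun i => m i + k i)%N pinj (leq_addl _ _).
have -> : (\sum_i 'C((m i + k i).+1, 2) =
    \sum_i 'C((m i).+1, 2) + \sum_i 'C((k i).+1, 2) + \sum_i m i * k i)%N.
  by rewrite -!big_split; apply: eq_bigr => i _; apply: bin2_add.
have binE j : 'C(j + 2, j) = 'C(j + 2, 2) by rewrite -bin_sub ?leq_addr // addKn.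
have : ('C(n + 2, 2) + 'C(M + 2, 2) = 'C(e + M + 2, 2) + 'C(d + M + 2, 2) + d * e)%N.
  rewrite !addn2; have := bin2_double n.+1; have := bin2_double M.+1.
  have := bin2_double (e + M).+1; have := bin2_double (d + M).+1.
  by rewrite /n; move: ('C(_, _)) ('C(_, _)) ('C(_, _)) ('C(_, _)) => a b c c'; nia.
rewrite !binE.
move: (\dim _) (\dim _) (\dim _) (\dim _) (\dim _) => x1 x2 x3 x4 x5.
move: lt_de; move: (\sum__ _)%N (\sum__ _)%N (\sum__ _)%N => s1 s2 s3.
by move: ('C(_, _)) ('C(_, _)) ('C(_, _)) ('C(_, _)) => c1 c2 c3 c4; lia.
Qed.

End Forms.

(** * Lines and conics through given points *)

Section LinesConics.
Variable K : numFieldType.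
Implicit Types (x y z v w : 'rV[K]_3) (q : {mpoly K[3]}).

Lemma dot0r w : dot w 0 = 0.
Proof. by rewrite /dot big1 // => j _; rewrite mxE mulr0. Qed.

Lemma dot0l x : dot 0 x = 0.
Proof. by rewrite /dot big1 // => j _; rewrite mxE mul0r. Qed.

Lemma dotDl w w' x : dot (w + w') x = dot w x + dot w' x.
Proof. by rewrite -big_split; apply: eq_bigr => j _; rewrite mxE mulrDl. Qed.

Lemma dotZl c w x : dot (c *: w) x = c * dot w x.
Proof. by rewrite mulr_sumr; apply: eq_bigr => j _; rewrite mxE mulrA. Qed.

Lemma linD w w' : lin (w + w') = lin w + lin w'.
Proof. by rewrite -big_split; apply: eq_bigr => j _; rewrite mxE scalerDl. Qed.

Lemma linZ c w : lin (c *: w) = c *: lin w.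
Proof. by rewrite scaler_sumr; apply: eq_bigr => j _; rewrite mxE scalerA. Qed.

Lemma lin_irreducible w : w != 0 -> irreducible_mpoly (lin w).
Proof.
move=> w0; apply: msize2_irreducible; apply: homog_msize (lin_homog w).
by apply: contraNneq w0 => /lin_eq0->.
Qed.

Lemma homog1_lin (m : {mpoly K[3]}) : m \is 1.-homog -> exists w, m = lin w.
Proof.
move=> hm; exists (\row_j m@_U_(j)); apply/mpolyP => mon.
rewrite raddf_sum /=.
under eq_bigr => j _ do rewrite mcoeffZ mcoeffX mxE.
have [/eqP/mdeg1P[i /eqP->]|d1] := eqVneq (mdeg mon) 1%N.
  rewrite (bigD1 i) //= eqxx mulr1 big1 ?addr0 // => j ji.
  by rewrite eq_mnm1 (negPf ji) mulr0.
rewrite (dhomog_nemf_coeff hm) ?big1 // => j _.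
by rewrite (_ : (_ == mon) = false) ?mulr0 //; apply: contraNF d1 => /eqP<-; rewrite mdeg1.
Qed.

Lemma dot_eq0 w : (forall v, dot w v = 0) -> w = 0.
Proof.
move=> H; apply/rowP => j; rewrite mxE -[RHS](H (delta_mx 0 j)) /dot.
rewrite (bigD1 j) //= big1 ?addr0 => [|k kj]; rewrite !mxE ?eqxx ?mulr1 //.
by rewrite (negPf kj) mulr0.
Qed.

Definition dependent (A : lmodType K) (a b : A) :=
  exists c d : K, (c != 0) || (d != 0) /\ c *: a + d *: b = 0.

Lemma dependent_scalars (s t : K) : exists c d : K, (c != 0) || (d != 0) /\ c * s + d * t = 0.
Proof.
have [->|s0] := eqVneq s 0; first by exists 1, 0; rewrite oner_neq0 mulr0 mul0r addr0.
by exists t, (- s); rewrite oppr_eq0 s0 orbT mulNr mulrC subrr.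
Qed.

Lemma line_through x y : x != 0 -> y != 0 -> ~ proj_eq x y ->
  exists w, [/\ w != 0, dot w x = 0 & dot w y = 0].
Proof.
move=> x0 y0 nxy; have [u [v [lu [lv [H [lux lvx] [luu luv] [lvu lvv]]]]]] := frame x0.
exists (dot lv y *: lu - dot lu y *: lv); split.
- apply: contra_notN nxy => /eqP E.
  have [E1 E2] : dot lv y = 0 /\ dot lu y = 0.
    have ev z : dot lv y * dot lu z - dot lu y * dot lv z = 0.
      by rewrite -mulNr -!dotZl -dotDl scaleNr E /dot big1 // => j _; rewrite mxE mul0r.
    by split; [have := ev u|have := ev v];
      rewrite ?luu ?luv ?lvu ?lvv !(mulr0, mulr1, sub0r, subr0) // => /eqP; rewrite oppr_eq0 => /eqP.
  have [c Ey] := H y; exists c; last by rewrite {1}Ey E1 E2 !scale0r !addr0.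
  by apply: contraNneq y0 => c0; rewrite Ey E1 E2 c0 !scale0r !addr0.
- by rewrite -scaleNr dotDl !dotZl lux lvx !mulr0 addr0.
- by rewrite -scaleNr dotDl !dotZl mulNr mulrC subrr.
Qed.

Lemma line_unique x y w w' : x != 0 -> y != 0 -> ~ proj_eq x y ->
  dot w x = 0 -> dot w y = 0 -> dot w' x = 0 -> dot w' y = 0 -> dependent w w'.
Proof.
move=> x0 y0 nxy wx wy w'x w'y.
have [u [v [lu [lv [H _ _ _]]]]] := frame x0.
have [c Ey] := H y.
have E (z : 'rV[K]_3) : dot z x = 0 -> dot z y = 0 -> dot lu y * dot z u + dot lv y * dot z v = 0.
  by move=> zx; rewrite {1}Ey !dotDr !dotZr zx mulr0 add0r.
have D a b : a * dot w u + b * dot w' u = 0 -> a * dot w v + b * dot w' v = 0 ->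
    a *: w + b *: w' = 0.
  move=> Eu Ev; apply: dot_eq0 => z; have [e ->] := H z.
  rewrite !dotDl !dotZl !dotDr !dotZr wx w'x.
  transitivity (dot lu z * (a * dot w u + b * dot w' u) + dot lv z * (a * dot w v + b * dot w' v)).
    by ring.
  by rewrite Eu Ev !mulr0 addr0.
have [bu|bu] := eqVneq (dot lu y) 0.
  have bv : dot lv y != 0.
    apply: contra_notN nxy => /eqP bv; exists c; last by rewrite {1}Ey bu bv !scale0r !addr0.
    by apply: contraNneq y0 => c0; rewrite Ey bu bv c0 !scale0r !addr0.
  have Ev (z : 'rV[K]_3) : dot z x = 0 -> dot z y = 0 -> dot z v = 0.
    by move=> zx zy; move/eqP: (E z zx zy); rewrite bu mul0r add0r mulf_eq0 (negPf bv) => /eqP.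
  have [a [b [ab0 ab]]] := dependent_scalars (dot w u) (dot w' u).
  exists a, b; split=> //; apply: D => //.
  by rewrite !Ev // !mulr0 addr0.
have [a [b [ab0 ab]]] := dependent_scalars (dot w v) (dot w' v).
exists a, b; split=> //; apply: D => //; apply: (mulfI bu).
transitivity (a * (dot lu y * dot w u + dot lv y * dot w v) +
   b * (dot lu y * dot w' u + dot lv y * dot w' v) - dot lv y * (a * dot w v + b * dot w' v)).
  by ring.
by rewrite !E // ab; ring.
Qed.

Lemma proj_eq_sym x y : proj_eq x y -> proj_eq y x.
Proof.
by move=> [c c0 ->]; exists c^-1; rewrite ?invr_eq0 // scalerA mulVf ?scale1r.
Qed.

(** Three intersections exceed the product of the degrees, so the line is a component. *)
Lemma line_in_conic x y z w q : w != 0 -> q \is 2.-homog ->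
  [/\ x != 0, y != 0 & z != 0] ->
  [/\ ~ proj_eq x y, ~ proj_eq x z & ~ proj_eq y z] ->
  [/\ dot w x = 0, dot w y = 0 & dot w z = 0] ->
  [/\ q.@[x 0] = 0, q.@[y 0] = 0 & q.@[z 0] = 0] ->
  exists m, q = lin w * lin m.
Proof.
move=> w0 hq [x0 y0 z0] [nxy nxz nyz] [wx wy wz] [qx qy qz].
pose t (i : 'I_3) := nth 0 [:: x; y; z] i.
have tP (P : 'rV[K]_3 -> Prop) : P x -> P y -> P z -> forall i, P (t i).
  by move=> Px Py Pz [[|[|[|]]]].
have [r E] : divides (lin w) q.
  apply: (@bezout_inequality K 3 t _ _ 1 2 (fun=> 1%N) (fun=> 1%N)) => //.
  - exact: (tP (fun v => v != 0)).
  - move=> [[|[|[|//]]] Hi] [[|[|[|//]]] Hj] /= E; apply: val_inj => //=; exfalso;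
    first [exact: nxy E|exact: nxz E|exact: nyz E|exact: nxy (proj_eq_sym E)|exact: nxz (proj_eq_sym E)|exact: nyz (proj_eq_sym E)].
  - exact: lin_irreducible.
  - exact: lin_homog.
  - by move=> i; apply/mult_ge1; rewrite lin_eval; apply: (tP (fun v => dot w v = 0)).
  - by move=> i; apply/mult_ge1; apply: (tP (fun v => q.@[v 0] = 0)).
  - by rewrite !big_ord_recr big_ord0.
have /homog1_lin[m Em] : r \is 1.-homog.
  apply: (homog_cofactor _ (lin_homog w)); last by rewrite -E.
  by apply: contraNneq w0 => /lin_eq0->.
by exists m; rewrite -Em.
Qed.

Lemma dependent_cofactor q m m' : dependent m m' -> dependent (q * m) (q * m').
Proof.
move=> [a [b [ab0 E]]]; exists a, b; split=> //.
by rewrite !scalerAr -mulrDr E mulr0.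
Qed.

(** If three of the points are on a line, both conics contain this line, and their
    residual lines contain the two points off it. Otherwise, a member of the pencil of
    [q] and [q'] that vanishes at a third point of the line through two of the points
    contains this line, and its residual line would contain three of the points. *)
Lemma conic_unique N (p : 'I_N -> 'rV[K]_3) (A : {set 'I_N}) q q' :
  (forall i, p i != 0) -> (forall i j, proj_eq (p i) (p j) -> i = j) ->
  (forall w, w != 0 -> (#|[set i in A | dot w (p i) == 0%R]| <= 3)%N) ->
  (5 <= #|A|)%N -> q \is 2.-homog -> q' \is 2.-homog ->
  (forall i, i \in A -> q.@[p i 0] = 0) -> (forall i, i \in A -> q'.@[p i 0] = 0) ->
  dependent q q'.
Proof.
move=> p0 pinj line3 A5 hq hq' qA q'A.
have off w m r : lin w * lin m = r -> (forall i, i \in A -> r.@[p i 0] = 0) ->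
    forall i, i \in A -> dot w (p i) != 0 -> dot m (p i) = 0.
  move=> <- rA i iA wi; have /eqP := rA i iA.
  by rewrite mevalM !lin_eval mulf_eq0 (negPf wi) => /eqP.
have [[w [w0 wA]]|nw] := boolp.pselect (exists w, w != 0 /\
    (3 <= #|[set i in A | dot w (p i) == 0%R]|)%N).
  have /card_geqP[s [us ss sA]] := wA.
  case: s us ss sA => [|i [|j [|k []]]] // /and3P[]; rewrite !inE => /norP[ij ik] jk _ _ sA.
  have onl l : l \in [:: i; j; k] -> [/\ l \in A, dot w (p l) = 0, q.@[p l 0] = 0 & q'.@[p l 0] = 0].
    by move=> /sA; rewrite inE => /andP[lA /eqP wl]; split=> //; [apply: qA|apply: q'A].
  have [iA wi qi q'i] := onl i (mem_head _ _).
  have jin : j \in [:: i; j; k] by rewrite !inE eqxx orbT.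
  have kin : k \in [:: i; j; k] by rewrite !inE eqxx !orbT.
  have [jA wj qj q'j] := onl j jin; have [kA wk qk q'k] := onl k kin.
  have npe l l' : l != l' -> ~ proj_eq (p l) (p l') by move=> /eqP ll' /pinj.
  have dis : [/\ ~ proj_eq (p i) (p j), ~ proj_eq (p i) (p k) & ~ proj_eq (p j) (p k)].
    by split; apply: npe.
  have [m Em] := line_in_conic w0 hq (And3 (p0 i) (p0 j) (p0 k)) dis (And3 wi wj wk) (And3 qi qj qk).
  have [m' Em'] := line_in_conic w0 hq' (And3 (p0 i) (p0 j) (p0 k)) dis (And3 wi wj wk) (And3 q'i q'j q'k).
  have : (2 <= #|A :\: [set l in A | dot w (p l) == 0%R]|)%N.
    have := cardsID [set l in A | dot w (p l) == 0%R] A.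
    rewrite (setIidPr _); last by apply/subsetP => l; rewrite inE => /andP[].
    by have := line3 w w0; move: (#|_|) (#|_|) (#|_|) A5 => b c d; lia.
  move=> /card_gt1P[d [e [+ + de]]]; rewrite !inE => /andP[+ dA] /andP[+ eA].
  rewrite dA eA /= => wd we.
  have dep : dependent m m'.
    apply: (line_unique (p0 d) (p0 e) (npe _ _ de)).
    - exact: off (esym Em) qA d dA wd.
    - exact: off (esym Em) qA e eA we.
    - exact: off (esym Em') q'A d dA wd.
    - exact: off (esym Em') q'A e eA we.
  rewrite Em Em'; apply: dependent_cofactor; have [a [b [ab0 E]]] := dep.
  by exists a, b; split=> //; rewrite -!linZ -linD E /lin big1 // => l _; rewrite mxE scale0r.
have /card_gt1P[i [j [iA jA ij]]] : (1 < #|A|)%N by apply: leq_trans A5.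
have nij : ~ proj_eq (p i) (p j) by move=> /pinj /eqP; apply/negP.
have [w [w0 wi wj]] := line_through (p0 i) (p0 j) nij.
pose z := p i + p j.
have [a [b [ab0 ab]]] := dependent_scalars q.@[z 0] q'.@[z 0].
exists a, b; split=> //; set r := a *: q + b *: q'.
have rA l : l \in A -> r.@[p l 0] = 0.
  by move=> lA; rewrite mevalD !mevalZ qA ?q'A // !mulr0 addr0.
have hr : r \is 2.-homog by rewrite rpredD ?rpredZ.
have z0 : z != 0.
  apply: contra_notN nij => /eqP; rewrite /z addrC => /eqP; rewrite addr_eq0 => /eqP E.
  by exists (-1); rewrite ?oppr_eq0 ?oner_neq0 // scaleN1r.
have nz x y : x != 0 -> y != 0 -> ~ proj_eq x y -> ~ proj_eq x (x + y).
  move=> x0 y0 nxy [c c0 E]; apply: nxy; exists (c - 1); last first.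
    by rewrite scalerBl scale1r -E addrC addKr.
  apply: contraNneq y0 => /eqP; rewrite subr_eq0 => /eqP c1.
  by move: E; rewrite c1 scale1r -[X in _ = X]addr0 => /addrI->.
have [m Em] : exists m, r = lin w * lin m.
  apply: (line_in_conic w0 hr (And3 (p0 i) (p0 j) z0)).
  - split=> //; first exact: nz.
    by rewrite /z addrC; apply: nz => // /proj_eq_sym.
  - by split; rewrite // dotDr wi wj addr0.
  - split; [exact: rA|exact: rA|].
    by rewrite mevalD !mevalZ.
suff m0 : m = 0 by rewrite Em m0 /lin [X in _ * X]big1 ?mulr0 // => l _; rewrite mxE scale0r.
apply/eqP; apply: contra_notT (nw) => m0; exists m; split=> //.
have le2 : (#|[set l in A | dot w (p l) == 0%R]| <= 2)%N.
  by rewrite leqNgt; apply: contra_notN nw => wA; exists w.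
have := cardsID [set l in A | dot w (p l) == 0%R] A.
rewrite (setIidPr _); last by apply/subsetP => l; rewrite inE => /andP[].
have sub : A :\: [set l in A | dot w (p l) == 0%R] \subset [set l in A | dot m (p l) == 0%R].
  apply/subsetP => l; rewrite !inE => /andP[+ lA]; rewrite lA /= => wl.
  by apply/eqP; apply: off (esym Em) rA l lA wl.
have := subset_leq_card sub.
by move: (#|_|) (#|_|) (#|_|) (#|_|) A5 le2 => b1 c d e; lia.
Qed.

End LinesConics.

(** * The net of cubics through seven nodes of a sextic *)

Lemma sum_nat_pred (T : finType) (P : pred T) : (\sum_i P i = #|[set i | P i]|)%N.
Proof.
by rewrite -sum1dep_card [RHS]big_mkcond; apply: eq_bigr => i _; case: (P i).
Qed.

Section Nodes.
Variables (K : numFieldType) (f : {mpoly K[3]}) (p : 'I_10 -> 'rV[K]_3).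
Hypotheses (hf : f \is 6.-homog) (firr : irreducible_mpoly f).
Hypotheses (p0 : forall i, p i != 0) (pinj : forall i j, proj_eq (p i) (p j) -> i = j).
Hypothesis f2 : forall i, mult_ge 2 f (p i).

(** The form in which Bezout's inequality is used: a curve of low degree cannot meet the
    sextic too much at its nodes. *)
Lemma node_bezout (g : {mpoly K[3]}) e (k : 'I_10 -> nat) :
  g \is e.-homog -> (e < 6)%N -> (forall i, mult_ge (k i) g (p i)) ->
  (3 * e < \sum_i k i)%N -> g = 0.
Proof.
move=> hg e6 gk lt_k; apply/eqP; apply: contraT => g0.
have fg : divides f g.
  apply: (bezout_inequality p0 pinj firr hf hg f2 gk).
  by rewrite -big_distrr /=; move: lt_k; move: (\sum__ _)%N => s; lia.
have := dvd_msize g0 fg; rewrite (homog_msize g0 hg).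
have f0 : f != 0 by have [+ _] := firr; apply: contraTneq => ->; rewrite msize0.
by rewrite (homog_msize f0 hf) ltnNge e6.
Qed.

Lemma nodes_on_line w : w != 0 -> (#|[set i | dot w (p i) == 0%R]| <= 3)%N.
Proof.
move=> w0; rewrite leqNgt -sum_nat_pred; apply: contraNN w0 => lt.
apply/eqP/lin_eq0/(node_bezout (lin_homog w) _ _ lt) => // i.
case: eqP => [E|_]; last exact: mult_ge0.
by apply/mult_ge1; rewrite lin_eval.
Qed.

Lemma nodes_on_conic (q : {mpoly K[3]}) : q \is 2.-homog ->
  (forall i : 'I_10, (i < 7)%N -> q.@[p i 0] = 0) -> q = 0.
Proof.
move=> hq qp; apply: (@node_bezout q 2 (fun i : 'I_10 => (i < 7)%N)) => // [i|].
  by case: ltnP => [/qp/mult_ge1|_] //; apply: mult_ge0.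
by rewrite !big_ord_recr big_ord0.
Qed.

Lemma double_cubic (c : {mpoly K[3]}) k j : c \is 3.-homog ->
  (forall i, i != k -> c.@[p i 0] = 0) -> j != k -> mult_ge 2 c (p j) -> c = 0.
Proof.
move=> hc cp jk c2.
apply: (@node_bezout c 3 (fun i => (i != k) + (i == j))%N) => // [i|].
  have [->|ij] := eqVneq i j; first by rewrite jk.
  rewrite addn0; case: eqP => [_|/eqP/cp/mult_ge1 //]; exact: mult_ge0.
rewrite big_split /= !sum_nat_pred.
have -> : [set i | i != k] = ~: [set k] by apply/setP => i; rewrite !inE.
have -> : [set i | i == j] = [set j] by apply/setP => i; rewrite !inE.
by have := cardsC [set k]; rewrite !cards1 card_ord; move: (#|_|) => s; lia.
Qed.

Definition seven_points : {set 'I_10} := [set i : 'I_10 | (i < 7)%N].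

Lemma card_seven : #|seven_points| = 7%N.
Proof. by rewrite -sum_nat_pred !big_ord_recr big_ord0. Qed.

(** The linear system [|3L - E_1 - .. - E_7|]. *)
Definition cubic_net (c : {mpoly K[3]}) :=
  c \is 3.-homog /\ forall i : 'I_10, (i < 7)%N -> c.@[p i 0] = 0.

Lemma cubic_net_comb c d b b' : cubic_net c -> cubic_net d -> cubic_net (b *: c + b' *: d).
Proof.
move=> [hc cp] [hd dp]; split; first by rewrite rpredD ?rpredZ.
by move=> i i7; rewrite mevalD !mevalZ cp ?dp // !mulr0 addr0.
Qed.

Lemma five_nodes_conic (A : {set 'I_10}) q q' : (5 <= #|A|)%N ->
  q \is 2.-homog -> q' \is 2.-homog ->
  (forall i, i \in A -> q.@[p i 0] = 0) -> (forall i, i \in A -> q'.@[p i 0] = 0) ->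
  dependent q q'.
Proof.
apply: conic_unique => // w /nodes_on_line; apply: leq_trans.
by apply/subset_leq_card/subsetP => i; rewrite !inE => /andP[].
Qed.

(** If [u] divides two independent cubics of the net, hence is contracted by the
    map to the plane that the net defines, then [u . (3L - E_1 - .. - E_7) <= 0]. *)
Lemma contracted_degree (u a b : {mpoly K[3]}) d : u \is d.-homog ->
  cubic_net a -> cubic_net b -> ~ dependent a b -> divides u a -> divides u b ->
  (3 * d <= #|[set i in seven_points | (u.@[p i 0] == 0)%R]|)%N.
Proof.
move=> hu [ha ap] [hb bp] nab [a' Ea] [b' Eb].
have a0 : a != 0.
  apply: contra_notN nab => /eqP->; exists 1, 0; rewrite oner_neq0 scaler0 scale0r addr0.
  by [].
have u0 : u != 0 by apply: contraNneq a0 => u0; rewrite Ea u0 mul0r.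
have du : (d <= 3)%N.
  by have := dvd_msize a0 (ex_intro _ a' Ea); rewrite (homog_msize u0 hu) (homog_msize a0 ha).
have ha' : a' \is (3 - d).-homog by apply: (homog_cofactor u0 hu); rewrite -Ea subnKC.
have hb' : b' \is (3 - d).-homog by apply: (homog_cofactor u0 hu); rewrite -Eb subnKC.
have nab' : ~ dependent a' b'.
  by move=> /(dependent_cofactor u); rewrite -Ea -Eb.
set Z := [set i in seven_points | (u.@[p i 0] == 0)%R].
have ZC : (#|Z| + #|seven_points :\: Z| = 7)%N.
  rewrite -[RHS]card_seven -(cardsID Z seven_points) (setIidPr _) //.
  by apply/subsetP => i; rewrite inE => /andP[].
have offZ c c' i : c = u * c' -> (forall i : 'I_10, (i < 7)%N -> c.@[p i 0] = 0) ->
    i \in seven_points :\: Z -> c'.@[p i 0] = 0.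
  move=> E cp; rewrite !inE => /andP[+ i7]; rewrite i7 /= => ui.
  by have /eqP := cp i i7; rewrite E mevalM mulf_eq0 (negPf ui) => /eqP.
case: d du hu ha' hb' => [|[|[|[|//]]]] _ hu ha' hb'.
- by [].
- rewrite leqNgt; apply/negP => Z3; apply: nab'.
  have c5 : (5 <= #|seven_points :\: Z|)%N.
    by move: ZC Z3; move: (#|_|) (#|_|) => x y; lia.
  by apply: (five_nodes_conic c5 ha' hb') => i; [exact: offZ Ea ap|exact: offZ Eb bp].
- rewrite leqNgt; apply/negP => Z6; apply: nab'.
  have : (1 < #|seven_points :\: Z|)%N.
    by move: ZC Z6; move: (#|_|) (#|_|) => x y; lia.
  move=> /card_gt1P[i [j [iZ jZ ij]]].
  have nij : ~ proj_eq (p i) (p j) by move=> /pinj /eqP; apply/negP.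
  have [v Ev] := homog1_lin ha'; have [w Ew] := homog1_lin hb'.
  have [x [y [xy E]]] : dependent v w.
    by apply: (line_unique (p0 i) (p0 j) nij); rewrite -lin_eval -?Ev -?Ew; (exact: offZ Ea ap _ || exact: offZ Eb bp _).
  exists x, y; split=> //; rewrite Ev Ew -!linZ -linD E /lin big1 // => l _.
  by rewrite mxE scale0r.
- case: nab'.
  have c0 (c : {mpoly K[3]}) : c \is (3 - 3).-homog -> c = (c@_0) *: 1.
    move=> hc; rewrite -mul_mpolyC mulr1; apply: msize1_polyC.
    by have [->|cn0] := eqVneq c 0; rewrite ?msize0 // (homog_msize cn0 hc).
  have [x [y [xy E]]] := dependent_scalars a'@_0 b'@_0.
  exists x, y; split=> //; rewrite (c0 _ ha') (c0 _ hb') !scalerA -scalerDl E scale0r.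
  by [].
Qed.

(** The cubics of the net cut independent tangent lines at each [p i]: a line
    joining [p i] to another point and the conic through the other five is such a
    cubic, and the conic passes through [p i] for at most one choice. *)
Lemma cubic_net_tangents (i : 'I_10) : (i < 7)%N -> exists a b,
  [/\ cubic_net a, cubic_net b
    & forall c d, mult_ge 2 (c *: a + d *: b) (p i) -> c = 0 /\ d = 0].
Proof.
move=> i7.
have npe j l : j != l -> ~ proj_eq (p j) (p l) by move=> /eqP jl /pinj.
have /boolp.choice[w Hw] : forall j, exists w, j != i -> [/\ w != 0, dot w (p i) = 0 & dot w (p j) = 0].
  move=> j; have [->|ji] := eqVneq j i; first by exists 0.
  have ij : i != j by rewrite eq_sym.
  by have [w Hw] := line_through (p0 i) (p0 j) (npe _ _ ij); exists w.
pose rest j := seven_points :\ i :\ j.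
have /boolp.choice[q Hq] : forall j, exists q : {mpoly K[3]}, j \in seven_points :\ i ->
    [/\ q != 0, q \is 2.-homog & forall l, l \in rest j -> q.@[p l 0] = 0].
  move=> j; have [j7|] := boolP (j \in seven_points :\ i); last by exists 0.
  pose k l : nat := l \in rest j.
  have s5 : (\sum_l 'C((k l).+1, 2) = 5)%N.
    rewrite (eq_bigr (fun l => k l)) => [|l _]; last by rewrite /k; case: (_ \in _).
    rewrite sum_nat_pred (_ : [set l | _] = rest j); last by apply/setP => l; rewrite inE.
    have := cardsD1 j (seven_points :\ i); have := cardsD1 i seven_points.
    have -> : i \in seven_points by rewrite inE.
    by rewrite j7 card_seven -/(rest j); move: (#|_|) (#|_|) => x y; lia.
  have := dim_mult_ge p0 2 k; rewrite s5.
  have [->|/eqP Z0 _] := eqVneq (mult_space p 2 k) 0%VS; first by rewrite dimv0.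
  pose G := vpick (mult_space p 2 k).
  have /mult_spaceP GZ : G \in mult_space p 2 k by apply: memv_pick.
  have G0 : G != 0 by rewrite vpick0; apply/eqP.
  exists (val G) => _; split; first by apply: contraNneq G0 => E; apply/eqP/val_inj.
    exact: valP.
  by move=> l lr; apply/mult_ge1; have := GZ l; rewrite /k lr.
have irest j l : l \in seven_points -> l != i -> l != j -> l \in rest j.
  by rewrite !inE => -> -> ->.
pose J := seven_points :\ i.
pose B := [set j in J | (q j).@[p i 0] == 0].
have cJ : #|J| = 6%N.
  have := cardsD1 i seven_points; have -> : i \in seven_points by rewrite inE.
  by rewrite card_seven -/J; move: (#|_|) => x; lia.
have JE j : j \in J -> j != i /\ j \in seven_points by rewrite !inE => /andP[].
have cB : (#|B| <= 1)%N.
  rewrite leqNgt; apply/negP => /card_gt1P[j [l [jB lB jl]]].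
  move: jB lB; rewrite inE => /andP[jJ /eqP qji]; rewrite inE => /andP[lJ /eqP qli].
  have [qj0 hqj qjr] := Hq j jJ; have [ql0 hql qlr] := Hq l lJ.
  have [ji j7] := JE j jJ; have [li l7] := JE l lJ.
  have [x [y [xy E]]] : dependent (q j) (q l).
    apply: (@five_nodes_conic (seven_points :\ j :\ l)) => //.
    - have := cardsD1 l (seven_points :\ j); have := cardsD1 j seven_points.
      rewrite j7 !inE eq_sym jl /=; move: l7; rewrite inE => ->; rewrite card_seven.
      by move: (#|_|) (#|_|) => a b; lia.
    - move=> m; rewrite !inE => /and3P[ml mj m7].
      by have [->//|mi] := eqVneq m i; apply/qjr/irest; rewrite ?inE.
    - move=> m; rewrite !inE => /and3P[ml mj m7].
      by have [->//|mi] := eqVneq m i; apply/qlr/irest; rewrite ?inE.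
  have x0 : x != 0.
    apply: contraTneq xy => x0; rewrite x0 eqxx /=.
    move/eqP: E; rewrite x0 scale0r add0r mscalerI (negPf ql0) orbF => /eqP->.
    by rewrite eqxx.
  case/eqP: qj0; apply: (nodes_on_conic hqj) => m m7.
  have [->//|mi] := eqVneq m i.
  have [mj|mj] := eqVneq m j; last by apply/qjr/irest; rewrite ?inE.
  have qlm : (q l).@[p m 0] = 0 by apply/qlr/irest; rewrite ?inE // mj.
  have := congr1 (meval (p m 0)) E; rewrite mevalD !mevalZ qlm mulr0 addr0 meval0.
  by move=> /eqP; rewrite mulf_eq0 (negPf x0) => /eqP.
have [j1 j1P] : exists j, j \in J :\: B.
  apply/set0Pn; rewrite -card_gt0; have := cardsID B J.
  have := subset_leq_card (subsetIr J B); rewrite cJ.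
  by move: (#|_|) (#|_|) (#|_|) cB => a b c; lia.
have [j1J qj1i] : j1 \in J /\ (q j1).@[p i 0] != 0.
  by move: j1P; rewrite in_setD => /andP[+ jJ]; rewrite inE jJ.
have [j1i j17] := JE j1 j1J; have [w10 w1i w1j1] := Hw j1 j1i.
pose L := [set j | dot (w j1) (p j) == 0] :\ i.
have cL : (#|L| <= 2)%N.
  have := nodes_on_line w10; rewrite (cardsD1 i) inE w1i eqxx -/L.
  by move: (#|_|) => a; lia.
have [j2 j2P] : exists j, j \in J :\: (B :|: L).
  apply/set0Pn; rewrite -card_gt0; have := cardsID (B :|: L) J.
  have := subset_leq_card (subsetIr J (B :|: L)); have := leq_of_leqif (leq_card_setU B L); rewrite cJ.
  by move: (#|_|) (#|_|) (#|_|) (#|_|) (#|_|) cB cL => a b c d e; lia.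
have [j2J qj2i w1j2] : [/\ j2 \in J, (q j2).@[p i 0] != 0 & dot (w j1) (p j2) != 0].
  move: j2P; rewrite in_setD => /andP[+ jJ]; rewrite in_setU negb_or => /andP[jB jL].
  split=> //; first by apply: contraNN jB => E; rewrite inE jJ.
  by apply: contraNN jL => E; rewrite in_setD1 inE E; have [-> _] := JE j2 jJ.
have [j2i j27] := JE j2 j2J; have [w20 w2i w2j2] := Hw j2 j2i.
have w2j1 : dot (w j2) (p j1) != 0.
  apply: contraNneq w1j2 => w2j1.
  have ij1 : i != j1 by rewrite eq_sym.
  have [x [y [xy E]]] := line_unique (p0 i) (p0 j1) (npe _ _ ij1) w1i w1j1 w2i w2j1.
  have x0 : x != 0.
    apply: contraTneq xy => x0; rewrite x0 eqxx /=.
    move/eqP: E; rewrite x0 scale0r add0r scaler_eq0 (negPf w20) orbF => /eqP->.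
    by rewrite eqxx.
  have := congr1 (fun z : 'rV[K]_3 => dot z (p j2)) E; rewrite /= dotDl !dotZl w2j2 mulr0 addr0 dot0l.
  by move=> /eqP; rewrite mulf_eq0 (negPf x0).
have net j : j \in J -> cubic_net (lin (w j) * q j).
  move=> jJ; have [qj0 hqj qjr] := Hq j jJ; have [ji j7] := JE j jJ; have [wj0 wi wj] := Hw j ji.
  split; first by apply: (dhomogM (lin_homog _) hqj).
  move=> m m7; rewrite mevalM lin_eval.
  have [->|mi] := eqVneq m i; first by rewrite wi mul0r.
  have [->|mj] := eqVneq m j; first by rewrite wj mul0r.
  by rewrite qjr ?mulr0 // irest ?inE.
exists (lin (w j1) * q j1), (lin (w j2) * q j2); split; [exact: net|exact: net|].
move=> c d m2.
have tan v : c * (dot (w j1) v * (q j1).@[p i 0]) + d * (dot (w j2) v * (q j2).@[p i 0]) = 0.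
  have := m2 v 1%N isT; rewrite taylorD !taylorZ !taylorM !taylor_lin w1i w2i !add0r coefD !coefZ.
  by rewrite -!scalerAl !coefZ !coefXM /= !taylor0.
have := tan (p j2); rewrite w2j2 mul0r mulr0 addr0 => /eqP.
rewrite !mulf_eq0 (negPf w1j2) (negPf qj1i) !orbF => /eqP->.
have := tan (p j1); rewrite w1j1 mul0r mulr0 add0r => /eqP.
by rewrite !mulf_eq0 (negPf w2j1) (negPf qj2i) !orbF => /eqP->.
Qed.

End Nodes.

(** * The net of cubics does not define a birational map of the plane *)

Section Composition.
Variable K : numFieldType.

Lemma taylor_comp k n (G : {mpoly K[k]}) (W : k.-tuple {mpoly K[n]}) a v :
  taylor (G \mPo W) a v = mmap (@polyC K) (fun j => taylor (tnth W j) a v) G.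
Proof.
have := rmorph_mmap (@mpolyC n K) (tnth W)
  (mmap (@polyC K) (fun j => (a 0 j)%:P + v 0 j *: 'X)) G.
rewrite /taylor /comp_mpoly => ->; apply: eq_mmap => [c|j] //=.
by rewrite mmapC.
Qed.

Lemma homog_mmap k (S : comNzRingType) (h : {rmorphism K -> S}) (G : {mpoly K[k]}) e
    (c : S) (Q : 'I_k -> S) : G \is e.-homog ->
  mmap h (fun j => c * Q j) G = c ^+ e * mmap h Q G.
Proof.
move=> hG; rewrite /mmap mulr_sumr; apply: eq_big_seq => m mG.
rewrite mulrCA; congr (_ * _); rewrite -(dhomog_mf hG mG) /= mdegE /mmap1 -prodrXr -big_split.
by apply: eq_bigr => i _; rewrite exprMn.
Qed.

Lemma mmap_coef0 k (G : {mpoly K[k]}) (Q : 'I_k -> {poly K}) :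
  (mmap (@polyC K) Q G)`_0 = G.@[fun j => (Q j)`_0].
Proof.
rewrite -horner_coef0; have := rmorph_mmap (@polyC K) Q (horner_eval 0) G.
rewrite /= /horner_eval => ->; apply: eq_mmap => [c|j] /=; first by rewrite hornerC.
by rewrite horner_coef0.
Qed.

Lemma comp_homog_mult k n (G : {mpoly K[k]}) (W : k.-tuple {mpoly K[n]}) e (a : 'rV[K]_n) :
  G \is e.-homog -> (forall j, (tnth W j).@[a 0] = 0) -> mult_ge e (G \mPo W) a.
Proof.
move=> hG W0 v i ie; rewrite taylor_comp.
have /boolp.choice[Q HQ] : forall j, exists q, taylor (tnth W j) a v = 'X * q.
  by move=> j; apply: divides_X; rewrite taylor0.
rewrite (boolp.funext HQ : (fun j => _) = _) (homog_mmap _ _ _ hG) coefXnM ie.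
by [].
Qed.

Lemma comp_sub_divides k n (G : {mpoly K[k]}) (A B : k.-tuple {mpoly K[n]}) d :
  (forall j, divides d (tnth A j - tnth B j)) -> divides d ((G \mPo A) - (G \mPo B)).
Proof.
move=> H; rewrite !comp_mpolyEX -sumrB; apply: dvdr_sum => m _.
rewrite -scalerBr -mul_mpolyC; apply: dvdr_mull; rewrite !comp_mpolyX.
elim/big_rec2: _ => [|j x y _ IH]; first by rewrite subrr; apply: dvdr0.
set s := tnth A j ^+ m j; set t := tnth B j ^+ m j.
have -> : s * y - t * x = (s - t) * y + t * (y - x) by ring.
apply: dvdrD; last exact: dvdr_mull.
by apply: dvdr_mulr; rewrite subrXX; apply: dvdr_mulr.
Qed.

Lemma vanishing_count n (us : seq {mpoly K[n]}) (a : 'rV[K]_n) :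
  mult_ge (\sum_(u <- us) (u.@[a 0] == 0)%R)%N (\prod_(u <- us) u) a.
Proof.
elim: us => [|u us IH]; first by rewrite big_nil; apply: mult_ge0.
rewrite !big_cons; apply: mult_geM => //.
by case: eqP => [/mult_ge1|_]; last exact: mult_ge0.
Qed.

Lemma taylor1_dot (F : {mpoly K[3]}) x : exists d, forall v, (taylor F x v)`_1 = dot d v.
Proof.
have [d Ed] := homog1_lin (generic_taylor_homog F x 1).
by exists d => v; rewrite generic_taylorE Ed lin_eval.
Qed.

Lemma taylor1_radial (F : {mpoly K[3]}) n (x : 'rV[K]_3) c : F \is n.-homog -> F.@[x 0] = 0 ->
  (taylor F x (c *: x))`_1 = 0.
Proof.
move=> hF /mult_ge1 F1; rewrite -[c *: x]add0r (taylor_shift 0 c hF F1).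
by have [d ->] := taylor1_dot F x; rewrite dot0r.
Qed.

(** The first-order terms of [b] and [c] at [x] are two linear forms on the tangent
    plane, independent by assumption, so that their values can be prescribed. *)
Lemma tangent_directions (b c : {mpoly K[3]}) n (x : 'rV[K]_3) (s t : K) : x != 0 ->
  b \is n.-homog -> c \is n.-homog -> b.@[x 0] = 0 -> c.@[x 0] = 0 ->
  (forall l m, mult_ge 2 (l *: b + m *: c) x -> l = 0 /\ m = 0) ->
  exists v, (taylor b x v)`_1 = s /\ (taylor c x v)`_1 = t.
Proof.
move=> x0 hb hc bx cx ind; have [u [w [lu [lw [H _ _ _]]]]] := frame x0.
have [db Db] := taylor1_dot b x; have [dc Dc] := taylor1_dot c x.
have dbx : dot db x = 0 by rewrite -Db -[x in taylor _ _ x]scale1r (taylor1_radial _ hb).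
have dcx : dot dc x = 0 by rewrite -Dc -[x in taylor _ _ x]scale1r (taylor1_radial _ hc).
have ind' l m : l * dot db u + m * dot dc u = 0 -> l * dot db w + m * dot dc w = 0 ->
    l = 0 /\ m = 0.
  move=> Eu Ew; apply: ind => v [|[|//]] _; rewrite taylorD !taylorZ coefD !coefZ.
    by rewrite !taylor0 bx cx !mulr0 addr0.
  rewrite Db Dc; have [e ->] := H v; rewrite !dotDr !dotZr dbx dcx.
  transitivity (dot lu v * (l * dot db u + m * dot dc u) + dot lw v * (l * dot db w + m * dot dc w)).
    by ring.
  by rewrite Eu Ew !mulr0 addr0.
set D := dot db u * dot dc w - dot db w * dot dc u.
have [D0|D0] := eqVneq D 0; last first.
  exists (((s * dot dc w - t * dot db w) / D) *: u + ((t * dot db u - s * dot dc u) / D) *: w).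
  by rewrite Db Dc !dotDr !dotZr; split; apply: (mulIf D0); rewrite mulrDl 2![_ / D * _]mulrAC -!mulrA;
     rewrite /D; field; rewrite -/D.
exfalso.
have [||dcu dbu] := ind' (dot dc u) (- dot db u).
- by ring.
- by rewrite -[RHS]oppr0 -[in RHS]D0 /D; ring.
move/eqP: dbu; rewrite oppr_eq0 => /eqP dbu.
have [||dcw dbw] := ind' (dot dc w) (- dot db w).
- by rewrite dcu dbu; ring.
- by ring.
move/eqP: dbw; rewrite oppr_eq0 => /eqP dbw.
have [||/eqP] := ind' 1 0; rewrite ?oner_eq0 //.
- by rewrite dcu dbu; ring.
- by rewrite dcw dbw; ring.
Qed.

End Composition.

Section BinaryForms.
Variable K : numClosedFieldType.

(** [rho] is [P] dehomogenised by [X_j = 1]; its roots give the factors other than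
    [X_j], and [X_j] makes up for the drop of its degree. *)
Lemma binary_form_split n (P : {mpoly K[n]}) e i j : P \is e.-homog -> P != 0 -> i != j ->
  P = P \mPo [tuple if (k == i) || (k == j) then 'X_k else 0 | k < n] ->
  exists2 c, c != 0 & exists2 zs : seq (K * K),
    all (fun z => (z.1 != 0) || (z.2 != 0)) zs
  & P = c *: \prod_(z <- zs) (z.1 *: 'X_i + z.2 *: 'X_j).
Proof.
move=> hP P0 ij EP.
pose rho := mmap (@polyC K) (fun k => if k == i then 'X else if k == j then 1 else 0) P.
have evP (x : 'I_n -> K) : x j != 0 -> P.@[x] = x j ^+ e * rho.[x i / x j].
  move=> xj; rewrite {1}EP comp_mpoly_meval.
  have := rmorph_mmap (@polyC K) (fun k => if k == i then 'X else if k == j then 1 else 0)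
    (horner_eval (x i / x j)) P.
  rewrite /= /horner_eval -/rho => ->.
  pose hk k := if k == i then x i / x j else if k == j then 1 else 0 : K.
  rewrite [X in _ * X](_ : _ = mmap idfun hk P); last first.
    apply: eq_mmap => [c|k] /=; first by rewrite hornerC.
    by rewrite /hk; case: ifP => _; [rewrite hornerX|case: ifP => _; rewrite hornerC].
  rewrite -(homog_mmap _ _ _ hP) /meval; apply: eq_mmap => [//|k] /=.
  rewrite tnth_mktuple /hk; have [->|ki] := eqVneq k i.
    by rewrite /= mmapX mmap1U mulrC divfK.
  by have [->|kj] := eqVneq k j; rewrite /= ?mmapX ?mmap1U ?mulr1 // mmap0 mulr0.
have ev0 (g : {mpoly K[n]}) : (forall x : 'I_n -> K, x j != 0 -> g.@[x] = 0) -> g = 0.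
  move=> g0; have /eqP : g * 'X_j = 0.
    apply: mpoly_eval_eq0 => x; rewrite mevalM mevalXU.
    by have [->|xj] := eqVneq (x j) 0; rewrite ?mulr0 // g0 ?mul0r.
  by rewrite mulf_eq0 -[X in _ || X]msize_poly_eq0 msizeX orbF => /eqP.
have rho0 : rho != 0.
  by apply: contraNneq P0 => r0; apply/eqP/ev0 => x xj; rewrite evP // r0 horner0 mulr0.
have srho : (size rho <= e.+1)%N.
  rewrite /rho /mmap; apply: leq_trans (size_sum _ _ _) _; apply/bigmax_leqP_seq => m mP _.
  rewrite mul_polyC; apply: leq_trans (size_scale_leq _ _) _.
  rewrite -(dhomog_mf hP mP) /= mdegE /mmap1.
  elim/big_rec2: _ => [|k q d _ IH]; first by rewrite size_poly1.
  apply: leq_trans (size_mul_leq _ _) _.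
  set h := (if _ then _ else _ : {poly K}).
  have : (size (h ^+ m k)%R <= (m k).+1)%N.
    apply: leq_trans (size_poly_exp_leq _ _) _; rewrite ltnS -[leqRHS]mul1n leq_mul2r.
    rewrite /h; case: ifP => _; first by rewrite size_polyX orbT.
    by case: ifP => _; rewrite ?size_poly1 ?size_poly0 orbT.
  by move: IH; move: (size _) (size _) => a b; lia.
have [rs Ers] := closed_field_poly_normal rho.
have lc0 : lead_coef rho != 0 by rewrite lead_coef_eq0.
have srs : (size rs <= e)%N.
  by move: srho; rewrite Ers size_scale // size_prod_XsubC.
exists (lead_coef rho) => //.
exists ([seq (1, - z) | z <- rs] ++ nseq (e - size rs) (0, 1)).
  rewrite all_cat all_map all_nseq /= oner_neq0 !orbT andbT.
  by apply/allP => z _ /=; rewrite oner_neq0.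
apply/eqP; rewrite -subr_eq0; apply/eqP/ev0 => x xj.
rewrite mevalB mevalZ evP // {1}Ers hornerZ mulrCA; apply/eqP; rewrite subr_eq0; apply/eqP.
congr (_ * _); rewrite big_cat big_map mevalM !rmorph_prod /= horner_prod.
have -> : \prod_(z <- nseq (e - size rs) (0, 1)) (z.1 *: 'X_i + z.2 *: 'X_j).@[x] = x j ^+ (e - size rs).
  by rewrite big_nseq scale0r scale1r add0r mevalXU iter_mulr_1.
rewrite -{1}(subnK srs) exprD -mulrA mulrC; congr (_ * _).
elim: rs {Ers srs} => [|z rs IH]; first by rewrite !big_nil mulr1.
rewrite !big_cons /= exprS mulrACA IH; congr (_ * _).
rewrite mevalD !mevalZ !mevalXU hornerXsubC mulrBr mulrCA divff // mulr1 mul1r mulNr.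
by rewrite [x j * z]mulrC.
Qed.

End BinaryForms.

Section CompositionAssociativity.
Variable K : numFieldType.

Lemma comp_mpolyA k m n (G : {mpoly K[k]}) (A : k.-tuple {mpoly K[m]}) (B : m.-tuple {mpoly K[n]}) :
  (G \mPo A) \mPo B = G \mPo [tuple tnth A j \mPo B | j < k].
Proof.
have := rmorph_mmap (@mpolyC m K) (tnth A) (mmap (@mpolyC n K) (tnth B)) G.
rewrite /comp_mpoly => ->; apply: eq_mmap => [c|j] /=; first by rewrite mmapC.
by rewrite tnth_mktuple.
Qed.

Lemma comp_mpolyXE k n (A : k.-tuple {mpoly K[n]}) i : 'X_i \mPo A = tnth A i.
Proof. by rewrite comp_mpolyXU -tnth_nth. Qed.

Lemma comp_mpolyM k n (A : k.-tuple {mpoly K[n]}) : {morph comp_mpoly A : P Q / P * Q}.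
Proof. by move=> P Q; rewrite rmorphM. Qed.

Lemma comp_homog k n (G : {mpoly K[k]}) (A : k.-tuple {mpoly K[n]}) d e :
  G \is d.-homog -> (forall j, tnth A j \is e.-homog) -> G \mPo A \is (d * e).-homog.
Proof.
move=> hG hA; rewrite comp_mpolyEX big_seq; apply: rpred_sum => m mG; apply: dhomogZ.
rewrite comp_mpolyX -(dhomog_mf hG mG) /= mdegE big_distrl /=.
elim/big_rec2: _ => [|j x y _ hx]; first exact: dhomog1.
by apply: dhomogM => //; rewrite mulnC; apply: dhomogMn.
Qed.

End CompositionAssociativity.

Section NotBirational.
Variables (K : numClosedFieldType) (f : {mpoly K[3]}) (p : 'I_10 -> 'rV[K]_3).
Hypotheses (hf : f \is 6.-homog) (firr : irreducible_mpoly f).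
Hypotheses (p0 : forall i, p i != 0) (pinj : forall i j, proj_eq (p i) (p j) -> i = j).
Hypothesis f2 : forall i, mult_ge 2 f (p i).

Lemma X_neq0 n (i : 'I_n) : 'X_i != 0 :> {mpoly K[n]}.
Proof. by rewrite -msize_poly_eq0 msizeX. Qed.

Lemma divides_prod_split n (a : {mpoly K[n]}) (bs : seq {mpoly K[n]}) (c : K) :
  c != 0 -> a != 0 -> divides a (c *: \prod_(b <- bs) b) ->
  exists c' us, [/\ a = c' *: \prod_(u <- us) u
    & forall u, u \in us -> exists2 b, b \in bs & divides u b].
Proof.
move=> c0; elim: bs a => [|b bs IH] a a0.
  rewrite big_nil => [[v E]]; exists a@_0, [::]; split=> //.
  rewrite big_nil -mul_mpolyC mulr1; apply: msize1_polyC.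
  have : (msize a <= msize (c *: 1 : {mpoly K[n]}))%N.
    apply: dvd_msize; last by exists v.
    by rewrite mscalerI (negPf c0) oner_eq0.
  by rewrite msizeZ // msize1.
rewrite big_cons scalerAr => /(dvd_mul_split a0)[a1 [a2 [Ea d1 d2]]].
have a20 : a2 != 0 by apply: contraNneq a0 => E; rewrite Ea E mulr0.
have [c' [us [E us_dvd]]] := IH a2 a20 d2.
exists c', (a1 :: us); split; first by rewrite Ea E big_cons scalerAr.
move=> u; rewrite inE => /orP[/eqP->|/us_dvd[b' b'bs ub]].
  by exists b; rewrite ?mem_head.
by exists b'; rewrite // inE b'bs orbT.
Qed.

(** A basis [a], [b], [c] of the net with [a] singular at [p ord0]: the map to the plane
    sends the exceptional curve over [p ord0] to the line [X_0 = 0]. *)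
Variables (a b c : {mpoly K[3]}).
Hypotheses (na : cubic_net p a) (nb : cubic_net p b) (nc : cubic_net p c).
Hypotheses (a0 : a != 0) (a2 : mult_ge 2 a (p ord0)).
Hypothesis span : forall v, cubic_net p v ->
  exists x y z, v = x *: a + y *: b + z *: c.
Hypothesis ind : forall x y, mult_ge 2 (x *: b + y *: c) (p ord0) -> x = 0 /\ y = 0.

Let W := [tuple a; b; c].

Lemma independent_pencil x y : (x != 0) || (y != 0) -> ~ dependent a (x *: b + y *: c).
Proof.
move=> xy [s [t [st E]]].
have [t0|t0] := eqVneq t 0.
  move: st E; rewrite t0 eqxx orbF scale0r addr0 => s0 /eqP.
  by rewrite mscalerI (negPf s0) (negPf a0).
have m2 : mult_ge 2 ((t * x) *: b + (t * y) *: c) (p ord0).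
  have -> : (t * x) *: b + (t * y) *: c = - s *: a.
    by apply/eqP; rewrite scaleNr -addr_eq0 addrC -E !scalerDr !scalerA.
  exact: mult_geZ.
have [/eqP tx /eqP ty] := ind m2.
by move: xy; move: tx ty; rewrite !mulf_eq0 (negPf t0) /= => -> ->.
Qed.

(** Each of the [us] divides two independent cubics of the net, so [contracted_degree]
    applies to it, and the bounds add up. *)
Lemma contracted_product (us : seq {mpoly K[3]}) d :
  \prod_(u <- us) u \is d.-homog -> \prod_(u <- us) u != 0 ->
  (forall u, u \in us -> divides u a) ->
  (forall u, u \in us -> exists x y, (x != 0) || (y != 0) /\ divides u (x *: b + y *: c)) ->
  (3 * d <= \sum_(i in seven_points) \sum_(u <- us) (u.@[p i 0] == 0)%R)%N.
Proof.
elim: us d => [|u us IH] d hus us0 ua ub.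
  by rewrite big_nil in hus us0; rewrite (dhomog_uniq us0 hus (dhomog1 _ _)).
rewrite big_cons in hus us0.
have [d1 [d2 [h1 h2 <-]]] := homog_factor hus us0.
have [u0 us0'] : u != 0 /\ \prod_(u <- us) u != 0.
  by apply/andP; rewrite -negb_or -mulf_eq0.
under eq_bigr do rewrite big_cons.
rewrite big_split mulnDr /=; apply: leq_add; last first.
  by apply: IH => // v vus; [apply: ua|apply: ub]; rewrite inE vus orbT.
have [x [y [xy ubc]]] := ub u (mem_head _ _).
have := contracted_degree hf firr p0 pinj f2 h1 na (cubic_net_comb x y nb nc)
  (independent_pencil xy) (ua u (mem_head _ _)) ubc.
move/leq_trans; apply; rewrite -sum_nat_pred [leqRHS]big_mkcond /=.
by apply: leq_sum => i _; case: (i \in seven_points).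
Qed.

(** The net sends the tangent directions at [p i] to first-order terms, where an inverse
    [S] of the net has to take the value [p i]. *)
Lemma inverse_at_node (i : 'I_10) e (S : 'I_3 -> {mpoly K[3]}) (H : {mpoly K[3]}) :
  (i < 7)%N -> (forall k, S k \is e.-homog) -> (forall k, S k \mPo W = H * 'X_k) ->
  mult_ge e H (p i) /\ forall v k,
    (S k).@[fun j => (taylor (tnth W j) (p i) v)`_1] = (taylor H (p i) v)`_e * p i 0 k.
Proof.
move=> i7 hS SW.
have Wi j : (tnth W j).@[p i 0] = 0.
  by case: j => [[|[|[|//]]] Hj]; rewrite /W /tnth /=; [case: na|case: nb|case: nc] => _ ->.
have key v k : exists2 r, taylor H (p i) v * ((p i 0 k)%:P + v 0 k *: 'X) = 'X^e * r
    & r`_0 = (S k).@[fun j => (taylor (tnth W j) (p i) v)`_1].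
  have /boolp.choice[Q HQ] : forall j, exists q, taylor (tnth W j) (p i) v = 'X * q.
    by move=> j; apply: divides_X; rewrite taylor0.
  exists (mmap (@polyC K) Q (S k)).
    rewrite -taylorX -taylorM -SW taylor_comp (boolp.funext HQ : (fun j => _) = _).
    exact: homog_mmap.
  by rewrite mmap_coef0; apply: meval_eq => j; rewrite HQ coefXM.
have [k pik] : exists k, p i 0 k != 0.
  apply: boolp.contrapT => nk; case/eqP: (p0 i); apply/rowP => k; rewrite mxE; apply/eqP.
  by apply: contraT => pik; case: nk; exists k.
have He v : divides 'X^e (taylor H (p i) v).
  have [r E _] := key v k.
  apply: (@divides_Xn_cancel _ 0 e ((p i 0 k)%:P + v 0 k *: 'X)); first by exists r; rewrite mulrC.
  case=> q /(congr1 (fun q : {poly K} => q`_0)).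
  rewrite expr1 coefXM coefD coefC coefZ coefX mulr0 addr0 /= => E0.
  by rewrite E0 eqxx in pik.
split=> [v j je|v k']; first by have [q ->] := He v; rewrite coefXnM je.
have [r E <-] := key v k'; have [h Eh] := He v.
have Xe0 : 'X^e != 0 :> {poly K} by rewrite expf_neq0 ?polyX_eq0.
have <- : h * ((p i 0 k')%:P + v 0 k' *: 'X) = r.
  by apply: (mulfI Xe0); rewrite mulrA -Eh.
by rewrite coef0M Eh coefXnM ltnn subnn coefD coefC coefZ coefX mulr0 addr0.
Qed.

Let Z : 3.-tuple {mpoly K[3]} := [tuple if (k == 1) || (k == 2) then 'X_k else 0 | k < 3].

(** On the line [X_0 = 0] an inverse [S] of the net is a multiple [h] of [p ord0], by
    [inverse_at_node]. Hence [X_0] divides the combinations of the [S k] that vanish at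
    [p ord0], and, substituting the net, [a] divides [H], so that it divides the
    substitution of [b] and [c] in the restriction [P] of each [S k] to the line.
    If [P] is not [0], it splits into linear factors, and [a] is a product of factors of
    members of the pencil of [b] and [c]. By [contracted_product] these pass at least
    nine times through the seven points, which exceeds the multiplicities of [a], unless
    [a] has a triple point at [p ord0] or another double point [p i]. In the former case
    [H] vanishes to too high an order at [p ord0], so that [h = 0]; in the latter the
    value of [S] on the line is also a multiple of [p i], so that it is [0]. *)
Lemma net_not_birational_step e (S : 'I_3 -> {mpoly K[3]}) (H : {mpoly K[3]}) :
  (forall k, S k \is e.+1.-homog) -> (forall k, S k \mPo W = H * 'X_k) ->
  (forall k, S k \mPo Z = 0) /\ divides a H.
Proof.
move=> hS SW.
have [He SD] := inverse_at_node (i := ord0) isT hS SW.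
have bp (i : 'I_10) : (i < 7)%N -> b.@[p i 0] = 0 by case: nb => _; apply.
have cp (i : 'I_10) : (i < 7)%N -> c.@[p i 0] = 0 by case: nc => _; apply.
have dir (y : 'I_3 -> K) : exists v, forall j,
    (taylor (tnth W j) (p ord0) v)`_1 = if (j == 1) || (j == 2) then y j else 0.
  have [v [Ev1 Ev2]] := tangent_directions (y 1) (y 2) (p0 ord0) nb.1 nc.1 (bp ord0 isT) (cp ord0 isT) ind.
  exists v => -[[|[|[|//]]] Hj]; rewrite /W /tnth /=.
  - by apply: a2.
  - by rewrite Ev1; congr y; apply: val_inj.
  - by rewrite Ev2; congr y; apply: val_inj.
have evZ (P : {mpoly K[3]}) (y : 'I_3 -> K) :
    (P \mPo Z).@[y] = P.@[fun j => if (j == 1) || (j == 2) then y j else 0].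
  rewrite comp_mpoly_meval; apply: meval_eq => j; rewrite tnth_mktuple.
  by case: ifP => _; rewrite ?mevalXU ?meval0.
have SZ v k y : (forall j, (taylor (tnth W j) (p ord0) v)`_1 = if (j == 1) || (j == 2) then y j else 0) ->
    (S k \mPo Z).@[y] = (taylor H (p ord0) v)`_e.+1 * p ord0 0 k.
  by move=> Ev; rewrite evZ -SD; apply: meval_eq => j; rewrite Ev.
have modX0 (P : {mpoly K[3]}) : divides 'X_0 (P - (P \mPo Z)).
  rewrite -[X in X - _]comp_mpoly_id; apply: comp_sub_divides => j.
  rewrite !tnth_mktuple; case: j => [[|[|[|//]]] Hj] /=; last first.
  - by rewrite subrr; apply: dvdr0.
  - by rewrite subrr; apply: dvdr0.
  - by rewrite subr0 (_ : Ordinal Hj = 0) //; [exact: dvdrr|exact: val_inj].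
pose Sx (x : 'rV[K]_3) := \sum_k x 0 k *: S k.
have SxW x : Sx x \mPo W = H * lin x.
  rewrite /Sx raddf_sum /lin mulr_sumr; apply: eq_bigr => k _ /=.
  by rewrite comp_mpolyZ SW scalerAr.
have SxZ x : dot x (p ord0) = 0 -> Sx x \mPo Z = 0.
  move=> xp; apply: mpoly_eval_eq0 => y; have [v Ev] := dir y.
  rewrite /Sx (raddf_sum (comp_mpoly Z)) (raddf_sum (meval y)) /=.
  rewrite (eq_bigr (fun k => (taylor H (p ord0) v)`_e.+1 * (x 0 k * p ord0 0 k))).
    by rewrite -mulr_sumr -/(dot x (p ord0)) xp mulr0.
  by move=> k _; rewrite comp_mpolyZ mevalZ (SZ v k y) // mulrCA.
have Sx_dvd x : dot x (p ord0) = 0 -> divides 'X_0 (Sx x).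
  by move=> /SxZ E; have := modX0 (Sx x); rewrite E subr0.
have X0W (P : {mpoly K[3]}) : divides 'X_0 P -> divides a (P \mPo W).
  by case=> T ->; exists (T \mPo W); rewrite comp_mpolyM comp_mpolyXE.
have [u [w [lu [lw [Hv [lup lwp] [luu luw] [lwu lww]]]]]] := frame (p0 ord0).
have aH : divides a H.
  have [A EA] := X0W _ (Sx_dvd lu lup); have [B EB] := X0W _ (Sx_dvd lw lwp).
  rewrite SxW in EA; rewrite SxW in EB.
  have E : lin lw * A = lin lu * B.
    apply: (mulfI a0); rewrite mulrCA -EA mulrCA [RHS]mulrCA -EB; ring.
  have lu0 : lu != 0 by apply: contra_eq_neq luu => ->; rewrite dot0l eq_sym oner_neq0.
  have [[C EC]|[A' EA']] := irreducible_prime (lin_irreducible lu0) (ex_intro _ B E).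
    have := lin_eval lw w; rewrite EC mevalM lin_eval luw lww mul0r => /eqP.
    by rewrite eq_sym oner_eq0.
  exists A'; apply: (mulIf (_ : lin lu != 0)); last by rewrite EA EA'; ring.
  by apply: contraNneq lu0 => /lin_eq0->.
split=> //; apply: boolp.contrapT => /boolp.existsNP[k /eqP Pk0].
set P := S k \mPo Z in Pk0.
have hP : P \is e.+1.-homog.
  rewrite -[e.+1]muln1; apply: comp_homog => // j; rewrite tnth_mktuple.
  by case: ifP => _; rewrite ?dhomog0 // dhomogX /= mdeg1.
have ZE : P = P \mPo Z.
  rewrite /P comp_mpolyA; congr (_ \mPo _); apply: eq_from_tnth => j.
  rewrite !tnth_mktuple; case: ifP => jj; last by rewrite comp_mpoly0.
  by rewrite comp_mpolyXE tnth_mktuple jj.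
have [q q0 [zs zs0 EP]] := binary_form_split hP Pk0 (isT : (1 : 'I_3) != 2) ZE.
have aP : divides a (P \mPo W).
  have -> : P \mPo W = H * 'X_k - ((S k - P) \mPo W) by rewrite comp_mpolyB -SW; ring.
  by apply: dvdrB; [exact: dvdr_mulr|exact/X0W/modX0].
have PW : P \mPo W = q *: \prod_(t <- [seq z.1 *: b + z.2 *: c | z <- zs]) t.
  rewrite EP comp_mpolyZ big_map; congr (_ *: _); rewrite rmorph_prod /=; apply: eq_bigr => z _.
  by rewrite comp_mpolyD !comp_mpolyZ !comp_mpolyXE.
rewrite PW in aP.
have [q' [us [Ea us_dvd]]] := divides_prod_split q0 a0 aP.
have q'0 : q' != 0 by apply: contraNneq a0 => E; rewrite Ea E scale0r.
have us0 : \prod_(u <- us) u != 0 by apply: contraNneq a0 => E; rewrite Ea E scaler0.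
have hus : \prod_(u <- us) u \is 3.-homog.
  rewrite -[X in X \is _]scale1r -(mulVf q'0) -scalerA -Ea; apply: dhomogZ; exact: na.1.
have cnt := contracted_product hus us0.
have ge9 : (9 <= \sum_(i in seven_points) \sum_(u <- us) (u.@[p i 0] == 0)%R)%N.
  apply: cnt => t tus.
    rewrite Ea (big_rem t) //= scalerAr; apply: dvdr_mulr; exact: dvdrr.
  have [_ /mapP[z zzs ->] tb] := us_dvd t tus.
  by exists z.1, z.2; split=> //; apply: (allP zs0).
have mult_count i : mult_ge (\sum_(u <- us) (u.@[p i 0] == 0)%R)%N a (p i).
  by rewrite Ea; apply/mult_geZ/vanishing_count.
have notP : ~ (forall y, P.@[y] = 0) by move=> /mpoly_eval_eq0 /eqP; apply/negP.
have [m3|m3] := boolp.pselect (mult_ge 3 a (p ord0)).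
  apply: notP => y; have [v Ev] := dir y.
  have zero x : dot x (p ord0) = 0 -> dot x v != 0 -> P.@[y] = 0.
    move=> xp xv; have [T ET] := Sx_dvd x xp.
    have hT : T \is e.-homog.
      apply: (@homog_cofactor _ _ 'X_0 _ 1 e (X_neq0 _)); first by rewrite dhomogX /= mdeg1.
      by rewrite -ET; apply: rpred_sum => j _; apply/dhomogZ/hS.
    have TW : mult_ge e (T \mPo W) (p ord0).
      apply: comp_homog_mult => // j; case: j => [[|[|[|//]]] Hj]; rewrite /W /tnth /=.
      - by case: na => _; apply.
      - exact: bp.
      - exact: cp.
    have : (taylor (Sx x \mPo W) (p ord0) v)`_e.+2 = 0.
      by rewrite ET comp_mpolyM comp_mpolyXE; apply: (mult_geM m3 TW).
    rewrite SxW taylorM taylor_lin xp add0r -scalerAr coefZ coefMX /= => /eqP.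
    by rewrite mulf_eq0 (negPf xv) /= => /eqP H0; rewrite (SZ v k y Ev) H0 mul0r.
  have [lu0|] := eqVneq (dot lu v) 0; last exact: zero.
  have [lw0|] := eqVneq (dot lw v) 0; last exact: zero.
  have [r Er] := Hv v; rewrite lu0 lw0 !scale0r !addr0 in Er.
  rewrite evZ (meval_eq _ (_ : _ =1 fun j => 0 * 0)).
    by rewrite (homog_eval_scale _ _ (hS k)) exprS !mul0r.
  move=> j; rewrite -Ev Er mul0r; case: j => [[|[|[|//]]] Hj]; rewrite /W /tnth /=.
  - by apply: (taylor1_radial _ na.1); case: na => _; apply.
  - exact: taylor1_radial nb.1 (bp ord0 isT).
  - exact: taylor1_radial nc.1 (cp ord0 isT).
have [nd|] := boolp.pselect (forall i : 'I_10, (i < 7)%N -> i != ord0 -> ~ mult_ge 2 a (p i)).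
  suff : (\sum_(i in seven_points) \sum_(u <- us) (u.@[p i 0] == 0)%R <= 8)%N.
    by move: ge9; move: (\sum_(i in _) _)%N => n; lia.
  apply: leq_trans (_ : \sum_(i in seven_points) (1 + (i == ord0)) <= 8)%N; last first.
    by rewrite big_mkcond !big_ord_recr big_ord0 /= !inE.
  apply: leq_sum => i; rewrite inE => i7; rewrite leqNgt; apply/negP => lt.
  have [i0|i0] := eqVneq i ord0.
    by apply: m3; apply: mult_ge_leq (mult_count ord0); move: lt; rewrite i0.
  by apply: (nd i i7 i0); apply: mult_ge_leq (mult_count i); move: lt; rewrite (negPf i0).
move=> /boolp.existsNP[i /boolp.not_implyP[i7 /boolp.not_implyP[i0 /boolp.contrapT ai2]]].
have indi x y : mult_ge 2 (x *: b + y *: c) (p i) -> x = 0 /\ y = 0.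
  move=> m2; have [xy|] := boolP ((x != 0) || (y != 0)); last first.
    by rewrite negb_or !negbK => /andP[/eqP-> /eqP->].
  have [A [B [nA nB indAB]]] := cubic_net_tangents hf firr p0 pinj f2 i7.
  have [x0 [x1 [x2 EA]]] := span nA; have [y0 [y1 [y2 EB]]] := span nB.
  have [l [m [lm E]]] := dependent_scalars (y * x1 - x * x2) (y * y1 - x * y2).
  have Eyx : y * (l * x1 + m * y1) = x * (l * x2 + m * y2).
    by apply/eqP; rewrite -subr_eq0 -[X in _ == X]E; apply/eqP; ring.
  have [r [Er1 Er2]] : exists r, l * x1 + m * y1 = r * x /\ l * x2 + m * y2 = r * y.
    have [x00|x00] := eqVneq x 0; last first.
      exists ((l * x1 + m * y1) / x); rewrite divfK //; split=> //.
      by apply: (mulfI x00); rewrite -Eyx; field.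
    have y00 : y != 0 by move: xy; rewrite x00 eqxx.
    exists ((l * x2 + m * y2) / y); rewrite divfK //; split=> //.
    by apply: (mulfI y00); rewrite Eyx x00; ring.
  have [] := indAB l m.
    have -> : l *: A + m *: B = (l * x0 + m * y0) *: a + r *: (x *: b + y *: c).
      by rewrite EA EB !scalerDr !scalerA -Er1 -Er2 !scalerDl; ring.
    by apply: mult_geD; apply: mult_geZ.
  by move=> l0 m0; move: lm; rewrite l0 m0 eqxx.
apply: notP => y; have [v Ev] := dir y.
have [v' [Ev1 Ev2]] := tangent_directions (y 1) (y 2) (p0 i) nb.1 nc.1 (bp i i7) (cp i i7) indi.
have Ev' j : (taylor (tnth W j) (p i) v')`_1 = if (j == 1) || (j == 2) then y j else 0.
  case: j => [[|[|[|//]]] Hj]; rewrite /W /tnth /=.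
  - exact: ai2.
  - by rewrite Ev1; congr y; apply: val_inj.
  - by rewrite Ev2; congr y; apply: val_inj.
have [_ SDi] := inverse_at_node i7 hS SW.
have h0 : (taylor H (p ord0) v)`_e.+1 = 0.
  apply/eqP; apply: contraNT i0 => h0; apply/eqP/esym/pinj.
  have hh k' : (taylor H (p ord0) v)`_e.+1 * p ord0 0 k' = (taylor H (p i) v')`_e.+1 * p i 0 k'.
    by rewrite -(SZ v k' y Ev) evZ -SDi; apply: meval_eq => j; rewrite Ev'.
  have h'0 : (taylor H (p i) v')`_e.+1 != 0.
    apply: contraNneq (p0 ord0) => h'0; apply/eqP/rowP => k'; apply: (mulfI h0).
    by rewrite hh h'0 mul0r mxE mulr0.
  exists ((taylor H (p ord0) v)`_e.+1 / (taylor H (p i) v')`_e.+1); first by rewrite mulf_neq0 ?invr_eq0.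
  apply/rowP => k'; rewrite mxE; apply: (mulfI h'0).
  by rewrite -hh mulrA mulrCA divff // mulr1.
by rewrite (SZ v k y Ev) h0 mul0r.
Qed.

(** The map given by the net has degree two, the self-intersection of
    [3L - E_1 - .. - E_7]. The proof is a descent: an inverse restricts to [0] on the line
    [X_0 = 0], hence is divisible by [X_0], and the quotient is an inverse of lower
    degree. *)
Theorem net_not_birational e (S : 'I_3 -> {mpoly K[3]}) (H : {mpoly K[3]}) :
  (forall k, S k \is e.-homog) -> H != 0 -> (forall k, S k \mPo W = H * 'X_k) -> False.
Proof.
elim: e S H => [|e IH] S H hS H0 SW.
  have E : S 0 = ((S 0)@_0%MM)%:MP.
    by apply: msize1_polyC; have [->|n0] := eqVneq (S 0) 0; rewrite ?msize0 // (homog_msize n0 (hS 0)).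
  have := SW 0; rewrite E comp_mpolyC => E0.
  have := congr1 (meval (fun=> 0)) E0; rewrite mevalC mevalM mevalXU mulr0 => c0.
  by move/eqP: E0; rewrite c0 mpolyC0 eq_sym mulf_eq0 (negPf H0) (negPf (X_neq0 _)).
have [SZ [H' EH]] := net_not_birational_step hS SW.
have /boolp.choice[T HT] : forall k, exists T, S k = 'X_0 * T.
  move=> k; have : divides 'X_0 (S k - (S k \mPo Z)).
    rewrite -[X in X - _]comp_mpoly_id; apply: comp_sub_divides => j.
    rewrite !tnth_mktuple; case: j => [[|[|[|//]]] Hj] /=; last first.
    - by rewrite subrr; apply: dvdr0.
    - by rewrite subrr; apply: dvdr0.
    - by rewrite subr0 (_ : Ordinal Hj = 0) //; [exact: dvdrr|exact: val_inj].
  by rewrite SZ subr0.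
apply: (IH T H').
- move=> k; apply: (@homog_cofactor _ _ 'X_0 _ 1 e (X_neq0 _)); first by rewrite dhomogX /= mdeg1.
  by rewrite -HT.
- by apply: contraNneq H0 => E; rewrite EH E mulr0.
- move=> k; apply: (mulfI a0).
  by rewrite mulrA -EH -SW HT comp_mpolyM comp_mpolyXE.
Qed.

End NotBirational.

(** * The quintic model: edges of the tetrahedron and cubics *)

Section NodesOfSextic.
Variables (K : numFieldType) (f : {mpoly K[3]}) (p : 'I_10 -> 'rV[K]_3).

(** A tangent cone that is a product of two nonzero linear forms is nonzero. *)
Lemma node_mult (x : 'rV[K]_3) : node f x -> mult_ge 2 f x /\ ~ mult_ge 3 f x.
Proof.
move=> [f2 [a [b [rk ab]]]]; split=> // f3.
have lin0 : lin a * lin b = 0.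
  apply: mpoly_eval_eq0 => v; have := f3 (\row_j v j) 2%N isT; rewrite ab => E.
  rewrite mevalM -[RHS]E; have ev w : (lin w).@[v] = (w *m (\row_j v j)^T) 0 0.
    rewrite (meval_eq _ (_ : v =1 (\row_j v j) 0)) => [|j]; last by rewrite mxE.
    by rewrite lin_eval /dot mxE; apply: eq_bigr => j _; rewrite !mxE.
  by rewrite !ev.
have : (\rank (col_mx a b) <= 1)%N.
  move/eqP: lin0; rewrite mulf_eq0 => /orP[/eqP/lin_eq0->|/eqP/lin_eq0->].
    apply: leq_trans (mxrankS (_ : (col_mx 0 b <= b)%MS)) (rank_leq_row b).
    by rewrite col_mx_sub sub0mx submx_refl.
  apply: leq_trans (mxrankS (_ : (col_mx a 0 <= a)%MS)) (rank_leq_row a).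
  by rewrite col_mx_sub sub0mx submx_refl.
by rewrite rk.
Qed.

Lemma ten_nodes_spec : ten_nodes f p -> [/\ forall i, p i != 0,
  forall i j, proj_eq (p i) (p j) -> i = j, forall i, mult_ge 2 f (p i)
  & forall i, ~ mult_ge 3 f (p i)].
Proof.
move=> [p0 pinj pn]; have nd i : node f (p i).
  by apply/(pn _ (p0 i)); exists i, 1; rewrite ?oner_neq0 ?scale1r.
by split=> // i; have [] := node_mult (nd i).
Qed.

End NodesOfSextic.

Section EdgeTangents.
Variables (K : numFieldType) (F : 4.-tuple {mpoly K[3]}).

(** On an exceptional curve that is mapped isomorphically onto an edge, the first-order
    terms of [F] parametrise the vectors with [X_i = X_j = 0]. *)
Lemma edge_tangents (x : 'rV[K]_3) i j : exceptional_iso_onto_edge F x i j ->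
  (forall v, (taylor (tnth F i) x v)`_1 = 0 /\ (taylor (tnth F j) x v)`_1 = 0) /\
  forall A : 'I_4 -> K, mult_ge 2 (\sum_k A k *: tnth F k) x ->
    forall k, k != i -> k != j -> A k = 0.
Proof.
move=> [D1 _ D3]; split=> [v|A m2 k ki kj].
  by have [E1 E2] := D1 v; rewrite !mxE in E1 E2.
have [|v Ev] := D3 (delta_mx 0 k).
  by split; rewrite mxE eqxx eq_sym ?(negPf ki) ?(negPf kj).
have := m2 v 1%N isT.
rewrite (big_morph (fun G => taylor G x v) (taylorD _ _) (_ : _ = 0)) ?coef_sum; last by rewrite /taylor mmap0.
rewrite (bigD1 k) //= big1 ?addr0 => [|l lk]; rewrite taylorZ coefZ.
- by have /rowP/(_ k) := Ev; rewrite !mxE !eqxx => ->; rewrite mulr1.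
- by have /rowP/(_ l) := Ev; rewrite !mxE eqxx (negPf lk) => ->; rewrite mulr0.
Qed.

End EdgeTangents.

Section Setup.
Variables (K : numFieldType) (f : {mpoly K[3]}) (p : 'I_10 -> 'rV[K]_3).
Hypotheses (hf : f \is 6.-homog) (firr : irreducible_mpoly f).
Hypotheses (p0 : forall i, p i != 0) (pinj : forall i j, proj_eq (p i) (p j) -> i = j).
Hypothesis f2 : forall i, mult_ge 2 f (p i).

(** [3L - E_1 - .. - E_10] meets the strict transform of the sextic in [18 - 20 < 0]
    points. *)
Lemma no_anticanonical (v : {mpoly K[3]}) : v \is 3.-homog ->
  (forall i, v.@[p i 0] = 0) -> v = 0.
Proof.
move=> hv vp; apply: (node_bezout hf firr p0 pinj f2 (k := fun=> 1%N) hv) => // [i|].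
  exact/mult_ge1.
by rewrite sum_nat_const card_ord.
Qed.

(** Otherwise some combination of the two cubics would pass through the tenth node. *)
Lemma cubic_nine_nodes (v w : {mpoly K[3]}) (k : 'I_10) : v \is 3.-homog -> w \is 3.-homog ->
  (forall i, i != k -> v.@[p i 0] = 0) -> (forall i, i != k -> w.@[p i 0] = 0) ->
  w != 0 -> exists c, v = c *: w.
Proof.
move=> hv hw vp wp w0.
have wk : w.@[p k 0] != 0.
  apply: contraNneq w0 => wk; apply/eqP/no_anticanonical => // i.
  by have [->|/wp] := eqVneq i k.
exists (v.@[p k 0] / w.@[p k 0]); apply/eqP; rewrite -subr_eq0; apply/eqP.
apply: no_anticanonical => [|i]; first by rewrite rpredB ?rpredZ.
rewrite mevalB mevalZ; have [->|ik] := eqVneq i k; first by rewrite divfK // subrr.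
by rewrite (vp i) // (wp i) // mulr0 subrr.
Qed.

Lemma last_index_inj : injective last_index.
Proof. by move=> i j /(congr1 val) /= /addnI E; apply: val_inj. Qed.

Lemma last_indexP (i : 'I_10) : (i < 7)%N \/ exists k, i = last_index k.
Proof.
have [|i7] := ltnP i 7; [by left|right].
have lt : (i - 7 < 3)%N by have := ltn_ord i; lia.
by exists (Ordinal lt); apply: val_inj; rewrite /= subnKC.
Qed.

Lemma last_index_ge k : (last_index k < 7)%N = false.
Proof. by apply/negbTE; rewrite -leqNgt leq_addr. Qed.

Variables (F : 4.-tuple {mpoly K[3]}).
Hypotheses (FB : basis_of_sections p 6 H_mult F) (FA : adapted_coordinates p F).

(** The members [C j] of the three systems [|-K_X + E_k|], where [k = N j] runs over the
    last three indices; no order of these is assumed. *)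
Record cubic_triangle (N : 'I_3 -> 'I_10) (C : 'I_3 -> {mpoly K[3]}) : Prop := CubicTriangle {
  triangle_inj : injective N;
  triangle_ge : forall j, (N j < 7)%N = false;
  triangle_cover : forall i : 'I_10, (i < 7)%N \/ exists j, i = N j;
  triangle_homog : forall j, C j \is 3.-homog;
  triangle_van : forall j i, i != N j -> (C j).@[p i 0] = 0;
  triangle_nz : forall j, (C j).@[p (N j) 0] != 0 }.

Lemma ord3_cases (P : 'I_3 -> Prop) : P 0 -> P 1 -> P 2 -> forall j, P j.
Proof.
move=> P0 P1 P2 [[|[|[|//]]] Hj]; [move: P0|move: P1|move: P2];
  by congr P; apply: val_inj.
Qed.

Lemma ord4_cases (P : 'I_4 -> Prop) : P 0 -> P 1 -> P 2 -> P 3 -> forall j, P j.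
Proof.
move=> P0 P1 P2 P3 [[|[|[|[|//]]]] Hj]; [move: P0|move: P1|move: P2|move: P3];
  by congr P; apply: val_inj.
Qed.

(** The sextic [f] is itself a section and is singular at the last three points. At each of
    them two of [F 1], [F 2], [F 3] have independent tangents, by [edge_tangents], so that
    only [F 0] enters in [f]. Each cubic of the triangle divides two of [F 1], [F 2], [F 3],
    and the points where these are singular identify the residual cubics. *)
Lemma quintic_coordinates : exists N C (k : 'I_4 -> K),
  [/\ cubic_triangle N C,
      forall j, k j != 0
    & [/\ tnth F 0 = k 0 *: f, tnth F 1 = k 1 *: (C 0 * C 1),
          tnth F 2 = k 2 *: (C 0 * C 2) & tnth F 3 = k 3 *: (C 1 * C 2)]].
Proof.
have [[s [s0 s1 s2]] [t [c [cE d0 d1 d2]]]] := FA.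
have [sF indF spanF] := FB.
have [t0 i0] := edge_tangents s0; have [t1 i1] := edge_tangents s1; have [t2 i2] := edge_tangents s2.
have f0 : f != 0 by have [+ _] := firr; apply: contraTneq => ->; rewrite msize0.
pose P k := p (last_index k).
have FP j k : (tnth F j).@[P k 0] = 0.
  by apply/mult_ge1; have [_ /(_ (last_index k))] := sF j; rewrite /H_mult last_index_ge.
have F7 j (i : 'I_10) : (i < 7)%N -> mult_ge 2 (tnth F j) (p i).
  by move=> i7; have [_ /(_ i)] := sF j; rewrite /H_mult i7.
have dbl j k : (forall v, (taylor (tnth F j) (P k) v)`_1 = 0) -> mult_ge 2 (tnth F j) (P k).
  by move=> H v [|[|//]] _; rewrite ?taylor0 ?FP.
have m10 : mult_ge 2 (tnth F 1) (P (s 0)) by apply: dbl => v; case: (t0 v).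
have m21 : mult_ge 2 (tnth F 2) (P (s 1)) by apply: dbl => v; case: (t1 v).
have m32 : mult_ge 2 (tnth F 3) (P (s 2)) by apply: dbl => v; case: (t2 v).
have [k0 k00 F0E] : exists2 k0, k0 != 0 & tnth F 0 = k0 *: f.
  have [|A EA] := spanF f.
    split=> // i; apply: mult_ge_leq (f2 i); rewrite /H_mult; by case: ifP.
  have A0 := i0 A; rewrite -EA in A0; have {}A0 := A0 (f2 _).
  have A1 := i1 A; rewrite -EA in A1; have {}A1 := A1 (f2 _).
  have E : f = A 0 *: tnth F 0.
    rewrite [LHS]EA (bigD1 0) //= big1 ?addr0 // => j j0.
    rewrite (_ : A j = 0) ?scale0r //; move: j0; move: j; apply: ord4_cases => // _; [exact: A1|exact: A0|exact: A0].
  have A00 : A 0 != 0 by apply: contraNneq f0 => A00; rewrite E A00 scale0r.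
  by exists (A 0)^-1; rewrite ?invr_eq0 // E scalerA mulVf ?scale1r.
pose C j := c (t j); pose N j := last_index (t j).
have hC j : C j \is 3.-homog by have [_ []] := cE (t j).
have Cvan j i : i != N j -> (C j).@[p i 0] = 0.
  by move=> ij; apply/mult_ge1; have [_ [_ /(_ i)]] := cE (t j); rewrite ij.
have C0 j : C j != 0 by have [] := cE (t j).
have Cnz j : (C j).@[p (N j) 0] != 0.
  apply: contraNneq (C0 j) => E; apply/eqP/no_anticanonical => // i.
  by have [->|/Cvan] := eqVneq i (N j).
have Csimple j i : i != N j -> ~ mult_ge 2 (C j) (p i).
  by move=> ij C2; case/eqP: (C0 j); apply: (double_cubic hf firr p0 pinj f2 (hC j) (Cvan j) ij).
(* The two forms that are divisible by [C j] have independent tangents at only one point. *)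
have dep (j : 'I_3) (a b : 'I_4) A B (i : 'I_10) : tnth F a = C j * A -> tnth F b = C j * B -> a != b ->
    (forall l : 'I_4 -> K, mult_ge 2 (\sum_k l k *: tnth F k) (p i) -> l a = 0 /\ l b = 0) -> i = N j.
  move=> Ea Eb ab ind; apply/eqP; apply: contraT => ij.
  have m1 : mult_ge 1 (C j) (p i) by apply/mult_ge1/Cvan.
  have ba : (b == a) = false by rewrite eq_sym (negPf ab).
  have comb (x y : K) : \sum_k (if k == a then x else if k == b then y else 0) *: tnth F k =
      x *: tnth F a + y *: tnth F b.
    rewrite (bigD1 a) //= eqxx (bigD1 b) ?ba //= ?ba ?eqxx big1 ?addr0 //.
    by move=> k /andP[/negPf-> /negPf->]; rewrite scale0r.
  have m2 x y : (x *: A + y *: B).@[p i 0] = 0 -> x = 0 /\ y = 0.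
    move=> E; have := ind (fun k => if k == a then x else if k == b then y else 0).
    rewrite eqxx ba eqxx comb; apply.
    rewrite Ea Eb !scalerAr -mulrDr; apply: (mult_geM m1); exact/mult_ge1.
  have [] := m2 B.@[p i 0] (- A.@[p i 0]).
    by rewrite mevalD !mevalZ; ring.
  move=> B0 _; have [] := m2 0 1; rewrite ?mevalD ?mevalZ ?B0 ?mulr0 ?mul0r ?addr0 //.
  by move=> _ /eqP; rewrite oner_eq0.
have [[A1 E1] [A2 E2] _] := d0; have [[B1 E1'] [B3 E3] _] := d1; have [[D2 E2'] [D3 E3'] _] := d2.
have st0 : last_index (s 2) = N 0.
  by apply: (dep 0 1 2 A1 A2) => // l /i2 H; split; apply: H.
have st1 : last_index (s 1) = N 1.
  by apply: (dep 1 1 3 B1 B3) => // l /i1 H; split; apply: H.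
have st2 : last_index (s 0) = N 2.
  by apply: (dep 2 2 3 D2 D3) => // l /i0 H; split; apply: H.
have Ninj : injective N by move=> j l E; apply: (@perm_inj _ t); apply: last_index_inj E.
have Nne j l : j != l -> N j != N l by apply: contraNneq => /Ninj->.
have cover (i : 'I_10) : (i < 7)%N \/ exists j, i = N j.
  have [|[k ->]] := last_indexP i; [by left|right].
  by exists (t^-1%g k); rewrite /N permKV.
have Nge j : (N j < 7)%N = false by apply: last_index_ge.
(* The residual cubic of [C j] in [F a] passes through the points other than [N l]. *)
have residual (j l m : 'I_3) (a : 'I_4) A : j != l -> j != m -> l != m -> tnth F a = C j * A ->
    tnth F a != 0 -> mult_ge 2 (tnth F a) (p (N m)) ->
    exists2 k, k != 0 & tnth F a = k *: (C j * C l).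
  move=> jl jm lm E Fa0 Fm.
  have hA : A \is 3.-homog.
    apply: (homog_cofactor (C0 j) (hC j)); rewrite -E; exact: (sF a).1.
  have Avan i : i != N l -> A.@[p i 0] = 0.
    move=> il; have [i7|[r Er]] := cover i.
      have ij : i != N j by apply: contraTneq i7 => ->; rewrite Nge.
      apply/mult_ge1/(@mult_ge_cancel _ _ 1 1 (C j)); last exact: Csimple.
      by rewrite -E; apply: F7.
    have [rj|rj] := eqVneq r j.
      apply/eqP; have := FP a (t j); rewrite E mevalM => /eqP.
      by rewrite mulf_eq0 (negPf (Cnz j)) /= Er rj.
    have rl : r != l by apply: contraNneq il => <-; rewrite Er.
    have rm : r = m.
      apply/eqP; move: jl jm lm rj rl; clear; move: j l m r.
      by do 4!apply: ord3_cases.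
    rewrite Er rm; apply/mult_ge1/(@mult_ge_cancel _ _ 1 1 (C j)); first by rewrite -E.
    by apply: Csimple; apply: Nne; rewrite eq_sym.
  have [k Ek] := cubic_nine_nodes hA (hC l) Avan (Cvan l) (C0 l).
  exists k; last by rewrite E Ek scalerAr.
  by apply: contraNneq Fa0 => k0'; rewrite E Ek k0' scale0r mulr0.
have Fnz a : tnth F a != 0.
  apply/eqP => Fa; have := indF (fun k => (k == a)%:R).
  have -> : \sum_k (k == a)%:R *: tnth F k = 0.
    by rewrite (bigD1 a) //= Fa scaler0 add0r big1 // => k /negPf->; rewrite scale0r.
  by move=> /(_ erefl a) /eqP; rewrite eqxx oner_eq0.
rewrite /P in m10 m21 m32; rewrite st2 in m10; rewrite st1 in m21; rewrite st0 in m32.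
have [k1 k10 F1E] := residual 0 1 2 1 A1 isT isT isT E1 (Fnz 1) m10.
have [k2 k20 F2E] := residual 0 2 1 2 A2 isT isT isT E2 (Fnz 2) m21.
have [k3 k30 F3E] := residual 1 2 0 3 B3 isT isT isT E3 (Fnz 3) m32.
exists N, C, (fun j => if j == 0 then k0 else if j == 1 then k1 else if j == 2 then k2 else k3).
split; [by split| |by split].
by move=> j; case: (j == 0) => //; case: (j == 1) => //; case: (j == 2).
Qed.

End Setup.

(** * The linear system [|9L - 3(E_1 + .. + E_7) - 2(E_8 + E_9 + E_10)|] *)

Lemma tnth_cubo_cubic (K : fieldType) :
  [/\ tnth (@cubo_cubic K) 0 = 'X_1 * 'X_2 * 'X_3, tnth (@cubo_cubic K) 1 = 'X_0 * 'X_2 * 'X_3,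
      tnth (@cubo_cubic K) 2 = 'X_0 * 'X_1 * 'X_3 & tnth (@cubo_cubic K) 3 = 'X_0 * 'X_1 * 'X_2].
Proof. by []. Qed.

Section EnriquesSystem.
Variables (K : numClosedFieldType) (f : {mpoly K[3]}) (p : 'I_10 -> 'rV[K]_3).
Hypotheses (hf : f \is 6.-homog) (firr : irreducible_mpoly f).
Hypotheses (p0 : forall i, p i != 0) (pinj : forall i j, proj_eq (p i) (p j) -> i = j).
Hypotheses (f2 : forall i, mult_ge 2 f (p i)) (f3 : forall i, ~ mult_ge 3 f (p i)).
Variables (N : 'I_3 -> 'I_10) (C : 'I_3 -> {mpoly K[3]}).
Hypothesis tri : cubic_triangle p N C.

Let hC := triangle_homog tri.
Let Cvan := triangle_van tri.
Let Cnz := triangle_nz tri.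

Lemma sextic_neq0 : f != 0.
Proof. by have [+ _] := firr; apply: contraTneq => ->; rewrite msize0. Qed.

Lemma triangle_neq0 j : C j != 0.
Proof. by apply: contraNneq (Cnz j) => ->; rewrite meval0. Qed.

Lemma triangle_N_neq j l : j != l -> N j != N l.
Proof. by apply: contraNneq => /(triangle_inj tri)->. Qed.

Lemma sum_ord3 (V : zmodType) (g : 'I_3 -> V) : \sum_m g m = g 0 + g 1 + g 2.
Proof.
rewrite !big_ord_recr big_ord0 /= add0r.
by congr (_ + _ + _); congr g; apply: val_inj.
Qed.

Lemma sum_ord4 (V : zmodType) (g : 'I_4 -> V) : \sum_m g m = g 0 + g 1 + g 2 + g 3.
Proof.
rewrite !big_ord_recr big_ord0 /= add0r.
by congr (_ + _ + _ + _); congr g; apply: val_inj.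
Qed.

Lemma triangle_net j : cubic_net p (C j).
Proof.
split=> [|i i7]; first exact: hC.
by apply: Cvan; apply: contraTneq i7 => ->; rewrite (triangle_ge tri).
Qed.

Lemma triangle_eval (x : 'I_3 -> K) j : (\sum_l x l *: C l).@[p (N j) 0] = x j * (C j).@[p (N j) 0].
Proof.
rewrite raddf_sum (bigD1 j) //= big1 ?addr0 ?mevalZ // => l lj.
by rewrite mevalZ Cvan ?mulr0 // triangle_N_neq // eq_sym.
Qed.

Lemma triangle_indep (x : 'I_3 -> K) : \sum_j x j *: C j = 0 -> forall j, x j = 0.
Proof.
move=> E j; have := triangle_eval x j; rewrite E meval0 => /esym/eqP.
by rewrite mulf_eq0 (negPf (Cnz j)) orbF => /eqP.
Qed.

(** By [no_anticanonical], a cubic of the net is determined by its values at the three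
    other points, where the [C j] interpolate. *)
Lemma triangle_spans v : cubic_net p v -> exists x : 'I_3 -> K, v = \sum_j x j *: C j.
Proof.
move=> [hv vp]; exists (fun j => v.@[p (N j) 0] / (C j).@[p (N j) 0]).
apply/eqP; rewrite -subr_eq0; apply/eqP.
apply: (no_anticanonical hf firr p0 pinj f2) => [|i].
  by rewrite rpredB // rpred_sum // => j _; apply: dhomogZ.
rewrite mevalB; have [i7|[j ->]] := triangle_cover tri i.
  rewrite vp // sub0r; apply/eqP; rewrite oppr_eq0; apply/eqP.
  rewrite raddf_sum big1 // => j _ /=.
  by rewrite mevalZ ((triangle_net j).2 i i7) mulr0.
by rewrite triangle_eval divfK // subrr.
Qed.

Lemma sextic_ndvd g : g != 0 -> (msize g <= 6)%N -> ~ divides f g.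
Proof.
move=> g0 sg /(dvd_msize g0); rewrite (homog_msize sextic_neq0 hf).
by rewrite leqNgt ltnS sg.
Qed.

Lemma cubic_msize (c : {mpoly K[3]}) : c \is 3.-homog -> (msize c <= 6)%N.
Proof. by move=> hc; have [->|c0] := eqVneq c 0; rewrite ?msize0 // (homog_msize c0 hc). Qed.

Lemma bezout_extra_point (g : {mpoly K[3]}) e (k : 'I_10 -> nat) x :
  g \is e.-homog -> (forall i, mult_ge (k i) g (p i)) -> x != 0 ->
  (forall i, ~ proj_eq (p i) x) -> f.@[x 0] = 0 -> g.@[x 0] = 0 ->
  (3 * e <= \sum_i k i)%N -> divides f g.
Proof.
move=> hg gk x0 px fx gx le_k.
pose q (i : 'I_11) := if unlift ord_max i is Some j then p j else x.
pose m (i : 'I_11) := if unlift ord_max i is Some j then 2%N else 1%N.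
pose k' (i : 'I_11) := if unlift ord_max i is Some j then k j else 1%N.
apply: (@bezout_inequality K 11 q f g 6 e m k') => //.
- by move=> i; rewrite /q; case: unliftP.
- move=> i j; rewrite /q; case: unliftP => [i' ->|->]; case: unliftP => [j' ->|->] //.
  + by move=> /pinj->.
  + by move=> /px.
  + by move=> /proj_eq_sym /px.
- by move=> i; rewrite /q /m; case: unliftP => // _; apply/mult_ge1.
- by move=> i; rewrite /q /k'; case: unliftP => // _; apply/mult_ge1.
rewrite big_ord_recr /= /m /k' unlift_none.
rewrite (eq_bigr (fun i => 2 * k i)%N) => [|i _]; last first.
  by rewrite (widen_ord_lift (i : 'I_10)) liftK.
by rewrite -big_distrr /=; move: le_k; move: (\sum__ _)%N => s; lia.
Qed.

(** Nine nodes already account for the [18] intersections of the sextic with such a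
    cubic. *)
Lemma sextic_meets_triangle x j : x != 0 -> (forall i, ~ proj_eq (p i) x) ->
  f.@[x 0] = 0 -> (C j).@[x 0] != 0.
Proof.
move=> x0 px fx; apply/negP => /eqP Cx.
apply: (@sextic_ndvd (C j)); [exact: triangle_neq0|exact: cubic_msize|].
apply: (@bezout_extra_point _ 3 (fun i => i != N j : nat) x) => // [i|].
  by case: eqP => [_|/eqP/Cvan/mult_ge1] //; apply: mult_ge0.
rewrite sum_nat_pred; have -> : [set i | i != N j] = ~: [set N j].
  by apply/setP => i; rewrite !inE.
by have := cardsC [set N j]; rewrite cards1 card_ord; move: (#|_|) => s; lia.
Qed.

(** Each line of a pencil with centre off the sextic meets the sextic; eleven lines give
    eleven points, which cannot all be nodes. *)
Lemma sextic_point : exists x : 'rV[K]_3, [/\ x != 0, f.@[x 0] = 0 & forall i, ~ proj_eq (p i) x].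
Proof.
have [o' o'P] := meval_neq0 sextic_neq0.
pose o : 'rV[K]_3 := \row_j o' j.
have fo : f.@[o 0] != 0 by rewrite (meval_eq _ (_ : o 0 =1 o')) // => j; rewrite mxE.
have o0 : o != 0.
  apply: contraNneq fo => ->; rewrite -(scale0r (0 : 'rV[K]_3)) (homog_evalZ _ _ hf).
  by rewrite exprS !mul0r.
have [u [w [lu [lw [_ [luo lwo] [luu luw] [lwu lww]]]]]] := frame o0.
have root (t : K) : exists s, f.@[(u + t *: w + s *: o) 0] = 0.
  have /closed_rootP[s /rootP Es] : size (taylor f (u + t *: w) o) != 1%N.
    apply/eqP => s1; move: fo; rewrite -(homog_taylor_top (u + t *: w) o hf).
    by rewrite nth_default ?eqxx // s1.
  by exists s; rewrite -taylor_eval.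
have /boolp.choice[s Hs] : forall i : 'I_11, exists s : K,
    f.@[(u + i%:R *: w + s *: o) 0] = 0 by move=> i; apply: root.
pose x (i : 'I_11) := u + i%:R *: w + s i *: o.
have lux i : dot lu (x i) = 1 by rewrite !dotDr !dotZr luu luw luo !mulr0 !addr0.
have lwx i : dot lw (x i) = i%:R by rewrite !dotDr !dotZr lwu lww lwo mulr0 mulr1 add0r addr0.
have x0 i : x i != 0 by apply: contra_eq_neq (lux i) => ->; rewrite dot0r eq_sym oner_neq0.
apply: boolp.contrapT => nx.
have /boolp.choice[g Hg] : forall i, exists j, proj_eq (p j) (x i).
  move=> i; apply: boolp.contrapT => nj; case: nx; exists (x i); split=> //; first exact: Hs.
  by move=> j pj; apply: nj; exists j.
have ginj : injective g.
  move=> i j gij; have [a a0 Ea] := Hg i; have [b b0 Eb] := Hg j.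
  have E : x i = (a / b) *: x j by rewrite Eb -gij scalerA divfK.
  have ab : a / b = 1 by rewrite -[LHS]mulr1 -(lux j) -dotZr -E lux.
  rewrite ab scale1r in E; have := lwx i; rewrite E lwx => /eqP.
  by rewrite eqr_nat => /eqP/val_inj.
by have := leq_card g ginj; rewrite !card_ord.
Qed.

Lemma triangle_product_mult i : mult_ge (H'_mult i) (C 0 * C 1 * C 2) (p i).
Proof.
have m1 j : i != N j -> mult_ge 1 (C j) (p i) by move=> /Cvan/mult_ge1.
rewrite /H'_mult; case: ifP => i7.
  have ij j : i != N j by apply: contraTneq i7 => ->; rewrite (triangle_ge tri).
  by apply: (mult_geM (mult_geM (m1 _ (ij 0)) (m1 _ (ij 1))) (m1 _ (ij 2))).
have [//|[j Ej]] := triangle_cover tri i; first by rewrite i7.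
have il l : j != l -> i != N l by rewrite Ej; apply: triangle_N_neq.
move: j Ej il; apply: ord3_cases => Ej il.
- rewrite -mulrA mulrC; apply: mult_geMl; apply: (mult_geM (m1 _ (il 1 isT)) (m1 _ (il 2 isT))).
- rewrite mulrAC; apply: mult_geMl; apply: (mult_geM (m1 _ (il 0 isT)) (m1 _ (il 2 isT))).
- apply: mult_geMl; apply: (mult_geM (m1 _ (il 0 isT)) (m1 _ (il 1 isT))).
Qed.

Lemma triangle_product_section : sections p 9 H'_mult (C 0 * C 1 * C 2).
Proof.
split; last exact: triangle_product_mult.
by apply: (dhomogM (dhomogM (hC 0) (hC 1)) (hC 2)).
Qed.

Lemma sextic_cubic_section j : sections p 9 H'_mult (f * C j).
Proof.
split=> [|i]; first exact: (dhomogM hf (hC j)).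
rewrite /H'_mult; case: ifP => i7; last exact: mult_geMl.
by apply: (mult_geM (f2 i)); apply/mult_ge1; case: (triangle_net j) => _; apply.
Qed.

(** [H'] has degree [54 - 42 - 12 = 0] on the strict transform of the sextic. Subtracting
    a multiple of [C_0 C_1 C_2], which is not [0] at a further point of the sextic, from a
    section makes it vanish there, hence divisible by the sextic, and the quotient
    lies in the net of cubics. *)
Lemma enriques_sections_span g : sections p 9 H'_mult g ->
  exists a (x : 'I_3 -> K), g = a *: (C 0 * C 1 * C 2) + f * \sum_j x j *: C j.
Proof.
move=> [hg gm]; have [x [x0 fx px]] := sextic_point.
have Cx j := sextic_meets_triangle j x0 px fx.
set T := C 0 * C 1 * C 2.
have Tx : T.@[x 0] != 0 by rewrite !mevalM !mulf_neq0.
pose a := g.@[x 0] / T.@[x 0].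
have hT : T \is 9.-homog by case: triangle_product_section.
have hg' : g - a *: T \is 9.-homog by rewrite rpredB // dhomogZ.
have gm' i : mult_ge (H'_mult i) (g - a *: T) (p i).
  by apply: mult_geB => //; apply/mult_geZ/triangle_product_mult.
have [v Ev] : divides f (g - a *: T).
  apply: (bezout_extra_point hg' gm' x0 px fx).
    by rewrite mevalB mevalZ divfK // subrr.
  by rewrite /H'_mult !big_ord_recr big_ord0.
have nv : cubic_net p v.
  split; first by apply: (homog_cofactor sextic_neq0 hf); rewrite -Ev.
  move=> i i7; apply/mult_ge1/(@mult_ge_cancel _ _ 2 1 f); last exact: f3.
  by rewrite -Ev; have := gm' i; rewrite /H'_mult i7.
have [y Ey] := triangle_spans nv.
by exists a, y; rewrite -Ey -Ev addrC subrK.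
Qed.

Lemma enriques_sections_indep a (x : 'I_3 -> K) :
  a *: (C 0 * C 1 * C 2) + f * \sum_j x j *: C j = 0 -> a = 0 /\ forall j, x j = 0.
Proof.
move=> E; have a0 : a = 0.
  apply/eqP; apply: contraT => a0.
  have fT : divides f (C 0 * C 1 * C 2).
    exists (- a^-1 *: \sum_j x j *: C j); apply: (scalerI a0).
    rewrite -scalerAr scalerA mulrN divff // scaleN1r.
    by apply/eqP; rewrite -addr_eq0 E.
  have nd j : ~ divides f (C j).
    by apply: sextic_ndvd; [exact: triangle_neq0|exact: cubic_msize].
  by have [/(irreducible_prime firr)[|]|] := irreducible_prime firr fT; move=> /nd.
split=> //; apply: triangle_indep; move/eqP: E.
by rewrite a0 scale0r add0r mulf_eq0 (negPf sextic_neq0) /= => /eqP.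
Qed.

(** The net has independent tangents at the seven points, so a common factor vanishes at
    none of them. The cofactors then pass through all seven points, but have degree at
    most two. *)
Lemma net_no_common_factor g : (forall j, divides g (C j)) -> (msize g <= 1)%N.
Proof.
move=> gC; rewrite leqNgt; apply/negP => sg.
have /boolp.choice[u Hu] := gC.
have g0 : g != 0 by apply: contraTneq sg => ->; rewrite msize0.
have [d [d' [hg _ dd']]] : exists d1 d2, [/\ g \is d1.-homog, u 0 \is d2.-homog & (d1 + d2)%N = 3%N].
  by apply: homog_factor; rewrite -Hu; [exact: hC|exact: triangle_neq0].
have d0 : (0 < d)%N by move: sg; rewrite (homog_msize g0 hg); lia.
have hu j : u j \is (3 - d).-homog.
  by apply: (homog_cofactor g0 hg); rewrite -Hu subnKC //; lia.
(* A common component through [p i] would make all the tangents there proportional. *)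
have gp (i : 'I_10) : (i < 7)%N -> g.@[p i 0] != 0.
  move=> i7; apply/negP => /eqP gi.
  have [a [b [na nb ind]]] := cubic_net_tangents hf firr p0 pinj f2 i7.
  have fac c : cubic_net p c -> exists v, c = g * v.
    move=> /triangle_spans[x ->]; exists (\sum_j x j *: u j).
    by rewrite mulr_sumr; apply: eq_bigr => j _; rewrite [C j]Hu scalerAr.
  have [v Ev] := fac a na; have [w Ew] := fac b nb.
  have m2 x y : (x *: v + y *: w).@[p i 0] = 0 -> x = 0 /\ y = 0.
    move=> E; apply: ind; rewrite Ev Ew !scalerAr -mulrDr.
    by apply: (@mult_geM _ _ 1 1); apply/mult_ge1.
  have [] := m2 w.@[p i 0] (- v.@[p i 0]).
    by rewrite mevalD !mevalZ; ring.
  move=> w0 _; have [] := m2 0 1; rewrite ?mevalD ?mevalZ ?w0 ?mulr0 ?mul0r ?addr0 //.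
  by move=> _ /eqP; rewrite oner_eq0.
have up j (i : 'I_10) : (i < 7)%N -> (u j).@[p i 0] = 0.
  move=> i7; have [_ /(_ i i7)/eqP] := triangle_net j.
  by rewrite [C j]Hu mevalM mulf_eq0 (negPf (gp i i7)) => /eqP.
have u0 : u 0 != 0 by apply: contraNneq (triangle_neq0 0) => E; rewrite Hu E mulr0.
have E : u 0 = 0.
  have [dE|[dE|dE]] : d = 1%N \/ d = 2%N \/ d = 3%N by lia.
  - by rewrite dE in hu; apply: (nodes_on_conic hf firr p0 pinj f2); [exact: (hu 0)|exact: up].
  - rewrite dE in hu; apply: (@node_bezout _ f p hf firr p0 pinj f2 (u 0) 1 (fun i => (i < 7)%N : nat)).
    + exact: (hu 0).
    + by [].
    + by move=> i; case: ltnP => [/up/mult_ge1|_] //; apply: mult_ge0.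
    + by rewrite !big_ord_recr big_ord0.
  - rewrite dE in hu; apply: (@node_bezout _ f p hf firr p0 pinj f2 (u 0) 0 (fun i => (i < 7)%N : nat)).
    + exact: (hu 0).
    + by [].
    + by move=> i; case: ltnP => [/up/mult_ge1|_] //; apply: mult_ge0.
    + by rewrite !big_ord_recr big_ord0.
by rewrite E eqxx in u0.
Qed.

(** The sections [f C_j] and [C_0 C_1 C_2] have no common factor, because the [C_j] have
    none and [f] does not divide [C_0 C_1 C_2]; the sections [f C_j] do not all vanish to a
    higher order at a node, where [f] has multiplicity exactly two. *)
Lemma enriques_no_fixed_component : no_fixed_component p 9 H'_mult.
Proof.
split=> [g sg|i].
  apply: boolp.contrapT => ns.
  have gs s : sections p 9 H'_mult s -> divides g s.
    by move=> sec; apply: boolp.contrapT => gs; case: ns; exists s => // -[u Eu];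
      by apply: gs; exists u; rewrite mulrC.
  suff : (msize g <= 1)%N by rewrite leqNgt sg.
  apply: net_no_common_factor => j.
  have [w Ew] := gs _ (sextic_cubic_section j).
  have [|[v Ev]|[v Ev]] := @irreducible_prime _ _ _ firr g w; first by exists (C j).
    have [w' Ew'] := gs _ triangle_product_section.
    have [u Eu] : divides f (C 0 * C 1 * C 2) by rewrite Ew' Ev -mulrA; apply: dvdr_mulr; apply: dvdrr.
    have nd l : ~ divides f (C l).
      by apply: sextic_ndvd; [exact: triangle_neq0|exact: cubic_msize].
    have fT : divides f (C 0 * C 1 * C 2) by exists u.
    by have [/(irreducible_prime firr)[|]|] := irreducible_prime firr fT; move=> /nd.
  exists v; apply: (mulfI sextic_neq0); rewrite Ew Ev; ring.
have [i7|[j Ej]] := triangle_cover tri i.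
  have [a [b [na nb ind]]] := cubic_net_tangents hf firr p0 pinj f2 i7.
  have [j nj] : exists j, ~ mult_ge 2 (C j) (p i).
    apply: boolp.contrapT => /boolp.forallNP nj.
    have [x Ex] := triangle_spans na.
    have [] := ind 1 0; last by move/eqP; rewrite oner_eq0.
    rewrite scale1r scale0r addr0 Ex; elim/big_rec: _ => [v k _|j c _ Hc].
      by rewrite /taylor mmap0 coef0.
    by apply: mult_geD => //; apply: mult_geZ; apply: boolp.contrapT; apply: nj.
  exists (f * C j); first exact: sextic_cubic_section.
  rewrite /H'_mult i7 => m4; apply: nj; apply: (@mult_ge_cancel _ _ 2 2 f) => //.
exists (f * C j); first exact: sextic_cubic_section.
rewrite /H'_mult Ej (triangle_ge tri) => m3; case/eqP: (Cnz j); apply/mult_ge1.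
by apply: (@mult_ge_cancel _ _ 2 1 f) => //; rewrite -Ej.
Qed.

Variables (F : 4.-tuple {mpoly K[3]}) (k : 'I_4 -> K).
Hypotheses (k0 : forall j, k j != 0) (F0 : tnth F 0 = k 0 *: f).
Hypotheses (F1 : tnth F 1 = k 1 *: (C 0 * C 1)) (F2 : tnth F 2 = k 2 *: (C 0 * C 2)).
Hypothesis F3 : tnth F 3 = k 3 *: (C 1 * C 2).

(** In terms of [f] and of the [C j], the products of three of the coordinates have the
    common factor [C_0 C_1 C_2], and the quotients are the sections of [H'] found above. *)
Lemma enriques_realized :
  realized_by p 9 H'_mult [tuple tnth cubo_cubic j \mPo F | j < 4].
Proof.
split; first exact: enriques_no_fixed_component.
pose T := C 0 * C 1 * C 2.
have T0 : T != 0 by rewrite !mulf_neq0 ?triangle_neq0.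
pose q (j : 'I_4) := if j == 0 then k 1 * k 2 * k 3 else if j == 1 then k 0 * k 2 * k 3
  else if j == 2 then k 0 * k 1 * k 3 else k 0 * k 1 * k 2.
pose y (j : 'I_4) := if j == 0 then T else if j == 1 then f * C 2
  else if j == 2 then f * C 1 else f * C 0.
have q0 j : q j != 0 by rewrite /q; do !case: ifP => _; rewrite !mulf_neq0.
have sumy (a : 'I_4 -> K) : \sum_j a j *: (q j *: y j) = (a 0 * q 0) *: T +
    f * \sum_j (if j == 0 then a 3 * q 3 else if j == 1 then a 2 * q 2 else a 1 * q 1) *: C j.
  rewrite sum_ord4 sum_ord3 /= !scalerA !mulrDr -!scalerAr; ring.
have sumY (a : 'I_4 -> K) : \sum_j a j *: tnth [tuple q l *: y l | l < 4] j =
    \sum_j a j *: (q j *: y j).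
  by apply: eq_bigr => j _; rewrite tnth_mktuple.
exists [tuple q j *: y j | j < 4]; last first.
  have [c0 c1 c2 c3] := tnth_cubo_cubic K.
  exists T => //; apply: ord4_cases; rewrite !tnth_mktuple /q /y /= ?c0 ?c1 ?c2 ?c3.
  - by rewrite !comp_mpolyM !comp_mpolyXE F1 F2 F3 /T -!mul_mpolyC !mpolyCM; ring.
  - by rewrite !comp_mpolyM !comp_mpolyXE F0 F2 F3 /T -!mul_mpolyC !mpolyCM; ring.
  - by rewrite !comp_mpolyM !comp_mpolyXE F0 F1 F3 /T -!mul_mpolyC !mpolyCM; ring.
  - by rewrite !comp_mpolyM !comp_mpolyXE F0 F1 F2 /T -!mul_mpolyC !mpolyCM; ring.
have qK j : (q j)^-1 * q j = 1 by rewrite mulVf.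
split=> [j|a|g].
- have [hy my] : sections p 9 H'_mult (y j).
    rewrite /y; do !case: ifP => _; [exact: triangle_product_section| | |];
    exact: sextic_cubic_section.
  by rewrite tnth_mktuple; split=> [|i]; [apply: dhomogZ|apply: mult_geZ].
- rewrite sumY sumy => /enriques_sections_indep[a0 aj].
  have z (l : 'I_4) : a l * q l = 0 -> a l = 0.
    by move=> /eqP; rewrite mulf_eq0 (negPf (q0 l)) orbF => /eqP.
  by apply: ord4_cases; apply: z; [exact: a0|exact: (aj 2)|exact: (aj 1)|exact: (aj 0)].
- move=> /enriques_sections_span[a [x ->]].
  pose b (j : 'I_4) := (if j == 0 then a else if j == 1 then x 2 else if j == 2 then x 1 else x 0) / q j.
  exists b; rewrite sumY sumy /b !divfK //=; congr (_ + f * _).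
  by rewrite !sum_ord3 /= ?divfK.
Qed.

End EnriquesSystem.

(** * Substitution of forms of the same degree *)

Section ScaledComposition.
Variables (K : numFieldType).

Lemma comp_homog_scale k n (G : {mpoly K[k]}) e c (W V : k.-tuple {mpoly K[n]}) :
  G \is e.-homog -> (forall j, tnth V j = c * tnth W j) -> G \mPo V = c ^+ e * (G \mPo W).
Proof.
move=> hG E; rewrite /comp_mpoly -(homog_mmap _ _ _ hG).
by apply: eq_mmap => [//|j]; rewrite E.
Qed.

(** Substituting forms of the same degree separates the homogeneous components. *)
Lemma comp_mpoly_homog_components k n (g : {mpoly K[k]}) (W : k.-tuple {mpoly K[n]}) e :
  (0 < e)%N -> (forall j, tnth W j \is e.-homog) -> g \mPo W = 0 ->
  forall d, pihomog mdeg d g \mPo W = 0.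
Proof.
move=> e0 hW gW d.
have E : \sum_(j < msize g) (pihomog mdeg j g \mPo W) = 0.
  by rewrite -raddf_sum -[RHS]gW; congr (_ \mPo _); apply/esym/pihomog_partitionE.
have [lt|ge] := ltnP d (msize g); last first.
  rewrite (_ : pihomog mdeg d g = 0) ?comp_mpoly0 // pihomogE big_seq_cond big1 // => m.
  by move=> /andP[/msize_mdeg_lt lt /eqP dm]; have := leq_trans lt ge; rewrite -dm ltnn.
have hd j : pihomog mdeg j g \mPo W \is (j * e).-homog.
  by apply: comp_homog => //; apply: pihomogP.
have ne (j : nat) : j != d -> pihomog mdeg (d * e) (pihomog mdeg j g \mPo W) = 0.
  move=> jd; have jde : (j * e != d * e)%N by rewrite eqn_pmul2r.
  exact: (pihomog_ne0 jde (hd j)).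
have E' : \sum_(j < msize g) pihomog mdeg (d * e) (pihomog mdeg j g \mPo W) = 0.
  by rewrite -raddf_sum E raddf0.
rewrite (bigD1 (Ordinal lt)) // big1 in E' => [|j jd]; last by apply: ne; rewrite -(inj_eq val_inj) in jd.
have {E'} E' : pihomog mdeg (d * e) (pihomog mdeg d g \mPo W) + 0 = 0 := E'.
by rewrite addr0 in E'; rewrite -E'; apply/esym/pihomog_dE/(hd d).
Qed.

End ScaledComposition.

(** * The triangle of cubics *)

Section QuinticEquation.
Variables (K : numClosedFieldType) (f : {mpoly K[3]}) (p : 'I_10 -> 'rV[K]_3).
Hypotheses (hf : f \is 6.-homog) (firr : irreducible_mpoly f).
Hypotheses (p0 : forall i, p i != 0) (pinj : forall i j, proj_eq (p i) (p j) -> i = j).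
Hypothesis f2 : forall i, mult_ge 2 f (p i).
Variables (N : 'I_3 -> 'I_10) (C : 'I_3 -> {mpoly K[3]}).
Hypothesis tri : cubic_triangle p N C.

Let hC := triangle_homog tri.
Let Cvan := triangle_van tri.
Let Cnz := triangle_nz tri.

(** The cubic [C i] passes through the points [N j] and [N l], where only one of [C j] and
    [C l] is not [0]: compare values there. *)
Lemma no_relation_on_cubic (i j l : 'I_3) (a a' : K) (v : {mpoly K[3]}) :
  i != j -> i != l -> j != l -> v.@[p (N j) 0] = 0 -> v.@[p (N l) 0] = 0 ->
  divides (C i) (f * (a *: C j ^+ 2 + a' *: C l ^+ 2 + v)) -> a = 0 /\ a' = 0.
Proof.
move=> ij il jl vj vl [w E].
have CN m m' : m != m' -> (C m).@[p (N m') 0] = 0.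
  by move=> mm; apply: Cvan; apply: (triangle_N_neq tri); rewrite eq_sym.
have [|[w' Ew]] := irreducible_prime firr (ex_intro _ _ (esym E)).
  by move/(sextic_ndvd hf firr (triangle_neq0 tri i) (cubic_msize (hC i))).
have {w E Ew} E : a *: C j ^+ 2 + a' *: C l ^+ 2 + v = C i * w'.
  by apply: (mulfI (sextic_neq0 firr)); rewrite E Ew; ring.
split.
  have := congr1 (meval (p (N j) 0)) E; rewrite !mevalD !mevalZ !mevalM vj (CN i j ij) (CN l j) 1?eq_sym //.
  rewrite !(mulr0, mul0r, addr0) => /eqP.
  by rewrite !mulf_eq0 !(negPf (Cnz j)) !orbF => /eqP.
have := congr1 (meval (p (N l) 0)) E; rewrite !mevalD !mevalZ !mevalM vl (CN i l il) (CN j l) //.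
rewrite !(mulr0, mul0r, addr0, add0r) => /eqP.
by rewrite !mulf_eq0 !(negPf (Cnz l)) !orbF => /eqP.
Qed.

(** A double point and six simple points impose nine conditions on the ten coefficients
    of a cubic. *)
Lemma cubic_net_double_point : exists a, [/\ cubic_net p a, a != 0 & mult_ge 2 a (p ord0)].
Proof.
pose k (i : 'I_10) := if i == ord0 then 2%N else if (i < 7)%N then 1%N else 0%N.
have := dim_mult_ge p0 3 k.
rewrite (_ : \sum_i 'C((k i).+1, 2) = 9)%N; last by rewrite !big_ord_recr big_ord0.
rewrite (_ : 'C(3 + 2, 3) = 10)%N //.
have [->|/eqP Z0 _] := eqVneq (mult_space p 3 k) 0%VS; first by rewrite dimv0.
pose G := vpick (mult_space p 3 k).
have /mult_spaceP GZ : G \in mult_space p 3 k by apply: memv_pick.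
have G0 : G != 0 by rewrite vpick0; apply/eqP.
exists (val G); split; last exact: (GZ ord0).
  split=> [|i i7]; first exact: valP.
  apply/mult_ge1; apply: mult_ge_leq (GZ i); rewrite /k i7.
  by case: ifP.
by apply: contraNneq G0 => E; apply/eqP/val_inj.
Qed.

Lemma sum3_tuple (a b c : {mpoly K[3]}) (x : 'I_3 -> K) :
  \sum_j x j *: tnth [tuple a; b; c] j = x 0 *: a + x 1 *: b + x 2 *: c.
Proof. by rewrite sum_ord3. Qed.

(** A linear change of coordinates reduces to a basis of the net as in
    [net_not_birational]. *)
Theorem triangle_not_birational e (S : 'I_3 -> {mpoly K[3]}) (H : {mpoly K[3]}) :
  (forall k, S k \is e.-homog) -> H != 0 ->
  (forall k, S k \mPo [tuple C j | j < 3] = H * 'X_k) -> False.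
Proof.
move=> hS H0 SC.
have [a [na a0 a2]] := cubic_net_double_point.
have [b [c [nb nc ind]]] := cubic_net_tangents hf firr p0 pinj f2 (isT : ((ord0 : 'I_10) < 7)%N).
pose D := [tuple a; b; c].
have spans := triangle_spans hf firr p0 pinj f2 tri.
have /boolp.choice[M HM] : forall i, exists x : 'I_3 -> K, tnth D i = \sum_j x j *: C j.
  by apply: ord3_cases; apply: spans.
pose A : 'M[K]_3 := \matrix_(i, j) M i j.
have Aunit : A \in unitmx.
  rewrite -row_free_unit -kermx_eq0; apply/rowV0P => x /sub_kermxP xA.
  have : \sum_i x 0 i *: tnth D i = 0.
    under eq_bigr => i _ do rewrite HM scaler_sumr.
    rewrite exchange_big big1 // => j _.
    under eq_bigr => i _ do rewrite scalerA.
    rewrite -scaler_suml; have /rowP/(_ j) := xA.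
    rewrite !mxE => E; rewrite (_ : \sum_i _ = 0) ?scale0r // -[RHS]E.
    by apply: eq_bigr => i _; rewrite mxE.
  rewrite sum3_tuple => E.
  have [x1 x2] : x 0 1 = 0 /\ x 0 2 = 0.
    apply: ind; rewrite (_ : _ + _ = - x 0 0 *: a); first exact: mult_geZ.
    by apply/eqP; rewrite scaleNr -addr_eq0 addrC addrA E.
  apply/rowP => i; rewrite mxE; move: i; apply: ord3_cases => //.
  by move/eqP: E; rewrite x1 x2 !scale0r !addr0 scaler_eq0 (negPf a0) orbF => /eqP.
pose B := invmx A.
have CD i : C i = \sum_j B i j *: tnth D j.
  under eq_bigr => j _ do rewrite HM scaler_sumr.
  rewrite exchange_big (bigD1 i) //= [X in _ = _ + X]big1 => [|l li]; last first.
    under eq_bigr => j _ do rewrite scalerA.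
    rewrite -scaler_suml; have /matrixP/(_ i l) := mulVmx Aunit.
    rewrite !mxE eq_sym (negPf li) => E.
    rewrite (_ : \sum_i _ = 0) ?scale0r // -[RHS]E.
    by apply: eq_bigr => j _; rewrite mxE.
  rewrite addr0; under eq_bigr => j _ do rewrite scalerA.
  rewrite -scaler_suml; have /matrixP/(_ i i) := mulVmx Aunit.
  rewrite !mxE eqxx => E.
  rewrite (_ : \sum_i _ = 1) ?scale1r // -[RHS]E.
  by apply: eq_bigr => j _; rewrite mxE.
pose L : 3.-tuple {mpoly K[3]} := [tuple \sum_j B i j *: 'X_j | i < 3].
apply: (net_not_birational hf firr p0 pinj f2 na nb nc a0 a2 _ ind (e := e)
  (S := fun k => S k \mPo L) (H := H)) => [v /spans[x ->]|k||k] //.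
- under eq_bigr => j _ do rewrite CD sum3_tuple !scalerDr !scalerA.
  by rewrite !big_split /= -!scaler_suml; do 3!eexists.
- rewrite -[e]muln1; apply: comp_homog => // i; rewrite tnth_mktuple.
  by apply: rpred_sum => j _; apply: dhomogZ; rewrite dhomogX /= mdeg1.
- rewrite comp_mpolyA -SC; congr (_ \mPo _); apply: eq_from_tnth => i.
  rewrite !tnth_mktuple CD raddf_sum; apply: eq_bigr => j _ /=.
  by rewrite comp_mpolyZ comp_mpolyXE.
Qed.

End QuinticEquation.

(** * The squares in the equation of the quintic *)

Section QuadraticForms.
Variables (K : numFieldType) (n : nat).

Lemma quadratic_form (q : {mpoly K[n]}) : q \is 2.-homog ->
  exists c : 'I_n -> 'I_n -> K, q = \sum_i \sum_j c i j *: ('X_i * 'X_j).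
Proof.
move=> hq; rewrite (mpolyE q) big_seq.
elim/big_rec: _ => [|m r mq [c ->]].
  exists (fun _ _ => 0); rewrite big1 // => i _; rewrite big1 // => j _.
  by rewrite scale0r.
have dm := dhomog_mf hq mq; rewrite /= in dm.
have [i mi] : exists i, m i != 0%N.
  apply: boolp.contrapT => ni; move: dm; rewrite mdegE big1 // => i _.
  by apply/eqP; apply: contraT => mi; case: ni; exists i.
have Em : m = (U_(i) + (m - U_(i)))%MM by rewrite addmC submK // lep1mP.
have [j /eqP Ej] : exists j, (m - U_(i))%MM == U_(j)%MM.
  by apply/mdeg1P; have := mdegD U_(i) (m - U_(i)); rewrite -Em dm mdeg1 add1n => -[<-].
pose d k l := if (k == i) && (l == j) then q@_m else 0.
exists (fun k l => d k l + c k l).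
under [RHS]eq_bigr => k _ do under eq_bigr => l _ do rewrite scalerDl.
under [RHS]eq_bigr => k _ do rewrite big_split /=.
rewrite big_split /=; congr (_ + _).
rewrite (bigD1 i) //= [X in _ + X]big1 ?addr0 => [|k ki]; last first.
  by rewrite big1 // => l _; rewrite /d (negPf ki) scale0r.
rewrite (bigD1 j) //= [X in _ + X]big1 ?addr0 => [|l lj]; last first.
  by rewrite /d (negPf lj) andbF scale0r.
by rewrite Ej in Em; rewrite /d !eqxx /= -mpolyXD -Em.
Qed.

End QuadraticForms.

Section Monomials.
Variable K : numFieldType.

Lemma X_homog n (i : 'I_n) : ('X_i : {mpoly K[n]}) \is 1.-homog.
Proof. by rewrite dhomogX /= mdeg1. Qed.

Lemma XX_homog n (i j : 'I_n) : ('X_i * 'X_j : {mpoly K[n]}) \is 2.-homog.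
Proof. exact: dhomogM (X_homog i) (X_homog j). Qed.

Lemma cubo_cubic_homog j : tnth (@cubo_cubic K) j \is 3.-homog.
Proof.
have [c0 c1 c2 c3] := tnth_cubo_cubic K.
by move: j; apply: ord4_cases; rewrite ?c0 ?c1 ?c2 ?c3; apply: dhomogM (XX_homog _ _) (X_homog _).
Qed.

End Monomials.

Section EnriquesEquation.
Variables (K : numClosedFieldType) (f : {mpoly K[3]}) (p : 'I_10 -> 'rV[K]_3).
Hypotheses (hf : f \is 6.-homog) (firr : irreducible_mpoly f).
Hypotheses (p0 : forall i, p i != 0) (pinj : forall i j, proj_eq (p i) (p j) -> i = j).
Hypotheses (f2 : forall i, mult_ge 2 f (p i)).
Variables (N : 'I_3 -> 'I_10) (C : 'I_3 -> {mpoly K[3]}).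
Hypothesis tri : cubic_triangle p N C.
Variables (F : 4.-tuple {mpoly K[3]}) (k : 'I_4 -> K).
Hypotheses (k0 : forall j, k j != 0) (F0 : tnth F 0 = k 0 *: f).
Hypotheses (F1 : tnth F 1 = k 1 *: (C 0 * C 1)) (F2 : tnth F 2 = k 2 *: (C 0 * C 2)).
Hypothesis F3 : tnth F 3 = k 3 *: (C 1 * C 2).

Definition quadric (l : 'I_4 -> K) (e : 'I_4 -> 'I_4 -> K) : {mpoly K[4]} :=
  l 0 *: ('X_0 * 'X_0) + l 1 *: ('X_1 * 'X_1) + l 2 *: ('X_2 * 'X_2) + l 3 *: ('X_3 * 'X_3)
  + e 0 1 *: ('X_0 * 'X_1) + e 0 2 *: ('X_0 * 'X_2) + e 0 3 *: ('X_0 * 'X_3)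
  + e 1 2 *: ('X_1 * 'X_2) + e 1 3 *: ('X_1 * 'X_3) + e 2 3 *: ('X_2 * 'X_3).

Lemma quadricP (q : {mpoly K[4]}) : q \is 2.-homog -> exists l e, q = quadric l e.
Proof.
move=> /quadratic_form[c ->]; exists (fun i => c i i), (fun i j => c i j + c j i).
rewrite /quadric sum_ord4 !sum_ord4 !scalerDl.
by rewrite ['X_1 * 'X_0]mulrC ['X_2 * 'X_0]mulrC ['X_3 * 'X_0]mulrC ['X_2 * 'X_1]mulrC
  ['X_3 * 'X_1]mulrC ['X_3 * 'X_2]mulrC; ring.
Qed.

Variables (al be ga : K) (l : 'I_4 -> K) (e : 'I_4 -> 'I_4 -> K).
Let q := quadric l e.
Let Q := quintic al be ga q.
Hypothesis QF : Q \mPo F = 0.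
Hypothesis Qgen : forall g, g \mPo F = 0 -> divides Q g.

Lemma coordinate_neq0 j : tnth F j != 0.
Proof.
by move: j; apply: ord4_cases; rewrite ?F0 ?F1 ?F2 ?F3 scaler_eq0 (negPf (k0 _)) ?mulf_eq0
  ?(negPf (triangle_neq0 tri _)) ?(negPf (sextic_neq0 firr)).
Qed.

(** The coordinates are nonzero on the plane, so [Q'] would vanish on the image as well,
    and [Q] would divide it. *)
Lemma quintic_monomial_factor i j Q' : Q = 'X_i * 'X_j * Q' -> Q = 0.
Proof.
move=> E; have [u Eu] : divides Q Q'.
  apply: Qgen; apply/eqP; have /eqP := QF.
  rewrite E !comp_mpolyM !comp_mpolyXE !mulf_eq0.
  by rewrite !(negPf (coordinate_neq0 _)).
apply/eqP; apply: contraT => Q0.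
have : 'X_i * 'X_j * u = 1 by apply: (mulfI Q0); rewrite mulr1 {2}E Eu; ring.
move/(congr1 (meval (fun=> 0))); rewrite !mevalM mevalXU !mul0r meval1 => /eqP.
by rewrite eq_sym oner_eq0.
Qed.

(** The equation of the quintic, divided by [(C_0 C_1 C_2)^2]. *)
Lemma quintic_relation :
  f * ((k 0 * al * (k 2 * k 3) ^+ 2) *: C 2 ^+ 2 + (k 0 * be * (k 1 * k 3) ^+ 2) *: C 1 ^+ 2
    + (k 0 * ga * (k 1 * k 2) ^+ 2) *: C 0 ^+ 2) + (k 1 * k 2 * k 3) *: (q \mPo F) = 0.
Proof.
have T0 : (C 0 * C 1 * C 2) ^+ 2 != 0 by rewrite expf_neq0 // !mulf_neq0 ?(triangle_neq0 tri).
apply: (mulfI T0); rewrite mulr0 -[RHS]QF /Q /quintic !expr2.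
rewrite !(comp_mpolyD, comp_mpolyZ, comp_mpolyM, comp_mpolyXE) F0 F1 F2 F3.
by rewrite -!mul_mpolyC !mpolyCM; ring.
Qed.

Lemma quadric_comp : q \mPo F =
  (l 0 * k 0 ^+ 2) *: (f * f) + (l 1 * k 1 ^+ 2) *: (C 0 * C 1 * (C 0 * C 1))
  + (l 2 * k 2 ^+ 2) *: (C 0 * C 2 * (C 0 * C 2)) + (l 3 * k 3 ^+ 2) *: (C 1 * C 2 * (C 1 * C 2))
  + (e 0 1 * (k 0 * k 1)) *: (f * (C 0 * C 1)) + (e 0 2 * (k 0 * k 2)) *: (f * (C 0 * C 2))
  + (e 0 3 * (k 0 * k 3)) *: (f * (C 1 * C 2)) + (e 1 2 * (k 1 * k 2)) *: (C 0 * C 1 * (C 0 * C 2))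
  + (e 1 3 * (k 1 * k 3)) *: (C 0 * C 1 * (C 1 * C 2))
  + (e 2 3 * (k 2 * k 3)) *: (C 0 * C 2 * (C 1 * C 2)).
Proof.
rewrite /q /quadric !(comp_mpolyD, comp_mpolyZ, comp_mpolyM, comp_mpolyXE) F0 F1 F2 F3.
by rewrite !expr2 -!mul_mpolyC !mpolyCM; ring.
Qed.

Let CN m m' : m != m' -> (C m).@[p (N m') 0] = 0.
Proof.
by move=> mm; apply: (triangle_van tri); apply: (triangle_N_neq tri); rewrite eq_sym.
Qed.

Let fN m : f.@[p (N m) 0] = 0.
Proof. exact/mult_ge1/(mult_ge_leq _ (f2 _)). Qed.

Let scalar0 a i j m : k i * a * (k j * k m) ^+ 2 = 0 -> a = 0.
Proof.
move=> /eqP; rewrite !mulf_eq0 (negPf (k0 i)) orFb !(negPf (k0 _)) !orbF.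
by move=> /eqP.
Qed.

(** If [X_3 ^+ 2] is missing from the quadratic form, then every term of the relation that
    is not a multiple of [C 0] is a multiple of [f]. By [no_relation_on_cubic], [al] and [be]
    vanish, and [X_1 X_2] divides [Q]. The two next cases are analogous. *)
Lemma quintic_eq0_l3 : l 3 = 0 -> Q = 0.
Proof.
move=> l3; have R := quintic_relation; rewrite quadric_comp l3 in R.
set kk := k 1 * k 2 * k 3 in R.
have [] := no_relation_on_cubic hf firr tri (i := 0) (j := 1) (l := 2)
  (a := k 0 * be * (k 1 * k 3) ^+ 2) (a' := k 0 * al * (k 2 * k 3) ^+ 2)
  (v := kk *: ((l 0 * k 0 ^+ 2) *: f + (e 0 3 * (k 0 * k 3)) *: (C 1 * C 2))) isT isT isT.
- by rewrite mevalZ mevalD !mevalZ mevalM fN (@CN 2 1 isT) !mulr0 addr0 mulr0.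
- by rewrite mevalZ mevalD !mevalZ mevalM fN (@CN 1 2 isT) mul0r !mulr0 addr0 mulr0.
- exists (- ((k 0 * ga * (k 1 * k 2) ^+ 2) *: (f * C 0) + kk *: (
    (l 1 * k 1 ^+ 2) *: (C 1 * (C 0 * C 1)) + (l 2 * k 2 ^+ 2) *: (C 2 * (C 0 * C 2))
    + (e 0 1 * (k 0 * k 1)) *: (f * C 1) + (e 0 2 * (k 0 * k 2)) *: (f * C 2)
    + (e 1 2 * (k 1 * k 2)) *: (C 1 * (C 0 * C 2)) + (e 1 3 * (k 1 * k 3)) *: (C 1 * (C 1 * C 2))
    + (e 2 3 * (k 2 * k 3)) *: (C 2 * (C 1 * C 2))))).
  apply/eqP; rewrite -subr_eq0 -R; apply/eqP.
  by rewrite !expr2 -!mul_mpolyC !mpolyCM; ring.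
move=> /scalar0 be0 /scalar0 al0.
apply: (@quintic_monomial_factor 1 2 (ga *: ('X_0 * 'X_1 * 'X_2) + 'X_3 * q)).
by rewrite /Q /quintic be0 al0 !scale0r; rewrite -!mul_mpolyC; ring.
Qed.

Lemma quintic_eq0_l2 : l 2 = 0 -> Q = 0.
Proof.
move=> l2; have R := quintic_relation; rewrite quadric_comp l2 in R.
set kk := k 1 * k 2 * k 3 in R.
have [] := no_relation_on_cubic hf firr tri (i := 1) (j := 0) (l := 2)
  (a := k 0 * ga * (k 1 * k 2) ^+ 2) (a' := k 0 * al * (k 2 * k 3) ^+ 2)
  (v := kk *: ((l 0 * k 0 ^+ 2) *: f + (e 0 2 * (k 0 * k 2)) *: (C 0 * C 2))) isT isT isT.
- by rewrite mevalZ mevalD !mevalZ mevalM fN (@CN 2 0 isT) !mulr0 addr0 mulr0.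
- by rewrite mevalZ mevalD !mevalZ mevalM fN (@CN 0 2 isT) mul0r !mulr0 addr0 mulr0.
- exists (- ((k 0 * be * (k 1 * k 3) ^+ 2) *: (f * C 1) + kk *: (
    (l 1 * k 1 ^+ 2) *: (C 0 * (C 0 * C 1)) + (l 3 * k 3 ^+ 2) *: (C 2 * (C 1 * C 2))
    + (e 0 1 * (k 0 * k 1)) *: (f * C 0) + (e 0 3 * (k 0 * k 3)) *: (f * C 2)
    + (e 1 2 * (k 1 * k 2)) *: (C 0 * (C 0 * C 2)) + (e 1 3 * (k 1 * k 3)) *: (C 0 * (C 1 * C 2))
    + (e 2 3 * (k 2 * k 3)) *: (C 2 * (C 0 * C 2))))).
  apply/eqP; rewrite -subr_eq0 -R; apply/eqP.
  by rewrite !expr2 -!mul_mpolyC !mpolyCM; ring.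
move=> /scalar0 ga0 /scalar0 al0.
apply: (@quintic_monomial_factor 1 3 (be *: ('X_0 * 'X_1 * 'X_3) + 'X_2 * q)).
by rewrite /Q /quintic ga0 al0 !scale0r; rewrite -!mul_mpolyC; ring.
Qed.

Lemma quintic_eq0_l1 : l 1 = 0 -> Q = 0.
Proof.
move=> l1; have R := quintic_relation; rewrite quadric_comp l1 in R.
set kk := k 1 * k 2 * k 3 in R.
have [] := no_relation_on_cubic hf firr tri (i := 2) (j := 0) (l := 1)
  (a := k 0 * ga * (k 1 * k 2) ^+ 2) (a' := k 0 * be * (k 1 * k 3) ^+ 2)
  (v := kk *: ((l 0 * k 0 ^+ 2) *: f + (e 0 1 * (k 0 * k 1)) *: (C 0 * C 1))) isT isT isT.
- by rewrite mevalZ mevalD !mevalZ mevalM fN (@CN 1 0 isT) !mulr0 addr0 mulr0.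
- by rewrite mevalZ mevalD !mevalZ mevalM fN (@CN 0 1 isT) mul0r !mulr0 addr0 mulr0.
- exists (- ((k 0 * al * (k 2 * k 3) ^+ 2) *: (f * C 2) + kk *: (
    (l 2 * k 2 ^+ 2) *: (C 0 * (C 0 * C 2)) + (l 3 * k 3 ^+ 2) *: (C 1 * (C 1 * C 2))
    + (e 0 2 * (k 0 * k 2)) *: (f * C 0) + (e 0 3 * (k 0 * k 3)) *: (f * C 1)
    + (e 1 2 * (k 1 * k 2)) *: (C 0 * (C 0 * C 1)) + (e 1 3 * (k 1 * k 3)) *: (C 1 * (C 0 * C 1))
    + (e 2 3 * (k 2 * k 3)) *: (C 0 * (C 1 * C 2))))).
  apply/eqP; rewrite -subr_eq0 -R; apply/eqP.
  by rewrite !expr2 -!mul_mpolyC !mpolyCM; ring.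
move=> /scalar0 ga0 /scalar0 be0.
apply: (@quintic_monomial_factor 2 3 (al *: ('X_0 * 'X_2 * 'X_3) + 'X_1 * q)).
by rewrite /Q /quintic ga0 be0 !scale0r; rewrite -!mul_mpolyC; ring.
Qed.

(* If [X_0 ^+ 2] is missing, then [Q = X_0 M + X_1 X_2 X_3 R0]. *)
Let M : {mpoly K[4]} := al *: ('X_2 * 'X_3 * ('X_2 * 'X_3)) + be *: ('X_1 * 'X_3 * ('X_1 * 'X_3))
  + ga *: ('X_1 * 'X_2 * ('X_1 * 'X_2)) + e 0 1 *: ('X_1 * 'X_2 * ('X_1 * 'X_3))
  + e 0 2 *: ('X_1 * 'X_2 * ('X_2 * 'X_3)) + e 0 3 *: ('X_1 * 'X_3 * ('X_2 * 'X_3)).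
Let R0 : {mpoly K[4]} := l 1 *: ('X_1 * 'X_1) + l 2 *: ('X_2 * 'X_2) + l 3 *: ('X_3 * 'X_3)
  + e 1 2 *: ('X_1 * 'X_2) + e 1 3 *: ('X_1 * 'X_3) + e 2 3 *: ('X_2 * 'X_3).

(** If [X_0 ^+ 2] is missing, then [Q] has degree one in [X_0]: the quintic has a point
    of multiplicity four at the vertex [(1 : 0 : 0 : 0)]. Either [Q] has a monomial factor,
    or [F 0] is a rational function of [F 1], [F 2], [F 3], hence of the [C j]. An inverse of
    the map given by [F] would then yield an inverse of the map given by the net of cubics,
    which has none. *)
Lemma quintic_eq0_l0 d (S : 3.-tuple {mpoly K[4]}) h : l 0 = 0 -> h != 0 ->
  (forall i, tnth S i \is d.-homog) -> (forall i, tnth S i \mPo F = h * 'X_i) -> Q = 0.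
Proof.
move=> l0 h0 hS SF.
have QE : Q = 'X_0 * M + 'X_1 * 'X_2 * ('X_3 * R0).
  by rewrite /Q /quintic /q /quadric l0 /M /R0 !expr2 -!mul_mpolyC; ring.
have hM : M \is 4.-homog by rewrite /M !rpredD // dhomogZ //; exact: dhomogM (XX_homog _ _ _) (XX_homog _ _ _).
have hR : R0 \is 2.-homog by rewrite /R0 !rpredD // dhomogZ // XX_homog.
have hN : 'X_1 * 'X_2 * ('X_3 * R0) \is 5.-homog by apply: dhomogM (XX_homog _ _ _) (dhomogM (X_homog _ _) hR).
have hQ : Q \is 5.-homog by rewrite QE rpredD //; apply: dhomogM (X_homog _ _) hM.
have [M0|M0] := eqVneq M 0.
  by apply: (@quintic_monomial_factor 1 2 ('X_3 * R0)); rewrite QE M0 mulr0 add0r.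
have [MF|MF] := eqVneq (M \mPo F) 0.
  apply/eqP; apply: contraT => Q0.
  have := dvd_msize M0 (Qgen MF).
  by rewrite (homog_msize Q0 hQ) (homog_msize M0 hM).
pose Psi : 4.-tuple {mpoly K[3]} := [tuple 0; k 1 *: ('X_0 * 'X_1); k 2 *: ('X_0 * 'X_2); k 3 *: ('X_1 * 'X_2)].
have hPsi j : tnth Psi j \is 2.-homog.
  by move: j; apply: ord4_cases; rewrite ?dhomogZ ?XX_homog // rpred0.
pose m := M \mPo Psi; pose Y := [tuple C j | j < 3].
have [P1 P2 P3] : [/\ tnth Psi 1 \mPo Y = tnth F 1, tnth Psi 2 \mPo Y = tnth F 2 & tnth Psi 3 \mPo Y = tnth F 3].
  by rewrite F1 F2 F3; split; rewrite !comp_mpolyZ !comp_mpolyM !comp_mpolyXE !tnth_mktuple.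
have mY : m \mPo Y = M \mPo F.
  rewrite /m comp_mpolyA /M !(comp_mpolyD, comp_mpolyZ, comp_mpolyM, comp_mpolyXE).
  by rewrite !tnth_mktuple P1 P2 P3.
have NY : (('X_1 * 'X_2 * ('X_3 * R0)) \mPo Psi) \mPo Y = ('X_1 * 'X_2 * ('X_3 * R0)) \mPo F.
  rewrite comp_mpolyA /R0 !(comp_mpolyD, comp_mpolyZ, comp_mpolyM, comp_mpolyXE).
  by rewrite !tnth_mktuple P1 P2 P3.
pose Phi : 4.-tuple {mpoly K[3]} := [tuple if j == 0 then - (('X_1 * 'X_2 * ('X_3 * R0)) \mPo Psi)
  else m * tnth Psi j | j < 4].
have hPhi j : tnth Phi j \is 10.-homog.
  rewrite tnth_mktuple; case: ifP => _; last exact: dhomogM (comp_homog hM hPsi) (hPsi j).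
  by rewrite rpredN; apply: (comp_homog hN hPsi).
have PhiY j : tnth Phi j \mPo Y = (M \mPo F) * tnth F j.
  rewrite tnth_mktuple; move: j; apply: ord4_cases => /=.
  - rewrite raddfN /= NY; have /eqP := QF.
    rewrite QE comp_mpolyD comp_mpolyM comp_mpolyXE addrC addr_eq0 => /eqP ->.
    by rewrite opprK mulrC.
  - by rewrite comp_mpolyM mY P1.
  - by rewrite comp_mpolyM mY P2.
  - by rewrite comp_mpolyM mY P3.
case: (triangle_not_birational hf firr p0 pinj f2 tri (e := d * 10)
  (S := fun i => tnth S i \mPo Phi) (H := (M \mPo F) ^+ d * h)) => [i||i].
- exact: comp_homog.
- by rewrite mulf_neq0 // expf_neq0.
- rewrite comp_mpolyA (comp_homog_scale (W := F) (c := M \mPo F) (hS i)); first by rewrite SF mulrA.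
  by move=> j; rewrite tnth_mktuple PhiY.
Qed.

End EnriquesEquation.

(** * The Enriques sextic *)

Section CuboCubic.
Variable K : numClosedFieldType.
Variables (F : 4.-tuple {mpoly K[3]}) (al be ga : K) (l : 'I_4 -> K) (e : 'I_4 -> 'I_4 -> K).
Let Q := quintic al be ga (quadric l e).
Let G := [tuple tnth cubo_cubic j \mPo F | j < 4].
Let P : {mpoly K[4]} := 'X_0 * 'X_1 * 'X_2 * 'X_3.

(** The quadratic form of the sextic. The involution takes the squares in the quadratic
    form of the quintic to the four square terms of the sextic, the terms in [al], [be],
    [ga] to squares of coordinates, and each mixed term to the mixed term of the
    complementary pair of coordinates. *)
Definition residual_quadric : {mpoly K[4]} :=
  al *: ('X_1 * 'X_1) + be *: ('X_2 * 'X_2) + ga *: ('X_3 * 'X_3)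
  + e 2 3 *: ('X_0 * 'X_1) + e 1 3 *: ('X_0 * 'X_2) + e 1 2 *: ('X_0 * 'X_3)
  + e 0 1 *: ('X_2 * 'X_3) + e 0 2 *: ('X_1 * 'X_3) + e 0 3 *: ('X_1 * 'X_2).

Let E := enriques_sextic l residual_quadric.

Lemma residual_quadric_homog : residual_quadric \is 2.-homog.
Proof.
by rewrite /residual_quadric !rpredD // dhomogZ // XX_homog.
Qed.

Lemma residual_quadric_vertex : residual_quadric.@[fun i => (i == 0)%:R] = 0.
Proof.
by rewrite /residual_quadric !mevalD !mevalZ !mevalM !mevalXU /= !(mulr0, mul0r, addr0).
Qed.

Lemma quintic_cubo_cubic : Q \mPo cubo_cubic = P ^+ 2 * 'X_0 * E.
Proof.
have [c0 c1 c2 c3] := tnth_cubo_cubic K.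
rewrite /Q /quintic /quadric /E /enriques_sextic /residual_quadric /P !expr2.
rewrite !(comp_mpolyD, comp_mpolyZ, comp_mpolyM, comp_mpolyXE) c0 c1 c2 c3.
by rewrite -!mul_mpolyC; ring.
Qed.

Lemma sextic_cubo_cubic : E \mPo cubo_cubic = P ^+ 3 * 'X_0 * Q.
Proof.
have [c0 c1 c2 c3] := tnth_cubo_cubic K.
rewrite /Q /quintic /quadric /E /enriques_sextic /residual_quadric /P !expr2.
rewrite !(comp_mpolyD, comp_mpolyZ, comp_mpolyM, comp_mpolyXE) c0 c1 c2 c3.
by rewrite -!mul_mpolyC; ring.
Qed.

Lemma cubo_cubicK j : tnth cubo_cubic j \mPo cubo_cubic = P ^+ 2 * 'X_j.
Proof.
have [c0 c1 c2 c3] := tnth_cubo_cubic K.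
move: j; apply: ord4_cases; rewrite ?c0 ?c1 ?c2 ?c3 !comp_mpolyM !comp_mpolyXE ?c0 ?c1 ?c2 ?c3 /P; ring.
Qed.

Lemma cubo_cubicK_homog g d : g \is d.-homog ->
  (g \mPo cubo_cubic) \mPo cubo_cubic = P ^+ (2 * d) * g.
Proof.
move=> hg; rewrite comp_mpolyA exprM.
rewrite (comp_homog_scale (W := [tuple 'X_j | j < 4]) (c := P ^+ 2) hg) => [|j].
  by rewrite comp_mpoly_id.
by rewrite !tnth_mktuple cubo_cubicK.
Qed.

Lemma comp_cubo_cubic g : g \mPo G = (g \mPo cubo_cubic) \mPo F.
Proof. by rewrite comp_mpolyA. Qed.

Hypothesis FQ : birational_onto F Q.
Hypothesis hF : forall j, tnth F j \is 6.-homog.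
Hypothesis F0 : forall j, tnth F j != 0.
Hypothesis l_neq0 : Q != 0 -> forall i, l i != 0.

(** At the point with [X_i = 0] and all other coordinates [1], the sextic has value
    [l i]. *)
Lemma sextic_coordinate_ndvd i : Q != 0 -> ~ divides 'X_i E.
Proof.
move=> /l_neq0/(_ i) li [v Ev].
have := congr1 (meval (fun j => (j != i)%:R)) Ev.
rewrite mevalM mevalXU eqxx mul0r => /eqP; apply/negP.
rewrite /E /enriques_sextic !expr2 !mevalD !mevalZ !mevalM !mevalXU; move: i li {v Ev}.
by apply: ord4_cases => li /=; rewrite !(mul0r, mulr0, mulr1, add0r, addr0).
Qed.

Lemma sextic_cancel_coordinate i g : divides E ('X_i * g) -> divides E g.
Proof.
move=> [v Ev]; have [Q0|Q0] := eqVneq Q 0.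
  have E0 : E = 0.
    have /eqP := quintic_cubo_cubic; rewrite Q0 comp_mpoly0 eq_sym mulf_eq0.
    rewrite (negPf (_ : P ^+ 2 * 'X_0 != 0)) => [/eqP//|].
    by rewrite /P !mulf_neq0 ?X_neq0 // expf_neq0 // !mulf_neq0 ?X_neq0.
  exists 0; rewrite mulr0; apply/eqP; move/eqP: Ev.
  by rewrite E0 mul0r mulf_eq0 (negPf (X_neq0 _ _)).
have [/(sextic_coordinate_ndvd Q0)//|[w Ew]] := prime_X (ex_intro _ g (esym Ev)).
by exists w; apply: (mulfI (X_neq0 K i)); rewrite Ev Ew; ring.
Qed.

Lemma sextic_cancel g n : divides E (P ^+ n * g) -> divides E g.
Proof.
elim: n => [|n IH]; first by rewrite mul1r.
have -> : P ^+ n.+1 * g = 'X_0 * ('X_1 * ('X_2 * ('X_3 * (P ^+ n * g)))).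
  by rewrite exprS {1}/P; ring.
by do 4!move/sextic_cancel_coordinate; exact: IH.
Qed.

(** If [g] vanishes on the image, then [g] composed with the involution is a multiple of
    [Q]. Composing again multiplies a homogeneous [g] by a power of [P], and turns the
    multiple of [Q] into a multiple of [E], from which the coordinates cancel. *)
Lemma enriques_image_equation : image_equation G E.
Proof.
have [FE _] := FQ; have QF : Q \mPo F = 0 by apply/FE; exists 1; rewrite mulr1.
move=> g; split=> [gG|[u ->]]; last first.
  rewrite comp_mpolyM [X in X * _]comp_cubo_cubic sextic_cubo_cubic.
  by rewrite [X in X * _]comp_mpolyM QF mulr0 mul0r.
rewrite (pihomog_partitionE (leqnn (mmeasure mdeg g))).
apply: dvdr_sum => d _; set gd := pihomog mdeg d g.
have hgd : gd \is d.-homog by apply: pihomogP.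
have hG j : tnth G j \is 18.-homog.
  by rewrite tnth_mktuple; apply: (comp_homog (cubo_cubic_homog K j) hF).
have gdG : gd \mPo G = 0 by exact: (comp_mpoly_homog_components _ hG gG).
have [u Eu] : divides Q (gd \mPo cubo_cubic) by apply/FE; rewrite -comp_cubo_cubic.
apply: (@sextic_cancel _ (2 * d)); exists (P ^+ 2 * 'X_0 * (u \mPo cubo_cubic)).
by rewrite -(cubo_cubicK_homog hgd) Eu comp_mpolyM quintic_cubo_cubic; ring.
Qed.

Lemma enriques_birational : birational_onto_image G.
Proof.
have [_ [d [S [h [h0 hS SF]]]]] := FQ.
exists (d * 3)%N, [tuple tnth S i \mPo cubo_cubic | i < 3], ((P \mPo F) ^+ (2 * d) * h); split.
- by rewrite mulf_neq0 // expf_neq0 // /P !comp_mpolyM !comp_mpolyXE !mulf_neq0.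
- by move=> i; rewrite tnth_mktuple; apply: (comp_homog (hS i)) => j; apply: cubo_cubic_homog.
- move=> i; rewrite tnth_mktuple comp_cubo_cubic (cubo_cubicK_homog (hS i)).
  by rewrite comp_mpolyM rmorphXn /= SF mulrA.
Qed.

End CuboCubic.

Theorem quintic_to_enriques_sextic (K : numClosedFieldType)
    (f : {mpoly K[3]}) (p : 'I_10 -> 'rV[K]_3)
    (F : 4.-tuple {mpoly K[3]})
    (alpha beta gamma : K) (q : {mpoly K[4]}) :
  f \is 6.-homog -> irreducible_mpoly f -> ten_nodes f p ->
  basis_of_sections p 6 H_mult F ->
  q \is 2.-homog -> birational_onto F (quintic alpha beta gamma q) ->
  adapted_coordinates p F ->
  let G := [tuple tnth cubo_cubic j \mPo F | j < 4] in
  (exists (l : 'I_4 -> K) (qh : {mpoly K[4]}),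
     [/\ qh \is 2.-homog, qh.@[fun k => (k == 0)%:R] = 0
       & birational_onto G (enriques_sextic l qh)]) /\
  realized_by p 9 H'_mult G.
Proof.
move=> hf firr /ten_nodes_spec[p0 pinj f2 f3] FB hq FQ FA G.
have [N [C [k [tri k0 [F0 F1 F2 F3]]]]] := quintic_coordinates hf firr p0 pinj f2 FB FA.
split; last exact: (enriques_realized hf firr p0 pinj f2 f3 tri k0 F0 F1 F2 F3).
have [l [e Eq]] := quadricP hq; rewrite {}Eq in FQ.
have [FE [d [S [h [h0 hS SF]]]]] := FQ.
have QF : quintic alpha beta gamma (quadric l e) \mPo F = 0 by apply/FE; exists 1; rewrite mulr1.
have Qgen g : g \mPo F = 0 -> divides (quintic alpha beta gamma (quadric l e)) g by move/FE.
have l_neq0 : quintic alpha beta gamma (quadric l e) != 0 -> forall i, l i != 0.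
  move=> Q0 i; apply: contraNneq Q0 => li; apply/eqP; move: i li; apply: ord4_cases => li.
  - exact: (quintic_eq0_l0 hf firr p0 pinj f2 tri k0 F0 F1 F2 F3 QF Qgen li h0 hS SF).
  - exact: (quintic_eq0_l1 hf firr f2 tri k0 F0 F1 F2 F3 QF Qgen li).
  - exact: (quintic_eq0_l2 hf firr f2 tri k0 F0 F1 F2 F3 QF Qgen li).
  - exact: (quintic_eq0_l3 hf firr f2 tri k0 F0 F1 F2 F3 QF Qgen li).
have Fh j : tnth F j \is 6.-homog by case: FB => /(_ j)[].
have Fn j := coordinate_neq0 firr tri k0 F0 F1 F2 F3 j.
exists l, (residual_quadric alpha beta gamma e); split.
- exact: residual_quadric_homog.
- exact: residual_quadric_vertex.
- split; first exact: (enriques_image_equation FQ Fh l_neq0).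
  exact: (enriques_birational FQ Fn).
Qed.

Theorem proposition55 (R : realType)
    (f : {mpoly R[i][3]}) (p : 'I_10 -> 'rV[R[i]]_3)
    (F : 4.-tuple {mpoly R[i][3]})
    (alpha beta gamma : R[i]) (q : {mpoly R[i][4]}) :
  f \is 6.-homog -> irreducible_mpoly f -> ten_nodes f p ->
  basis_of_sections p 6 H_mult F ->
  q \is 2.-homog -> birational_onto F (quintic alpha beta gamma q) ->
  adapted_coordinates p F ->
  let G := [tuple tnth cubo_cubic j \mPo F | j < 4] in
  (exists (l : 'I_4 -> R[i]) (qh : {mpoly R[i][4]}),
     [/\ qh \is 2.-homog, qh.@[fun k => (k == 0)%:R] = 0
       & birational_onto G (enriques_sextic l qh)]) /\
  realized_by p 9 H'_mult G.
Proof. exact: quintic_to_enriques_sextic. Qed.
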